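(* There exist universal constants $C_1,C_2,C_3>0$ such that the following holds. Let $n,d$ be positive integers, $p\in(0,1]$, $\sigma>0$ and $Z^*\in\Pi_d^n$, and consider the permutation synchronization model with parameters $(n,d,p,\sigma,Z^* )$, with the anchor $M$ and the matrix $H=U^\top U^*$ as defined in the context. If $\frac{np}{\log n}>C_1$ and $\frac{np}{(\sqrt d+\sigma d)^2}>C_2$, then with probability at least $1-n^{-10}$, $$\min_{P\in\Pi_d}\|M-PH^\top\|_{\mathrm F}\le\frac{C_3(\sqrt d+\sigma d)}{\sqrt{np}}.$$
   Context: $\Pi_d$ is the set of $d\times d$ permutation matrices; $\|\cdot\|_{\mathrm F}$ is the Frobenius norm; $n\ge2$. Universal constants do not depend on $n,d,p,\sigma,Z^*$. Model: $Z^*=(Z_1^{*\top},\dots,Z_n^{*\top})^\top$ with $Z_j^*\in\Pi_d$. For $1\le j<k\le n$, $A_{jk}\sim\mathrm{Bernoulli}(p)$ and $W_{jk}\in\mathbb{R}^{d\times d}$ has i.i.d. standard normal entries, all mutually independent. $X_{jk}=Z_j^*(Z_k^* )^\top+\sigma W_{jk}$ if $A_{jk}=1$ and $X_{jk}=0_{d\times d}$ if $A_{jk}=0$; $X_{kj}=X_{jk}^\top$, $X_{jj}=0$; $X\in\mathbb{R}^{nd\times nd}$ is the symmetric block matrix with blocks $X_{jk}$. $U\in\mathbb{R}^{nd\times d}$ has as columns orthonormal eigenvectors of $X$ for its $d$ largest eigenvalues. $U^*=(U_1^{*\top},\dots,U_n^{*\top})^\top\in\mathbb{R}^{nd\times d}$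 with $U_j^*=Z_j^*/\sqrt n$. $H=U^\top U^*\in\mathbb{R}^{d\times d}$. Anchor: let $v_1^\top,\dots,v_{nd}^\top$ be the rows of $U$ and $(\hat\mu_1,\dots,\hat\mu_d)\in\operatorname{argmin}_{\mu_1,\dots,\mu_d\in\mathbb{R}^d}\min_{z\in[d]^{nd}}\sum_{i=1}^{nd}\|v_i-\mu_{z_i}\|^2$ (exact $d$-means); $M\in\mathbb{R}^{d\times d}$ is the matrix with rows $\sqrt n\hat\mu_1^\top,\dots,\sqrt n\hat\mu_d^\top$. *)

(* Defs.v *)
From HB Require Import structures.
From mathcomp Require Import all_boot all_order all_algebra.
From mathcomp Require Import all_classical all_reals all_analysis.

Set Implicit Arguments.
Unset Strict Implicit.
Unset Printing Implicit Defensive.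

Import Order.TTheory GRing.Theory Num.Theory.
Import numFieldNormedType.Exports.

Local Open Scope classical_set_scope.
Local Open Scope ring_scope.

Section Matrices.
Context {R : realType}.

(* The norm `|A| of MathComp-Analysis is the entrywise maximum, hence: *)
Definition frobenius_norm m n (A : 'M[R]_(m, n)) : R :=
  Num.sqrt (\sum_i \sum_j A i j ^+ 2).

(* The range is finite and (for the identity) nonempty: inf is a minimum. *)
Definition min_over_perms d (f : 'M[R]_d -> R) : R :=
  inf [set f Q | Q in [set Q : 'M[R]_d | is_perm_mx Q]].

(* The list s enumerates the eigenvalues of X with multiplicity, its first d
   entries being the d largest ones; their relative order is free, so that the
   columns of U may be listed in any order. *)
Definition top_eigenvectors m d (X : 'M[R]_m) (U : 'M[R]_(m, d)) : Prop :=
  U^T *m U = 1%:M /\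
  exists s : seq R,
    [/\ char_poly X = \prod_(a <- s) ('X - a%:P),
        (forall i j : nat, (i < d)%N -> (d <= j < size s)%N -> s`_j <= s`_i)
      & forall j : 'I_d, X *m col j U = s`_j *: col j U].

Definition kmeans_cost m d (V : 'M[R]_(m, d)) (mu : 'I_d -> 'rV[R]_d)
    (z : 'I_m -> 'I_d) : R :=
  \sum_i frobenius_norm (row i V - mu (z i)) ^+ 2.

(* There are finitely many labelings z: inf is a minimum for 0 < d. *)
Definition kmeans_loss m d (V : 'M[R]_(m, d)) (mu : 'I_d -> 'rV[R]_d) : R :=
  inf [set kmeans_cost V mu z | z in [set: 'I_m -> 'I_d]].

Definition kmeans_centers m d (V : 'M[R]_(m, d)) (mu : 'I_d -> 'rV[R]_d) :=
  forall mu', kmeans_loss V mu <= kmeans_loss V mu'.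

Definition is_anchor n d (U : 'M[R]_(\sum_(j < n) d, d)) (M : 'M[R]_d) : Prop :=
  exists mu : 'I_d -> 'rV[R]_d,
    kmeans_centers U mu /\ forall k, row k M = Num.sqrt n%:R *: mu k.

Definition stacked_truth n d (Z : 'I_n -> 'M[R]_d) :
    'M[R]_(\sum_(j < n) d, d) :=
  \mxcol_(j < n) ((Num.sqrt n%:R)^-1 *: Z j).

End Matrices.

Section Probability.
Context {R : realType} {dT : measure_display} {T : measurableType dT}.
Variable P : probability T R.

(* Laws are compared on measurable sets only: the values of a measure at other
   sets are unspecified. *)
Definition has_law dE (E : measurableType dE) (X : {RV P >-> E})
    (Q : set E -> \bar R) : Prop :=
  forall B, measurable B -> distribution P X B = Q B.

Definition mutually_independent (I : finType) (F : I -> set (set T)) : Prop :=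
  forall (J : {set I}) (B : I -> set T),
    (forall i, i \in J -> F i (B i)) ->
    P (\bigcap_(i in [set` J]) B i) = (\prod_(i in J) P (B i))%E.

(* For events that need not be measurable. *)
Definition with_probability_at_least (q : R) (E : set T) : Prop :=
  exists B, [/\ measurable B, B `<=` E & (q%:E <= P B)%E].

(* Families indexed by all of 'I_n * 'I_n are used at pairs j < k only. *)
Definition edge n := {e : 'I_n * 'I_n | (e.1 < e.2)%N}.

Section Model.
Variables (n d : nat).
Variables (A : 'I_n -> 'I_n -> {RV P >-> bool}).
Variables (W : 'I_n -> 'I_n -> 'I_d -> 'I_d -> {RV P >-> R}).

Definition noise_sigma_algebra (i : edge n + edge n * ('I_d * 'I_d)) :
    set (set T) :=
  match i with
  | inl e => g_sigma_algebra_preimage (A (val e).1 (val e).2)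
  | inr (e, (a, b)) => g_sigma_algebra_preimage (W (val e).1 (val e).2 a b)
  end.

Definition perm_sync_noise (p : R) : Prop :=
  [/\ forall j k : 'I_n, (j < k)%N -> has_law (A j k) (bernoulli_prob p),
      forall (j k : 'I_n) a b, (j < k)%N -> has_law (W j k a b) (normal_prob 0 1)
    & mutually_independent noise_sigma_algebra].

Definition upper_block (sigma : R) (Z : 'I_n -> 'M[R]_d) (j k : 'I_n) (w : T) :
    'M[R]_d :=
  if A j k w then Z j *m (Z k)^T + sigma *: \matrix_(a, b) W j k a b w else 0.

Definition perm_sync_data (sigma : R) (Z : 'I_n -> 'M[R]_d) (w : T) :
    'M[R]_(\sum_(j < n) d) :=
  \mxblock_(j < n, k < n)
    (if (j < k)%N then upper_block sigma Z j k w
     else if (k < j)%N then (upper_block sigma Z k j w)^T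
     else 0).

End Model.
End Probability.

(* Main.v *)
(* Relabelling the rows of each block by the true permutation turns X into
   D U* U*^T - p I + E with D = np, where E is assembled from d^2 + 1 sparse n x n
   matrices with independent centered entries above the diagonal: the centered
   adjacency matrix, and one Gaussian matrix for each pair of labels.

   Each of these matrices N has norm O(sqrt D) outside an event of probability
   n^-13. This follows from a bound on E tr (N N^T)^m with m of order D: grouping
   the closed walks in the trace by coincidence pattern compares it with the same
   trace for a dense matrix of size of order D whose entries have a fixed
   subgaussian law, and the latter is bounded by exponential moments of bilinear
   forms on a lattice net.

   Since U maximizes tr (V^T X V) over isometries V (Ky Fan), the bounds on the
   noise give |U - U* H^T|_F^2 <= B with B of order (sqrt d + sigma d)^2 / D. The
   rows of U* H^T take only the d values h_a / sqrt n, h_a the rows of H^T, so the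
   optimal d-means cost is at most B; the h_a being well separated, each of them
   is matched with one center, and averaging over each true cluster gives the
   bound on the anchor. *)
Require Import Defs.
From HB Require Import structures.
From mathcomp Require Import all_boot all_order all_algebra.
From mathcomp Require Import all_classical all_reals all_analysis.
From mathcomp Require Import perm measurable_realfun complex ring lra zify.

Set Implicit Arguments.
Unset Strict Implicit.
Unset Printing Implicit Defensive.

Import Order.TTheory GRing.Theory Num.Theory.
Import numFieldNormedType.Exports.

Local Open Scope classical_set_scope.
Local Open Scope ring_scope.

(** * Closed walks *)

(** The norm bound must carry no logarithmic factor although D is only assumed to be of order log n,
    and the entries [A W] are unbounded. The dense size r has to be at least D for the patterns to
    be matched, and a net in dimension r costs exp(O(r)), which an m-th root absorbs only when m is
    of order r. This is why m is of order D and not of order log n; exp(-m) is then a small power of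
    1/n because D >= 18 log n.

    The comparison is made term by term, for edges of every multiplicity, so the dense law needs
    nonnegative moments dominating those of the noise. A symmetric law has vanishing odd moments,
    unlike the centered Bernoulli law in general: hence a skewed law built by hand.

    The noise matrices are kept strictly upper triangular instead of symmetric. Their entries above
    the diagonal are then independent, and the missing half of E is restored by transposition. The
    union over d^2 + 1 matrices is affordable because the assumptions imply d <= np <= n. *)

Section WalkCounting.
Local Open Scope set_scope.

Section Walks.
Variables (L : nat) (T : finType).
Implicit Types t : {ffun 'I_L.+1 -> T}.

(* Odd steps are read backwards, so that a closed walk of even length indexes a
   term of the expansion of a power of N N^T for a nonsymmetric N. *)
Definition walk_edge t (i : 'I_L) : T * T :=
  let x := t (lift ord_max i) in let y := t (lift ord0 i) in
  if odd i then (y, x) else (x, y).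

Definition closed_walk t := t ord0 == t ord_max.

Definition edge_count t (e : T * T) := #|[set i | walk_edge t i == e]|.
Definition nb_edges t := #|[set walk_edge t i | i : 'I_L]|.
Definition nb_vertices t := #|[set t i | i : 'I_L.+1]|.

Lemma edge_count_eq0 t e :
  (edge_count t e == 0%N) = (e \notin [set walk_edge t i | i : 'I_L]).
Proof.
rewrite cards_eq0; apply/eqP/idP => [h0|].
  apply/negP => /imsetP[i _ ei].
  by move/setP/(_ i): h0; rewrite !inE ei eqxx.
move=> eN; apply/setP => i; rewrite !inE; apply/negP => /eqP ei.
by move/negP: eN; apply; apply/imsetP; exists i.
Qed.

End Walks.

(** Induction along the walk: a step reaching a new vertex uses a new edge, since both endpoints of
    an earlier edge have been visited. Reversing the odd steps only swaps endpoints. *)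
Lemma prefix_vertices (L : nat) (T : finType) (t : {ffun 'I_L.+1 -> T}) (k : nat) :
  (k <= L)%N ->
  (#|[set t i | i : 'I_L.+1 & (i <= k)%N]| <=
   #|[set walk_edge t i | i : 'I_L & (i < k)%N]|.+1)%N.
Proof.
elim: k => [|k IH] kL.
  rewrite (_ : [set t i | i : 'I_L.+1 & (i <= 0)%N] = [set t ord0]) ?cards1//.
  apply/setP => x; rewrite inE; apply/imsetP/eqP => [[i ]|->].
    by rewrite inE leqn0 => /eqP i0 ->; congr (t _); exact/val_inj.
  by exists ord0; rewrite ?inE.
have {}IH := IH (ltnW kL).
pose i0 : 'I_L := Ordinal kL.
set A := [set t i | i : 'I_L.+1 & (i <= k)%N] in IH *.
set B := [set walk_edge t i | i : 'I_L & (i < k)%N] in IH *.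
have tE : [set t i | i : 'I_L.+1 & (i <= k.+1)%N] = t (lift ord0 i0) |: A.
  apply/setP => x; rewrite !inE; apply/imsetP/orP.
    move=> [i ]; rewrite inE leq_eqVlt => /orP[/eqP ik|ik] ->.
      by left; apply/eqP; congr (t _); exact/val_inj.
    by right; apply/imsetP; exists i; rewrite ?inE.
  case=> [/eqP ->|/imsetP[i ]].
    by exists (lift ord0 i0); rewrite ?inE.
  by rewrite inE => ik ->; exists i; rewrite ?inE// ltnW.
have eE : [set walk_edge t i | i : 'I_L & (i < k.+1)%N] = walk_edge t i0 |: B.
  apply/setP => x; rewrite !inE; apply/imsetP/orP.
    move=> [i ]; rewrite inE ltnS leq_eqVlt => /orP[/eqP ik|ik] ->.
      by left; apply/eqP; congr (walk_edge t _); exact/val_inj.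
    by right; apply/imsetP; exists i; rewrite ?inE.
  case=> [/eqP ->|/imsetP[i ]].
    by exists i0; rewrite ?inE/=.
  by rewrite inE => ik ->; exists i; rewrite ?inE// ltnW.
rewrite tE eE !cardsU1.
have [tA|tA] := boolP (t (lift ord0 i0) \in A); first by rewrite add0n; lia.
suff -> : walk_edge t i0 \notin B by lia.
apply/negP => /imsetP[i ]; rewrite inE => ik eq_e.
have inA : forall j : 'I_L.+1, (j <= k)%N -> t j \in A.
  by move=> j jk; apply/imsetP; exists j; rewrite ?inE.
have lA : t (lift ord_max i) \in A by apply: inA; rewrite lift_max ltnW.
have rA : t (lift ord0 i) \in A by apply: inA.
move/negP: tA; apply.
move: eq_e; rewrite /walk_edge; case: ifP => _; case: ifP => _ [] e1 e2;
  by [rewrite e1|rewrite e2].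
Qed.

Lemma nb_vertices_le (L : nat) (T : finType) (t : {ffun 'I_L.+1 -> T}) :
  (nb_vertices t <= (nb_edges t).+1)%N.
Proof.
have := prefix_vertices t (leqnn L); congr (_ <= _.+1)%N; apply: eq_card => x.
  by apply/imsetP/imsetP => -[i iL ->]; exists i; rewrite // inE -ltnS ltn_ord.
by apply/imsetP/imsetP => -[i iL ->]; exists i; rewrite // inE ltn_ord.
Qed.

(** Indexing the product by the times at which an edge is first used makes it depend on the
    coincidence pattern only, so that it can be compared between walks on different vertex sets. *)
Lemma prod_first_visit (L : nat) (T : finType) (t : {ffun 'I_L.+1 -> T})
    (R : comPzRingType) (M : nat -> R) : M 0%N = 1 ->
  \prod_e M (edge_count t e) =
  \prod_(i : 'I_L | [forall j : 'I_L, (j < i)%N ==> (walk_edge t j != walk_edge t i)])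
     M (edge_count t (walk_edge t i)).
Proof.
move=> M0; pose first (i : 'I_L) :=
  [forall j : 'I_L, (j < i)%N ==> (walk_edge t j != walk_edge t i)].
have inj : {in [set i | first i] &, injective (walk_edge t)}.
  move=> i j; rewrite !inE => /forallP fi /forallP fj e; apply/val_inj => /=.
  have := fi j; have := fj i; rewrite e eqxx /= !implybF -!leqNgt => ij ji.
  by apply/eqP; rewrite eqn_leq ij ji.
transitivity (\prod_(e in [set walk_edge t i | i in [set i | first i]])
    M (edge_count t e)); last first.
  by rewrite big_imset//=; apply: eq_bigl => i; rewrite inE.
rewrite [RHS]big_mkcond; apply: eq_bigr => e _; case: ifPn => // eN.
suff /eqP -> : edge_count t e == 0%N by [].
rewrite edge_count_eq0; apply: contra eN => /imsetP[i0 _ ->].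
have P0 : walk_edge t i0 == walk_edge t i0 by [].
pose i := [arg min_(i < i0 | walk_edge t i == walk_edge t i0) (i : nat)].
have [/eqP ei imin] : walk_edge t i == walk_edge t i0 /\
    forall j : 'I_L, walk_edge t j == walk_edge t i0 -> (i <= j)%N.
  by rewrite /i; case: arg_minnP.
apply/imsetP; exists i; rewrite // inE; apply/forallP => j; apply/implyP => ji.
by apply: contraL ji => /eqP ej; rewrite -leqNgt imin// ej ei.
Qed.

Definition same_pattern (I A B : finType) (t : {ffun I -> A}) (v : {ffun I -> B}) :=
  [forall i, forall j, (t i == t j) == (v i == v j)].

Lemma same_patternP (I A B : finType) (t : {ffun I -> A}) (v : {ffun I -> B}) :
  reflect (forall i j, (t i == t j) = (v i == v j)) (same_pattern t v).
Proof.
by apply: (iffP 'forall_'forall_eqP) => // h i j; exact: h.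
Qed.

Lemma same_pattern_sym (I A B : finType) (t : {ffun I -> A}) (v : {ffun I -> B}) :
  same_pattern t v = same_pattern v t.
Proof. by apply/same_patternP/same_patternP => h i j; rewrite h. Qed.

(** Every injection of the range of [t] into [B], composed with [t], has the pattern of [t]. *)
Lemma card_same_pattern_ge (I A B : finType) (t : {ffun I -> A}) :
  (#|B| ^_ #|[set t i | i : I]| <= #|[set v : {ffun I -> B} | same_pattern t v]|)%N.
Proof.
pose S : finType := {x : A | x \in [set t i | i : I]}.
have tS i : t i \in [set t i | i : I] by apply/imsetP; exists i.
have <- : #|S| = #|[set t i | i : I]| by rewrite card_sig.
rewrite -card_inj_ffuns.
pose f (phi : {ffun S -> B}) := [ffun i => phi (exist _ (t i) (tS i))].
have fI : injective f.
  move=> phi psi /ffunP e; apply/ffunP => -[x xS].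
  have /imsetP[i _ xi] := xS; have := e i; rewrite !ffunE.
  have -> : exist _ x xS = exist _ (t i) (tS i) :> S by apply/val_inj.
  by [].
rewrite -(card_imset _ fI); apply/subset_leq_card/fintype.subsetP => _ /imsetP[phi + ->].
rewrite !inE => /injectiveP phiI; apply/same_patternP => i j; rewrite !ffunE.
by rewrite (inj_eq phiI).
Qed.

Lemma card_same_pattern_le (I A B : finType) (t : {ffun I -> A}) :
  (#|[set v : {ffun I -> B} | same_pattern t v]| <= #|B| ^ #|[set t i | i : I]|)%N.
Proof.
pose S : finType := {x : A | x \in [set t i | i : I]}.
have tS i : t i \in [set t i | i : I] by apply/imsetP; exists i.
have <- : #|S| = #|[set t i | i : I]| by rewrite card_sig.
rewrite -card_ffun.
pose f (phi : {ffun S -> B}) := [ffun i => phi (exist _ (t i) (tS i))].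
rewrite -cardsT; apply: leq_trans (leq_imset_card f _).
apply/subset_leq_card/fintype.subsetP => v; rewrite inE => /same_patternP vt.
have rep (x : S) : exists i, t i == val x.
  by case: x => x /= /imsetP[i _ ->]; exists i.
apply/imsetP; exists [ffun x => v (xchoose (rep x))] => //.
apply/ffunP => i; rewrite !ffunE; apply/eqP; rewrite -vt.
by rewrite eq_sym (eqP (xchooseP (rep _))).
Qed.

Lemma card_imset_pattern (I A B : finType) (f : I -> A) (g : I -> B) :
  (forall i j, (f i == f j) = (g i == g j)) ->
  #|[set f i | i : I]| = #|[set g i | i : I]|.
Proof.
move=> fg; apply/eqP; rewrite eqn_leq.
wlog suff H : A B f g fg / (#|[set f i | i : I]| <= #|[set g i | i : I]|)%N.
  by rewrite !H.
pose h y := omap f [pick i | g i == y].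
have SI : injective (@Some A) by move=> x y [].
rewrite -(card_imset _ SI); apply: leq_trans (leq_imset_card h _).
apply/subset_leq_card/fintype.subsetP => _ /imsetP[_ /imsetP[i _ ->] ->].
apply/imsetP; exists (g i); first by apply/imsetP; exists i.
rewrite /h; case: pickP => [j gj|/(_ i)] /=; last by rewrite eqxx.
by congr Some; apply/eqP; rewrite fg eq_sym.
Qed.

Section PatternInvariance.
Variables (L : nat) (A B : finType).
Variables (t : {ffun 'I_L.+1 -> A}) (v : {ffun 'I_L.+1 -> B}).
Hypothesis tv : same_pattern t v.

Lemma same_pattern_closed : closed_walk t = closed_walk v.
Proof. by rewrite /closed_walk (same_patternP _ _ tv). Qed.

Lemma same_pattern_edge i j :
  (walk_edge t i == walk_edge t j) = (walk_edge v i == walk_edge v j).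
Proof.
rewrite /walk_edge; case: ifP => _; case: ifP => _;
  by rewrite !xpair_eqE !(same_patternP _ _ tv).
Qed.

Lemma same_pattern_vertices : nb_vertices t = nb_vertices v.
Proof. by apply: card_imset_pattern => i j; exact: (same_patternP _ _ tv). Qed.

Lemma same_pattern_edges : nb_edges t = nb_edges v.
Proof. by apply: card_imset_pattern => i j; exact: same_pattern_edge. Qed.

Lemma same_pattern_prod (R : comPzRingType) (M : nat -> R) : M 0%N = 1 ->
  \prod_e M (edge_count t e) = \prod_e M (edge_count v e).
Proof.
move=> M0; rewrite !prod_first_visit//; apply: eq_big => i.
  by apply: eq_forallb => j; rewrite same_pattern_edge.
move=> _; congr (M _); apply: eq_card => j.
by rewrite !inE same_pattern_edge.
Qed.

End PatternInvariance.

(** Each of the V factors of the falling factorial is at least D. The resulting D^V cancels the n^V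
    p^V of the sparse walks. *)
Lemma ffact_ge (R : numDomainType) (D : R) (r V : nat) :
  0 <= D -> D + V%:R <= r%:R -> D ^+ V <= (r ^_ V)%:R.
Proof.
move=> D0; elim: V => [|V IH] Dr; first by rewrite ffactn0 expr0.
rewrite ffactnSr natrM exprSr ler_pM// ?exprn_ge0//.
  by apply: IH; apply: le_trans Dr; rewrite lerD2l ler_nat.
have Vr : (V <= r)%N.
  rewrite -(ler_nat R) (le_trans _ Dr)// -[leLHS]add0r lerD// ler_nat.
  exact: leqnSn.
rewrite natrB// lerBrDr (le_trans _ Dr)// lerD2l ler_nat.
exact: leqnSn.
Qed.

Section WalkComparison.
Variables (R : realFieldType) (n r L : nat) (p : R) (M : nat -> R).
Hypotheses (n0 : (0 < n)%N) (p0 : 0 < p) (p1 : p <= 1) (M0 : M 0%N = 1).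
Hypotheses (Mge0 : forall k, 0 <= M k) (rL : n%:R * p + L.+1%:R <= r%:R).

Let walk_weight (A : finType) (t : {ffun 'I_L.+1 -> A}) : R :=
  \prod_e M (edge_count t e).

(* Double counting the pairs (t, v) of closed walks in [n] and in [r] with the
   same coincidence pattern: a pattern with V vertices has at least (np)^V
   representatives v and at most n^V representatives t, and connectedness gives
   p^(nb of edges) <= p^(V-1). *)
Lemma closed_walk_comparison :
  \sum_(t : {ffun 'I_L.+1 -> 'I_n} | closed_walk t) p ^+ nb_edges t * walk_weight t
  <= p^-1 * \sum_(v : {ffun 'I_L.+1 -> 'I_r} | closed_walk v) walk_weight v.
Proof.
pose D := n%:R * p; have D0 : 0 < D by rewrite mulr_gt0 ?ltr0n.
have W0 (A : finType) (t : {ffun 'I_L.+1 -> A}) : 0 <= walk_weight t.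
  by rewrite prodr_ge0.
pose w (t : {ffun 'I_L.+1 -> 'I_n}) := p ^+ nb_edges t * walk_weight t.
have w0 t : 0 <= w t by rewrite mulr_ge0 ?exprn_ge0// ltW.
pose sp (v : {ffun 'I_L.+1 -> 'I_r}) (t : {ffun 'I_L.+1 -> 'I_n}) :=
  same_pattern t v.
apply: (@le_trans _ _ (\sum_(t : {ffun 'I_L.+1 -> 'I_n} | closed_walk t)
   \sum_(v | sp v t) D ^- nb_vertices t * w t)).
  apply: ler_sum => t _; rewrite sumr_const -mulr_natr -/(w t).
  rewrite mulrAC ler_peMl// ler_pdivlMl ?exprn_gt0// mulr1.
  apply: le_trans (ffact_ge (ltW D0) _) _; last first.
    have := @card_same_pattern_ge _ _ 'I_r t; rewrite card_ord.
    rewrite -(ler_nat R) => /le_trans; apply; rewrite ler_nat.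
    by apply/subset_leq_card/fintype.subsetP => v; rewrite inE.
  apply: le_trans rL; rewrite lerD2l ler_nat.
  by apply: leq_trans (leq_imset_card _ _) _; rewrite card_ord.
rewrite (exchange_big_dep (fun v => closed_walk v))/=; last first.
  by move=> t v tc /same_pattern_closed <-.
rewrite mulr_sumr; apply: ler_sum => v cv.
apply: (@le_trans _ _ (\sum_(t | sp v t) D ^- nb_vertices v * (p ^+ nb_edges v * walk_weight v))).
  rewrite [leLHS](eq_bigl (sp v)); last first.
    by move=> t; case: (boolP (sp v t)) => tv; rewrite ?andbF//
       (same_pattern_closed tv) cv.
  apply: ler_sum => t tv.
  by rewrite (same_pattern_vertices tv) /w (same_pattern_edges tv)
    /walk_weight (same_pattern_prod tv).
rewrite sumr_const -mulr_natr mulrA mulrAC ler_wpM2r//.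
have pe : p ^+ nb_edges v <= p^-1 * p ^+ nb_vertices v.
  rewrite ler_pdivlMl// -exprS ler_wiXn2l// ?(ltW p0)//.
  exact: nb_vertices_le.
apply: (@le_trans _ _ (D ^- nb_vertices v * (p^-1 * p ^+ nb_vertices v) * n%:R ^+ nb_vertices v)).
  apply: ler_pM => //.
  - by rewrite mulr_ge0 ?invr_ge0 ?exprn_ge0 ?(ltW p0)// ltW.
  - by rewrite ler_wpM2l// invr_ge0 exprn_ge0// ltW.
  - rewrite -natrX ler_nat.
    have := @card_same_pattern_le _ _ 'I_n v; rewrite card_ord.
    apply: leq_trans; apply/subset_leq_card/fintype.subsetP => t.
    by rewrite inE same_pattern_sym.
rewrite /D exprMn; set a := n%:R ^+ _; set b := p ^+ _.
have a0 : a != 0 by rewrite expf_neq0// pnatr_eq0 -lt0n.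
have b0 : b != 0 by rewrite expf_neq0// gt_eqF.
by rewrite le_eqVlt; apply/orP; left; apply/eqP; field; rewrite ?a0 ?b0 ?gt_eqF.
Qed.

End WalkComparison.
End WalkCounting.

(** * The trace method *)

Section WalkTrace.
Variables (R : comNzRingType) (n : nat).
Implicit Types N : 'M[R]_n.

Fixpoint altpow N (L : nat) : 'M[R]_n :=
  if L is L'.+1 then altpow N L' *m (if odd L' then N^T else N) else 1%:M.

Definition walk_prod N L (t : {ffun 'I_L.+1 -> 'I_n}) : R :=
  \prod_(i < L) N (walk_edge t i).1 (walk_edge t i).2.

Lemma altpow_double N m : altpow N m.*2 = (N *m N^T) ^+ m.
Proof.
elim: m => [|m IH] //=.
by rewrite odd_double IH exprSr -mulmxA.
Qed.

Lemma altpowE N L a b :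
  altpow N L a b =
  \sum_(t : {ffun 'I_L.+1 -> 'I_n} | (t ord0 == a) && (t ord_max == b)) walk_prod N t.
Proof.
elim: L a b => [|L IH] a b.
  rewrite /= mxE; pose ta : {ffun 'I_1 -> 'I_n} := [ffun=> a].
  have tE (t : {ffun 'I_1 -> 'I_n}) : (t ord0 == a) = (t == ta).
    apply/eqP/eqP => [t0|->]; last by rewrite ffunE.
    by apply/ffunP => i; rewrite ffunE ord1.
  have m0 : (ord_max : 'I_1) = ord0 by apply/val_inj.
  case: eqVneq => [<-|ab].
    rewrite (big_pred1 ta) => [|t]; first by rewrite /walk_prod big_ord0.
    by rewrite /= m0 andbb tE.
  rewrite big_pred0// => t; rewrite m0 /=; apply/negbTE/negP => /andP[/eqP ta0 /eqP tb0].
  by move: ab; rewrite -ta0 -tb0 eqxx.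
pose ext (u : {ffun 'I_L.+1 -> 'I_n} * 'I_n) : {ffun 'I_L.+2 -> 'I_n} :=
  [ffun i => if unlift ord_max i is Some j then u.1 j else u.2].
have ext_lift u j : ext u (lift ord_max j) = u.1 j by rewrite ffunE liftK.
have ext_max u : ext u ord_max = u.2 by rewrite ffunE unlift_none.
pose res (t : {ffun 'I_L.+2 -> 'I_n}) : {ffun 'I_L.+1 -> 'I_n} * 'I_n :=
  ([ffun j => t (lift ord_max j)], t ord_max).
have extK : cancel ext res.
  move=> u; rewrite /res ext_max; case: u => u c /=; congr pair.
  by apply/ffunP => j; rewrite ffunE ext_lift.
have resK : cancel res ext.
  move=> t; apply/ffunP => i; case: (unliftP ord_max i) => [j ->|->].
    by rewrite ext_lift ffunE.
  by rewrite ext_max.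
rewrite /= mxE.
rewrite (eq_bigr (fun c => \sum_(u : {ffun 'I_L.+1 -> 'I_n} |
    (u ord0 == a) && (u ord_max == c)) walk_prod N u * (if odd L then N^T else N) c b));
  last by move=> c _; rewrite IH big_distrl.
rewrite (reindex ext)/=; last by exists res => x _; [exact: extK|exact: resK].
have e0 u : ext u ord0 = u.1 ord0.
  have -> : ord0 = lift ord_max ord0 :> 'I_L.+2 by apply/val_inj.
  by rewrite ext_lift.
under [RHS]eq_bigl => u do rewrite e0 ext_max.
rewrite (eq_bigr (fun c => \sum_(u : {ffun 'I_L.+1 -> 'I_n} | u ord0 == a)
   if u ord_max == c then walk_prod N u * (if odd L then N^T else N) c b else 0));
  last by move=> c _; rewrite big_mkcondr.
rewrite exchange_big/=.
rewrite -(pair_big_dep (fun u : {ffun 'I_L.+1 -> 'I_n} => u ord0 == a)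
  (fun u c => c == b) (fun u c => walk_prod N (ext (u, c))))/=.
apply: eq_bigr => u _; rewrite big_pred1_eq -big_mkcond/=.
rewrite (big_pred1 (u ord_max)); last by move=> c; rewrite /= eq_sym.
rewrite /walk_prod big_ord_recr/=.
have edgeE (i : 'I_L) :
    walk_edge (ext (u, b)) (widen_ord (leqnSn L) i) = walk_edge u i.
  rewrite /walk_edge /=.
  have -> : lift ord_max (widen_ord (leqnSn L) i) =
      lift ord_max (lift ord_max i) :> 'I_L.+2.
    by apply/ord_inj; rewrite !lift_max.
  have -> : lift ord0 (widen_ord (leqnSn L) i) = lift ord_max (lift ord0 i) :> 'I_L.+2.
    by apply/ord_inj; rewrite lift_max.
  by rewrite !ext_lift.
congr (_ * _); first by apply: eq_bigr => i _; rewrite edgeE.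
rewrite /walk_edge /=.
have -> : lift ord0 (ord_max : 'I_L.+1) = ord_max :> 'I_L.+2 by apply/val_inj.
rewrite ext_lift ext_max; case: (odd L) => //=.
by rewrite mxE.
Qed.

Lemma trace_altpow N L :
  \tr (altpow N L) =
  \sum_(t : {ffun 'I_L.+1 -> 'I_n} | closed_walk t) walk_prod N t.
Proof.
rewrite /mxtrace; under eq_bigr do rewrite altpowE.
rewrite (exchange_big_dep (@closed_walk L 'I_n))/=; last first.
  by move=> a t _ /andP[/eqP ta /eqP tb]; rewrite /closed_walk ta tb.
apply: eq_bigr => t /eqP tc; rewrite (big_pred1 (t ord0)) => [//|a].
by rewrite -tc andbb eq_sym.
Qed.

Lemma walk_prodE N L (t : {ffun 'I_L.+1 -> 'I_n}) :
  walk_prod N t = \prod_e N e.1 e.2 ^+ edge_count t e.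
Proof.
rewrite /walk_prod (partition_big (walk_edge t) predT)//=; apply: eq_bigr => e _.
rewrite /edge_count -prodr_const; apply: eq_big => i; first by rewrite inE.
by move=> /eqP ->.
Qed.

End WalkTrace.

(** * Squared Frobenius norms and operator norm bounds *)

Section SquaredNorm.
Variable R : realFieldType.

Definition sqn m n (A : 'M[R]_(m, n)) : R := \sum_i \sum_j A i j ^+ 2.

Lemma sqn_ge0 m n (A : 'M[R]_(m, n)) : 0 <= sqn A.
Proof. by apply: sumr_ge0 => i _; apply: sumr_ge0 => j _; rewrite sqr_ge0. Qed.

Lemma sqnE m n (A : 'M[R]_(m, n)) : sqn A = \tr (A^T *m A).
Proof.
rewrite /sqn exchange_big; apply: eq_bigr => j _; rewrite mxE.
by apply: eq_bigr => i _; rewrite mxE expr2.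
Qed.

Lemma sqn_tr m n (A : 'M[R]_(m, n)) : sqn A^T = sqn A.
Proof.
rewrite /sqn exchange_big; apply: eq_bigr => i _; apply: eq_bigr => j _.
by rewrite mxE.
Qed.

Lemma sqnZ m n a (A : 'M[R]_(m, n)) : sqn (a *: A) = a ^+ 2 * sqn A.
Proof.
rewrite /sqn mulr_sumr; apply: eq_bigr => i _; rewrite mulr_sumr.
by apply: eq_bigr => j _; rewrite mxE exprMn.
Qed.

Lemma sqn0 m n : sqn (0 : 'M[R]_(m, n)) = 0.
Proof. by rewrite /sqn big1// => i _; rewrite big1// => j _; rewrite mxE expr0n. Qed.

Lemma sqn_eq0 m n (A : 'M[R]_(m, n)) : (sqn A == 0) = (A == 0).
Proof.
apply/idP/eqP => [|->]; last by rewrite sqn0.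
rewrite psumr_eq0 => [|i _]; last by apply: sumr_ge0 => j _; rewrite sqr_ge0.
move=> /allP h; apply/matrixP => i j; rewrite mxE.
have := h i (mem_index_enum _); rewrite psumr_eq0 => [|k _]; last by rewrite sqr_ge0.
by move=> /allP/(_ j (mem_index_enum _)); rewrite sqrf_eq0 => /eqP.
Qed.

Lemma tr_mulmxE m n (A B : 'M[R]_(m, n)) :
  \tr (A^T *m B) = \sum_i \sum_j A i j * B i j.
Proof.
rewrite exchange_big; apply: eq_bigr => j _; rewrite mxE.
by apply: eq_bigr => i _; rewrite mxE.
Qed.

Lemma sqnD m n (A B : 'M[R]_(m, n)) :
  sqn (A + B) = sqn A + 2 * \tr (A^T *m B) + sqn B.
Proof.
rewrite /sqn tr_mulmxE mulr_sumr -!big_split; apply: eq_bigr => i _ /=.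
rewrite mulr_sumr -!big_split; apply: eq_bigr => j _ /=.
by rewrite mxE sqrrD mulr_natl.
Qed.

Lemma sqnD_le m n (A B : 'M[R]_(m, n)) : sqn (A + B) <= 2 * sqn A + 2 * sqn B.
Proof.
have := sqn_ge0 (A - B); rewrite -scaleN1r !sqnD sqnZ sqrrN expr1n mul1r.
by rewrite -scalemxAr mxtraceZ; lra.
Qed.

Lemma tr_cauchy m n (A B : 'M[R]_(m, n)) :
  \tr (A^T *m B) ^+ 2 <= sqn A * sqn B.
Proof.
have [/eqP|B0] := eqVneq (sqn B) 0.
  rewrite sqn_eq0 => /eqP ->.
  by rewrite mulmx0 mxtrace0 expr0n mulr_ge0// sqn_ge0.
have Bp : 0 < sqn B by rewrite lt_def B0 sqn_ge0.
set c := \tr (A^T *m B).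
have := sqn_ge0 (A - (c / sqn B) *: B).
rewrite -scaleNr sqnD sqnZ -scalemxAr mxtraceZ -/c sqrrN expr_div_n => h.
have : 0 <= sqn B * (sqn A + 2 * (- (c / sqn B) * c) + c ^+ 2 / sqn B ^+ 2 * sqn B).
  by rewrite mulr_ge0// ltW.
have -> : sqn B * (sqn A + 2 * (- (c / sqn B) * c) + c ^+ 2 / sqn B ^+ 2 * sqn B) =
  sqn A * sqn B - c ^+ 2 by field.
by rewrite subr_ge0.
Qed.

Lemma sqn_cols m n (A : 'M[R]_(m, n)) : sqn A = \sum_j sqn (col j A).
Proof.
rewrite /sqn exchange_big; apply: eq_bigr => j _; apply: eq_bigr => i _.
by rewrite big_ord1 mxE.
Qed.

Lemma sqn_rows m n (A : 'M[R]_(m, n)) : sqn A = \sum_i sqn (row i A).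
Proof.
by rewrite /sqn; apply: eq_bigr => i _; rewrite big_ord1; apply: eq_bigr => j _; rewrite mxE.
Qed.

Lemma sqn_mulmx m n k (A : 'M[R]_(m, n)) (B : 'M[R]_(n, k)) :
  sqn (A *m B) <= sqn A * sqn B.
Proof.
have vec (u : 'rV[R]_n) (v : 'cV[R]_n) : sqn (u *m v) <= sqn u * sqn v.
  rewrite {1}/sqn !big_ord1 -(sqn_tr u); have := tr_cauchy u^T v.
  by rewrite trmxK /mxtrace big_ord1.
rewrite (sqn_rows A) (sqn_cols B) {1}/sqn big_distrl/=; apply: ler_sum => i _.
rewrite big_distrr/=; apply: ler_sum => j _.
have := vec (row i A) (col j B); rewrite {1}/sqn !big_ord1.
have -> // : (row i A *m col j B) 0 0 = (A *m B) i j.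
by rewrite !mxE; apply: eq_bigr => l _; rewrite !mxE.
Qed.

(** [c] bounds the squared operator norm; the trace reads a 1 x 1 matrix as a scalar. The bilinear
    form is symmetric under transposition and can be tested on a net. *)
Definition op_sq_bound m n (A : 'M[R]_(m, n)) (c : R) :=
  forall (x : 'cV[R]_m) (y : 'cV[R]_n), \tr (x^T *m A *m y) ^+ 2 <= c * sqn x * sqn y.

(** For each column y of [B], testing the form at x = A y gives |A y|^4 <= c |A y|^2 |y|^2, and |A
    y|^2 cancels. *)
Lemma op_sq_bound_mul m n k (A : 'M[R]_(m, n)) c (B : 'M[R]_(n, k)) : 0 <= c ->
  op_sq_bound A c -> sqn (A *m B) <= c * sqn B.
Proof.
move=> c0 Ac; rewrite (sqn_cols (A *m B)) (sqn_cols B) mulr_sumr.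
apply: ler_sum => j _; set y := col j B.
have -> : col j (A *m B) = A *m y.
  by apply/matrixP => i i0; rewrite !mxE; apply: eq_bigr => l _; rewrite mxE.
have := Ac (A *m y) y; rewrite -mulmxA -sqnE expr2 -mulrA.
have [->|s0] := eqVneq (sqn (A *m y)) 0; first by rewrite mulr_ge0// sqn_ge0.
by rewrite mulrCA ler_pM2l// lt_def s0 sqn_ge0.
Qed.

Lemma op_sq_bound_tr m n (A : 'M[R]_(m, n)) c : op_sq_bound A c -> op_sq_bound A^T c.
Proof.
move=> Ac x y; rewrite -mxtrace_tr !trmx_mul !trmxK mulmxA.
by rewrite (le_trans (Ac y x))// mulrAC.
Qed.

Lemma gram_pow_tr n (A : 'M[R]_n) k : ((A *m A^T) ^+ k)^T = (A *m A^T) ^+ k.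
Proof.
elim: k => [|k IH]; first by rewrite expr0; exact: trmx1.
rewrite exprS trmx_mul trmx_mul trmxK IH.
exact: etrans (esym (exprSr _ _)) (exprS _ _).
Qed.

(** With S = A A^T, the trace of S^(2j) is the squared Frobenius norm of S^j, reached from the
    identity, of squared norm n, by 2j multiplications by [A^T] or [A], each costing a factor c. *)
Lemma trace_pow_le n (A : 'M[R]_n) c j : 0 <= c -> op_sq_bound A c ->
  \tr ((A *m A^T) ^+ (j.*2)) <= n%:R * c ^+ (j.*2).
Proof.
move=> c0 Ac; set S := A *m A^T.
have -> : \tr (S ^+ j.*2) = sqn (S ^+ j).
  by rewrite sqnE gram_pow_tr -addnn exprD.
have -> : n%:R * c ^+ j.*2 = c ^+ j.*2 * sqn (1%:M : 'M[R]_n).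
  by rewrite sqnE trmx1 mulmx1 mxtrace1 mulrC.
elim: j => [|j IH]; first by rewrite !expr0 mul1r.
have -> : S ^+ j.+1 = A *m (A^T *m S ^+ j) by rewrite exprS mulmxA.
rewrite doubleS !exprS -!mulrA.
have AcT := op_sq_bound_tr Ac.
apply: (le_trans (op_sq_bound_mul _ c0 Ac)); rewrite ler_wpM2l//.
by apply: (le_trans (op_sq_bound_mul _ c0 AcT)); rewrite ler_wpM2l.
Qed.

(* Iterating Cauchy-Schwarz gives |A^T x|^(2N) <= |x|^(2N-2) <x, (AA^T)^N x>
   for N a power of 2, so that no spectral decomposition is needed. *)
Lemma op_sq_bound_trace n (A : 'M[R]_n) c k : 0 <= c ->
  \tr ((A *m A^T) ^+ (2 ^ k.+1)) <= c ^+ (2 ^ k.+1) -> op_sq_bound A c.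
Proof.
move=> c0; set S := A *m A^T => Sc.
have sqnS i (x : 'cV[R]_n) : sqn (S ^+ i *m x) = \tr (x^T *m S ^+ (i.*2) *m x).
  by rewrite sqnE trmx_mul gram_pow_tr -addnn exprD !mulmxA.
have sqS i (x : 'cV[R]_n) :
    \tr (x^T *m S ^+ i *m x) ^+ 2 <= sqn x * \tr (x^T *m S ^+ (i.*2) *m x).
  by rewrite -mulmxA -sqnS tr_cauchy.
have pow i (x : 'cV[R]_n) : sqn (A^T *m x) ^+ (2 ^ i) <=
    sqn x ^+ (2 ^ i).-1 * \tr (x^T *m S ^+ (2 ^ i) *m x).
  elim: i => [|i IH].
    by rewrite expn0 expr0 mul1r !expr1 sqnE trmx_mul trmxK !mulmxA.
  rewrite expnS mulnC exprM.
  have := IH; rewrite -(ler_pXn2r (n := 2))// ?nnegrE ?exprn_ge0 ?sqn_ge0//;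
    last by apply: le_trans IH; rewrite exprn_ge0// sqn_ge0.
  move=> /le_trans; apply; rewrite exprMn -exprM.
  have -> : (2 ^ i * 2).-1 = ((2 ^ i).-1 * 2).+1 by have := expn_gt0 2 i; lia.
  rewrite (exprSr (sqn x)) -[leRHS]mulrA ler_wpM2l ?exprn_ge0 ?sqn_ge0//.
  by rewrite muln2 sqS.
have AT (x : 'cV[R]_n) : sqn (A^T *m x) <= c * sqn x.
  rewrite -(ler_pXn2r (n := 2 ^ k.+1)) ?expn_gt0// ?nnegrE ?mulr_ge0 ?sqn_ge0//.
  apply: le_trans (pow _ _) _.
  have -> : (2 ^ k.+1 = (2 ^ k).*2)%N by rewrite expnS mul2n.
  rewrite -sqnS -mul2n -expnS exprMn.
  have -> : sqn x ^+ (2 ^ k.+1) = sqn x ^+ (2 ^ k.+1).-1 * sqn x.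
    by rewrite -exprSr prednK// expn_gt0.
  rewrite mulrCA ler_wpM2l ?exprn_ge0 ?sqn_ge0//.
  (* For N = 2^k the squared Frobenius norm of S^N is the trace of S^(2N), so the trace dominates
     the quadratic form of S^(2N) on unit vectors. *)
  apply: le_trans (sqn_mulmx _ _) _; rewrite ler_wpM2r ?sqn_ge0//.
  by apply: le_trans Sc; rewrite sqnE gram_pow_tr expnS mul2n -addnn exprD.
move=> x y; have := tr_cauchy (A^T *m x) y.
rewrite trmx_mul trmxK => /le_trans; apply.
by rewrite ler_wpM2r ?sqn_ge0.
Qed.

End SquaredNorm.

(** * A finitely supported subgaussian law with large moments *)

Section SubgaussianLaw.
Variable R : realType.

Lemma expR_le_inv (x : R) : x < 1 -> expR x <= (1 - x)^-1.
Proof.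
move=> x1; have h := expR_ge1Dx (- x).
rewrite -[expR x]invrK -expRN lef_pV2 ?posrE ?expR_gt0 ?subr_gt0//.
Qed.

(** The linear term is isolated so that it disappears on averaging a centered variable. For x > 1/2,
    x <= 2 x^2; otherwise 1 / (1 - x) <= 1 + x + 2 x^2. *)
Lemma expR_le_quad (x : R) : expR x <= x + expR (2 * x ^+ 2).
Proof.
have [x2|x2] := leP x (1 / 2); last first.
  apply: (@le_trans _ _ (expR (2 * x ^+ 2))); last by rewrite lerDr; lra.
  by rewrite ler_expR; nra.
have x1 : 0 < 1 - x by lra.
apply: (@le_trans _ _ (1 - x)^-1); first by apply: expR_le_inv; lra.
apply: (@le_trans _ _ (x + (1 + 2 * x ^+ 2))); last first.
  by rewrite lerD2l expR_ge1Dx.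
rewrite -[leLHS]mul1r ler_pdivrMr//; nra.
Qed.

(** Convexity between 0 and [u], from the tangent line at [s * u]: its values at [u] and 0 are
    combined with weights s and 1 - s, and the linear terms cancel. *)
Lemma expR_chord (s u : R) : 0 <= s <= 1 -> expR (s * u) <= 1 - s + s * expR u.
Proof.
move=> /andP[s0 s1].
have h1 : expR (s * u) * (1 + (1 - s) * u) <= expR u.
  have -> : expR u = expR (s * u) * expR ((1 - s) * u).
    by rewrite -expRD; congr expR; ring.
  by rewrite ler_wpM2l ?expR_ge0// expR_ge1Dx.
have h2 : expR (s * u) * (1 - s * u) <= 1.
  rewrite -[leRHS](expRxMexpNx_1 (s * u)) ler_wpM2l ?expR_ge0//.
  exact: expR_ge1Dx.
have h3 := ler_wpM2l s0 h1.
have s1' : 0 <= 1 - s by lra.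
have h4 := ler_wpM2l s1' h2.
have := lerD h3 h4; set e := expR _ => h5.
have -> : e = s * (e * (1 + (1 - s) * u)) + (1 - s) * (e * (1 - s * u)) by ring.
by apply: (le_trans h5); rewrite mulr1 addrC.
Qed.

(** For 4 th^2 <= 1 the linear term averages to 0 and the chord inequality brings exp(2 th^2 y^2)
    down to exp(y^2 / 2). For larger th, th y <= th^2 / 2 + y^2 / 2, and B <= exp(B - 1) is absorbed
    because th^2 is bounded below. *)
Lemma mgf_subgaussian (K : finType) (q y : K -> R) (B : R) :
  1 <= B -> (forall a, 0 <= q a) -> \sum_a q a = 1 -> \sum_a q a * y a = 0 ->
  \sum_a q a * expR (y a ^+ 2 / 2) <= B ->
  forall th, \sum_a q a * expR (th * y a) <= expR (4 * B * th ^+ 2).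
Proof.
move=> B1 q0 q1 qy qB th.
have [th4|th4] := leP (4 * th ^+ 2) 1.
  apply: (@le_trans _ _ (\sum_a (th * (q a * y a) + ((1 - 4 * th ^+ 2) * q a +
      4 * th ^+ 2 * (q a * expR (y a ^+ 2 / 2)))))).
    apply: ler_sum => a _.
    have -> : th * (q a * y a) + ((1 - 4 * th ^+ 2) * q a +
        4 * th ^+ 2 * (q a * expR (y a ^+ 2 / 2))) =
      q a * (th * y a + (1 - 4 * th ^+ 2 + 4 * th ^+ 2 * expR (y a ^+ 2 / 2))) by ring.
    rewrite ler_wpM2l// (le_trans (expR_le_quad _))// lerD2l.
    have -> : 2 * (th * y a) ^+ 2 = 4 * th ^+ 2 * (y a ^+ 2 / 2) by field.
    by apply: expR_chord; rewrite th4 andbT mulr_ge0// sqr_ge0.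
  rewrite !big_split/= -!mulr_sumr qy q1 mulr0 add0r mulr1.
  apply: le_trans (expR_ge1Dx _).
  have := sqr_ge0 th; nra.
apply: (@le_trans _ _ (\sum_a q a * (expR (th ^+ 2 / 2) * expR (y a ^+ 2 / 2)))).
  apply: ler_sum => a _; rewrite ler_wpM2l// -expRD ler_expR.
  by have := sqr_ge0 (th - y a); nra.
under eq_bigr do rewrite mulrCA.
rewrite -mulr_sumr; apply: (@le_trans _ _ (expR (th ^+ 2 / 2) * B)).
  by rewrite ler_wpM2l ?expR_ge0.
apply: (@le_trans _ _ (expR (th ^+ 2 / 2) * expR (B - 1))).
  by rewrite ler_wpM2l ?expR_ge0//; have := expR_ge1Dx (B - 1); lra.
by rewrite -expRD ler_expR; have := sqr_ge0 th; nra.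
Qed.

Lemma sum_halves (T : nat) : \sum_(i < T) (2^-1 : R) ^+ i.+1 <= 1.
Proof.
have -> : \sum_(i < T) (2^-1 : R) ^+ i.+1 = 1 - 2^-1 ^+ T.
  elim: T => [|T IH]; first by rewrite big_ord0 expr0 subrr.
  by rewrite big_ord_recr/= IH exprS; field.
by rewrite gerBl exprn_ge0.
Qed.

Definition moment (K : finType) (q y : K -> R) (k : nat) := \sum_a q a * y a ^+ k.

Lemma exists_sqrt_ceil (k : nat) : (2 <= k)%N ->
  exists t : nat, [/\ (2 <= t)%N, (t <= k)%N, (k <= t ^ 2)%N & (t ^ 2 <= 4 * k)%N].
Proof.
move=> k2; have ex : exists t, (k <= t ^ 2)%N by exists k; nia.
have [t kt tmin] := ex_minnP ex; exists t.
have tk : (t <= k)%N by apply: tmin; nia.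
have t2 : (2 <= t)%N by case: t kt {tmin tk} => [|[|t]]; nia.
split => //; rewrite leqNgt; apply/negP => h.
by have : (t <= t.-1)%N by [apply: tmin; nia]; lia.
Qed.

(* The moments up to order T dominate those of the normal law, while the
   subgaussian constant does not depend on T. The law gives each value t with
   1 <= t <= T probability 4^(-t^2); an atom at -1 centers it and keeps all the
   moments nonnegative. *)
Lemma comparison_law : exists2 C : R, 0 <= C &
  forall T : nat, exists (K : finType) (q y : K -> R),
    [/\ [/\ (forall a, 0 <= q a), \sum_a q a = 1 & \sum_a q a * y a = 0],
        (forall k, 0 <= moment q y k),
        (forall k, (2 <= k <= T)%N -> exists t : nat,
           [/\ (0 < t)%N, (k <= t ^ 2)%N & 2 * t%:R ^+ k <= moment q y k])
      & forall th, \sum_a q a * expR (th * y a) <= expR (C * th ^+ 2)].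
Proof.
(* This scale pays for the probability 4^(-t^2) >= 4^(-4k) of the atom at t and leaves 4^k >= 4,
   which covers the required factor 2 and the loss of 1/2 in t^k - t >= t^k / 2. *)
have [kap kapE] : exists kap : R, kap = 4 ^+ 5 by exists (4 ^+ 5).
exists (4 * 4 * kap ^+ 2); first by rewrite mulr_ge0 ?sqr_ge0// mulr_ge0.
have kap0 : 0 <= kap by rewrite kapE exprn_ge0.
move=> T.
pose w (i : nat) : R := 4^-1 ^+ (i.+1 ^ 2).
pose b : R := \sum_(i < T) i.+1%:R * w i.
pose c : R := \sum_(i < T) w i.
(* The atom at -1 has mass [b], the mean of the positive part. The remaining mass, nonnegative
   because [b] and [c] are at most 1/2, is put at 0. *)
pose K : finType := ('I_T + bool)%type.
pose q (a : K) : R := match a with inl i => w i | inr true => b | inr false => 1 - b - c end.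
pose z (a : K) : R := match a with inl i => i.+1%:R | inr true => -1 | inr false => 0 end.
have w0 i : 0 <= w i by rewrite exprn_ge0.
have wle i : w i <= 2^-1 ^+ i.+1 * 2^-1 ^+ i.+1.
  have -> : 2^-1 ^+ i.+1 * 2^-1 ^+ i.+1 = 4^-1 ^+ i.+1 :> R.
    by rewrite -exprMn; congr (_ ^+ _); field.
  by rewrite ler_wiXn2l//; [lra|nia].
have half i : (2^-1 : R) ^+ i.+1 <= 2^-1.
  by rewrite exprS ler_piMr// exprn_ile1//; lra.
have iw i : i.+1%:R * w i <= 2^-1 * 2^-1 ^+ i.+1.
  have i2 : i.+1%:R <= (2 : R) ^+ i by rewrite -natrX ler_nat; exact: ltn_expl.
  apply: (@le_trans _ _ (2 ^+ i * (2^-1 ^+ i.+1 * 2^-1 ^+ i.+1))).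
    by rewrite ler_pM.
  rewrite le_eqVlt; apply/orP; left; apply/eqP; rewrite mulrA; congr (_ * _).
  by rewrite exprS mulrCA -exprMn divff ?expr1n ?mulr1// pnatr_eq0.
have b2 : b <= 2^-1.
  apply: (@le_trans _ _ (\sum_(i < T) 2^-1 * 2^-1 ^+ i.+1)); first exact: ler_sum.
  by rewrite -mulr_sumr ler_piMr// sum_halves.
have c2 : c <= 2^-1.
  apply: (@le_trans _ _ (\sum_(i < T) 2^-1 * 2^-1 ^+ i.+1)).
    by apply: ler_sum => i _; rewrite (le_trans (wle i))// ler_wpM2r// exprn_ge0.
  by rewrite -mulr_sumr ler_piMr// sum_halves.
have b0 : 0 <= b by apply: sumr_ge0 => i _; rewrite mulr_ge0.
have c0 : 0 <= c by apply: sumr_ge0.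
have sumK (f : K -> R) : \sum_a f a = \sum_(i < T) f (inl i) + (f (inr true) + f (inr false)).
  by rewrite big_sumType/= big_bool.
have q0 a : 0 <= q a by case: a => [i|[]] //=; lra.
have q1 : \sum_a q a = 1 by rewrite sumK/= -/c; lra.
have qz : \sum_a q a * z a = 0.
  rewrite sumK/= (eq_bigr (fun i : 'I_T => i.+1%:R * w i)); last by move=> i _; rewrite mulrC.
  by rewrite -/b; lra.
have zB : \sum_a q a * expR (z a ^+ 2 / 2) <= 4.
  rewrite sumK/= expr0n/= mul0r expR0 mulr1 sqrrN expr1n.
  have e2 : expR (1 / 2) <= 2 :> R.
    by apply: le_trans (expR_le_inv _) _; [lra|rewrite (_ : 1 - 1 / 2 = 2^-1) ?invrK//; field].
  (* Since exp(1/2) <= 2, the weight 4^(-t^2) beats exp(t^2 / 2) with 2^(-t^2) to spare, so the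
     bound is uniform in [T]. *)
  have S1 : \sum_(i < T) w i * expR (i.+1%:R ^+ 2 / 2) <= 1.
    apply: le_trans (sum_halves T); apply: ler_sum => i _.
    have -> : i.+1%:R ^+ 2 / 2 = (i.+1 ^ 2)%N%:R * (1 / 2) :> R.
      by rewrite natrX; field.
    rewrite expRM_natl -exprMn; apply: (@le_trans _ _ (2^-1 ^+ (i.+1 ^ 2))).
      by apply: lerXn2r; rewrite ?nnegrE ?mulr_ge0 ?expR_ge0//; lra.
    by rewrite ler_wiXn2l//; [lra|nia].
  have : b * expR (1 / 2) <= 2^-1 * 2 by rewrite ler_pM ?expR_ge0.
  by lra.
exists K, q, (fun a => kap * z a).
have momE k : moment q (fun a => kap * z a) k = kap ^+ k * moment q z k.
  by rewrite /moment mulr_sumr; apply: eq_bigr => a _; rewrite exprMn mulrCA.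
(* The atom at -1 contributes at least -b, which is distributed over the positive atoms, where t^k
   >= t. *)
have momz k : (0 < k)%N ->
    \sum_(i < T) (i.+1%:R ^+ k - i.+1%:R) * w i <= moment q z k.
  move=> k0; rewrite /moment sumK/= expr0n gtn_eqF// mulr0 addr0.
  have bk : - b <= b * (-1) ^+ k.
    rewrite -[leLHS]mulrN1 ler_wpM2l//.
    by rewrite -signr_odd; case: odd; rewrite ?expr1 ?expr0//; lra.
  apply: le_trans (lerD (lexx _) bk).
  rewrite -sumrB; apply: ler_sum => i _; lra.
have tk (i k : nat) : (0 < k)%N -> i.+1%:R <= (i.+1%:R : R) ^+ k.
  by case: k => // k _; rewrite -natrX ler_nat expnS leq_pmulr// expn_gt0.
split.
- split => //; under eq_bigr do rewrite mulrCA.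
  by rewrite -mulr_sumr qz mulr0.
- move=> k; rewrite momE mulr_ge0 ?exprn_ge0//.
  have [->|k0] := posnP k.
    by rewrite /moment (eq_bigr q) ?q1// => a _; rewrite expr0 mulr1.
  apply: le_trans (momz _ k0); apply: sumr_ge0 => i _.
  by rewrite mulr_ge0// subr_ge0 tk.
- move=> k /andP[k2 kT]; have [t [t2 tk' kt t4]] := exists_sqrt_ceil k2.
  exists t; split => //; first exact: leq_trans t2.
  have k0 : (0 < k)%N by lia.
  have tT : (t.-1 < T)%N by lia.
  have tE : t.-1.+1 = t by lia.
  rewrite momE; apply: (@le_trans _ _ (kap ^+ k * ((t%:R ^+ k - t%:R) * 4^-1 ^+ (t ^ 2)))).
    have h1 : t%:R ^+ k / 2 <= t%:R ^+ k - t%:R :> R.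
      have : 2 * t%:R <= t%:R ^+ k :> R.
        case: k k2 {kT tk' kt t4 k0} => [|[|k]] // _.
        by rewrite -natrX -natrM ler_nat expnS leq_mul// expnS leq_pmulr// expn_gt0; lia.
      by lra.
    have h2 : 4^-1 ^+ (4 * k) <= 4^-1 ^+ (t ^ 2) :> R by rewrite ler_wiXn2l//; lra.
    apply: (@le_trans _ _ (kap ^+ k * ((t%:R ^+ k / 2) * 4^-1 ^+ (4 * k)))).
      have -> : kap ^+ k * ((t%:R ^+ k / 2) * 4^-1 ^+ (4 * k)) =
          t%:R ^+ k / 2 * 4 ^+ k :> R.
        rewrite kapE -exprM exprVn.
        have -> : (5 * k = 4 * k + k)%N by lia.
        rewrite exprD; field; exact: expf_neq0.
      have : 4 <= 4 ^+ k :> R by apply: ler_eXnr => //; lra.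
      have : 0 <= t%:R ^+ k :> R by rewrite exprn_ge0.
      by nra.
    rewrite ler_wpM2l ?exprn_ge0// ler_pM ?exprn_ge0// mulr_ge0 ?exprn_ge0//.
  rewrite ler_wpM2l ?exprn_ge0//; apply: le_trans (momz _ k0).
  rewrite (bigD1 (Ordinal tT))//= /w tE lerDl; apply: sumr_ge0 => i _.
  by rewrite mulr_ge0// subr_ge0 tk.
- move=> th; have := mgf_subgaussian _ q0 q1 qz zB (th * kap).
  have -> : 4 * 4 * (th * kap) ^+ 2 = 4 * 4 * kap ^+ 2 * th ^+ 2 :> R by ring.
  under eq_bigr do rewrite -mulrA.
  by apply; lra.
Qed.

End SubgaussianLaw.

(** * A lattice net for bilinear forms *)

Section LatticeNet.
Variables (R : realType) (r : nat).
Hypothesis r0 : (0 < r)%N.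

(** Integer points of the cube [-2r, 2r]^r, to be read at scale sqrt r: a unit vector multiplied by
    sqrt r is rounded with error at most 1 per coordinate, which keeps the squared norm below 2r +
    2r. *)
Definition lattice_point (k : {ffun 'I_r -> 'I_(4 * r).+1}) : 'cV[R]_r :=
  \col_i ((k i)%:R - (2 * r)%:R).

Lemma round_coordinate (a c : R) : `|a| <= (2 * r)%:R - 1 ->
  exists j : 'I_(4 * r).+1,
    a * c <= (j%:R - (2 * r)%:R) * c /\ (j%:R - (2 * r)%:R) ^+ 2 <= 2 * a ^+ 2 + 2.
Proof.
rewrite ler_norml => /andP[al au].
have s0 : 0 <= a + (2 * r)%:R by lra.
have /andP[tl tu] := truncn_itv s0; set v := Num.truncn _ in tl tu.
have vr : (v.+1 <= 4 * r)%N.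
  rewrite -(ler_nat R) -natr1; have : (4 * r)%:R = (2 * r)%:R + (2 * r)%:R :> R.
    by rewrite -natrD; congr (_%:R); lia.
  lra.
rewrite -natr1 in tu.
have [c0|c0] := leP 0 c.
  exists (Ordinal (vr : (v.+1 < (4 * r).+1)%N)) => /=; rewrite -natr1; split; first by nra.
  set b := _ - _ : R.
  have [h1 h2] : a <= b /\ b <= a + 1 by rewrite /b; lra.
  by have := sqr_ge0 (a - 1); have := sqr_ge0 (a + 1); nra.
have vr' : (v < (4 * r).+1)%N by lia.
exists (Ordinal vr') => /=; split; first by nra.
set b := _ - _ : R.
have [h1 h2] : a - 1 <= b /\ b <= a by rewrite /b; lra.
by have := sqr_ge0 (a - 1); have := sqr_ge0 (a + 1); nra.
Qed.

Lemma round_vector (x c : 'cV[R]_r) : sqn x <= 1 ->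
  exists k, sqn (lattice_point k) <= (4 * r)%:R /\
    Num.sqrt r%:R * \tr (x^T *m c) <= \tr ((lattice_point k)^T *m c).
Proof.
move=> x1.
have rR : 1 <= r%:R :> R by rewrite ler1n.
have sr2 : Num.sqrt r%:R ^+ 2 = r%:R :> R by rewrite sqr_sqrtr.
have srr : Num.sqrt r%:R <= r%:R :> R by have := sqrtr_ge0 (r%:R : R); nra.
have xi i : x i 0 ^+ 2 <= 1.
  apply: le_trans x1; rewrite /sqn (bigD1 i)//= big_ord1 lerDl.
  by apply: sumr_ge0 => j _; rewrite big_ord1 sqr_ge0.
have ax i : `|Num.sqrt r%:R * x i 0| <= (2 * r)%:R - 1.
  rewrite normrM ger0_norm ?sqrtr_ge0// natrM.
  have : `|x i 0| <= 1 by rewrite -(@ler_pXn2r _ 2)// ?nnegrE// expr1n real_normK ?num_real.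
  by have := sqrtr_ge0 (r%:R : R); have := normr_ge0 (x i 0); nra.
have [k kP] := choice (fun i => round_coordinate (c i 0) (ax i)).
exists (finfun k); split.
  rewrite /sqn; apply: (@le_trans _ _ (\sum_i (2 * (r%:R * x i 0 ^+ 2) + 2))).
    apply: ler_sum => i _; rewrite big_ord1 mxE ffunE.
    by have [_] := kP i; rewrite exprMn sr2.
  rewrite big_split/= sumr_const card_ord -!mulr_sumr.
  have -> : \sum_i x i 0 ^+ 2 = sqn x by apply: eq_bigr => i _; rewrite big_ord1.
  have -> : (4 * r)%:R = 2 * (r%:R * 1) + 2 *+ r :> R.
    by rewrite -mulr_natr natrM; ring.
  by rewrite lerD2r ler_wpM2l// ler_wpM2l// ler0n.
rewrite !tr_mulmxE mulr_sumr; apply: ler_sum => i _; rewrite !big_ord1.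
by rewrite mulrA mxE ffunE; have [] := kP i.
Qed.

Definition net : {set {ffun 'I_r -> 'I_(4 * r).+1}} :=
  finset (fun k => sqn (lattice_point k) <= (4 * r)%:R).

Let val2 (Y : 'M[R]_r) k l := \tr ((lattice_point k)^T *m Y *m lattice_point l) / r%:R.

(* A linear functional does not decrease when each coordinate is rounded in
   the direction given by the sign of its coefficient; rounding first x, then y
   bounds a bilinear form by its values on the lattice points. *)
Lemma op_sq_bound_net (Y : 'M[R]_r) c : 0 <= c ->
  (forall k l, k \in net -> l \in net -> val2 Y k l ^+ 2 <= c) -> op_sq_bound Y c.
Proof.
move=> c0 Yc; have rR : 0 < r%:R :> R by rewrite ltr0n.
have s0 : 0 < Num.sqrt r%:R :> R by rewrite sqrtr_gt0.
have sr2 : Num.sqrt r%:R ^+ 2 = r%:R :> R by rewrite sqr_sqrtr ?ltW.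
have unit_pos (x y : 'cV[R]_r) : sqn x <= 1 -> sqn y <= 1 ->
    0 <= \tr (x^T *m Y *m y) -> \tr (x^T *m Y *m y) ^+ 2 <= c.
  move=> x1 y1 h0.
  have [k [kN hk]] := round_vector (Y *m y) x1.
  have [l [lN hl]] := round_vector (Y^T *m lattice_point k) y1.
  have lE z : \tr (z^T *m (Y^T *m lattice_point k)) = \tr ((lattice_point k)^T *m Y *m z).
    by rewrite -mxtrace_tr !trmx_mul !trmxK.
  rewrite !lE in hl; rewrite !mulmxA in hk.
  have hv : \tr (x^T *m Y *m y) <= val2 Y k l.
    rewrite ler_pdivlMr// mulrC -sr2 expr2 -mulrA.
    by apply: le_trans hl; rewrite ler_wpM2l// ltW.
  apply: le_trans (Yc k l _ _); rewrite ?inE//.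
  by rewrite ler_pXn2r// nnegrE// (le_trans h0).
have unitB (x y : 'cV[R]_r) : sqn x <= 1 -> sqn y <= 1 -> \tr (x^T *m Y *m y) ^+ 2 <= c.
  move=> x1 y1; have [h|h] := leP 0 (\tr (x^T *m Y *m y)); first exact: unit_pos.
  have := @unit_pos (-1 *: x) y; rewrite sqnZ sqrrN expr1n mul1r => /(_ x1 y1).
  rewrite linearZ/= -!scalemxAl mxtraceZ mulN1r sqrrN; apply.
  by rewrite oppr_ge0 ltW.
move=> x y.
have [/eqP|x0] := eqVneq (sqn x) 0.
  rewrite sqn_eq0 => /eqP ->.
  by rewrite trmx0 !mul0mx mxtrace0 expr0n sqn0 mulr0 mul0r.
have [/eqP|y0] := eqVneq (sqn y) 0.
  rewrite sqn_eq0 => /eqP ->.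
  by rewrite !mulmx0 mxtrace0 expr0n sqn0 mulr0.
have sp m (z : 'cV[R]_m) : sqn z != 0 -> 0 < Num.sqrt (sqn z).
  by move=> z0; rewrite sqrtr_gt0 lt_def z0 sqn_ge0.
have s2 m (z : 'cV[R]_m) : Num.sqrt (sqn z) ^+ 2 = sqn z by rewrite sqr_sqrtr ?sqn_ge0.
have := @unitB ((Num.sqrt (sqn x))^-1 *: x) ((Num.sqrt (sqn y))^-1 *: y).
rewrite !sqnZ !exprVn !s2 !mulVf// => /(_ (lexx _) (lexx _)).
have trZ a (z : 'cV[R]_r) : (a *: z)^T = a *: z^T by rewrite linearZ.
rewrite trZ -!scalemxAl -scalemxAr !mxtraceZ !exprMn !exprVn !s2.
rewrite ler_pdivrMl ?lt_def ?x0 ?sqn_ge0// ler_pdivrMl ?lt_def ?y0 ?sqn_ge0//.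
by move/le_trans; apply; lra.
Qed.

(** The largest squared value on the net bounds the squared operator norm; its power is then
    replaced by the sum over the net, whose terms can be averaged one by one. *)
Lemma trace_pow_net (Y : 'M[R]_r) j :
  \tr ((Y *m Y^T) ^+ j.*2) <=
  r%:R * \sum_(k in net) \sum_(l in net) val2 Y k l ^+ (j.*2).*2.
Proof.
pose k0 : {ffun 'I_r -> 'I_(4 * r).+1} := [ffun=> inord (2 * r)].
have k0N : k0 \in net.
  rewrite inE (_ : lattice_point k0 = 0) ?sqn0 ?ler0n//.
  by apply/matrixP => i i'; rewrite !mxE ffunE inordK ?subrr//; lia.
pose F (kl : _ * _) := val2 Y kl.1 kl.2 ^+ 2.
pose inN (kl : {ffun 'I_r -> 'I_(4 * r).+1} * {ffun 'I_r -> 'I_(4 * r).+1}) :=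
  (kl.1 \in net) && (kl.2 \in net).
have [|[k l] /andP[/= kN lN] klmax] := @arg_maxP _ _ _ (k0, k0) inN F.
  by rewrite /inN /= k0N.
have c0 : 0 <= F (k, l) by rewrite sqr_ge0.
apply: (le_trans (trace_pow_le j c0 _)).
  apply: op_sq_bound_net => // k' l' k'N l'N.
  by apply: (klmax (k', l')); rewrite /inN/= k'N.
rewrite ler_wpM2l ?ler0n//.
have evge0 k' l' : 0 <= val2 Y k' l' ^+ (j.*2).*2 by rewrite -mul2n exprM exprn_ge0// sqr_ge0.
rewrite (bigD1 k)//= (bigD1 l)//= -exprM mul2n -addrA lerDl addr_ge0//.
  exact: sumr_ge0.
by apply: sumr_ge0 => i _; exact: sumr_ge0.
Qed.

(** With truncated subtraction, (j - a) + (a - j) is the distance |j - a|. *)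
Lemma sum_two_sided (a b : nat) :
  \sum_(j < a + b) (2^-1 : R) ^+ ((j - a) + (a - j)) <= 3.
Proof.
rewrite big_split_ord/=.
have h1 : \sum_(j < a) (2^-1 : R) ^+ ((j - a) + (a - j)) = 1 - 2^-1 ^+ a.
  elim: a => [|a IH]; first by rewrite big_ord0 expr0 subrr.
  rewrite big_ord_recl/= /bump/=.
  rewrite (eq_bigr (fun j : 'I_a => 2^-1 ^+ ((j - a) + (a - j)))).
    by rewrite IH add0n subn0 exprS; field.
  by move=> j _; rewrite add1n !subSS.
have h2 : \sum_(j < b) (2^-1 : R) ^+ (((a + j) - a) + (a - (a + j))) = 2 - 2 * 2^-1 ^+ b.
  elim: b => [|b IH]; first by rewrite big_ord0 expr0; ring.
  rewrite big_ord_recr/= IH exprS addKn.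
  have -> : (a - (a + b) = 0)%N by lia.
  by rewrite addn0; field.
rewrite h1 h2.
have : 0 <= (2^-1 : R) ^+ a by rewrite exprn_ge0.
have : 0 <= (2^-1 : R) ^+ b by rewrite exprn_ge0.
by lra.
Qed.

(** The indicator of |k|^2 <= 4r is at most exp(4r - |k|^2), which factors over the coordinates;
    each coordinate contributes at most 3 exp(4) <= exp(6). *)
Lemma card_net : #|net|%:R <= expR (6 * r%:R) :> R.
Proof.
rewrite -sum1_card natr_sum big_mkcond/=.
pose g (j : 'I_(4 * r).+1) : R := expR (4 - (j%:R - (2 * r)%:R) ^+ 2).
apply: (@le_trans _ _ (\sum_(k : {ffun 'I_r -> 'I_(4 * r).+1}) \prod_i g (k i))).
  apply: ler_sum => k _; rewrite -expR_sum sumrB sumr_const card_ord.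
  have -> : \sum_i ((k i)%:R - (2 * r)%:R) ^+ 2 = sqn (lattice_point k).
    by apply: eq_bigr => i _; rewrite big_ord1 mxE.
  case: ifPn => [|_]; last exact: expR_ge0.
  rewrite inE natrM mulr_natr => h.
  by rewrite -[leLHS]expR0 ler_expR subr_ge0.
rewrite -(bigA_distr_bigA (fun _ => g)) prodr_const card_ord mulrC expRM_natl.
apply: lerXn2r; rewrite ?nnegrE ?expR_ge0 ?sumr_ge0//;
  first by move=> i _; exact: expR_ge0.
apply: (@le_trans _ _ (\sum_(j < (4 * r).+1) expR 4 *
    (2^-1 ^+ ((j - 2 * r) + (2 * r - j))))).
  apply: ler_sum => j _; rewrite /g expRD ler_wpM2l ?expR_ge0//.
  set d := ((j - 2 * r) + (2 * r - j))%N.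
  have -> : (j%:R - (2 * r)%:R) ^+ 2 = d%:R ^+ 2 :> R.
    rewrite /d; have [h|h] := leqP j (2 * r).
      have -> : (j - 2 * r = 0)%N by lia.
      by rewrite add0n natrB// -sqrrN opprB.
    have -> : (2 * r - j = 0)%N by lia.
    by rewrite addn0 natrB// ltnW.
  apply: (@le_trans _ _ (expR (d%:R * (-1)))).
    rewrite ler_expR mulrN1 lerN2 -natrX ler_nat.
    by case: (d) => // d'; rewrite expnS leq_pmulr.
  rewrite expRM_natl; apply: lerXn2r; rewrite ?nnegrE ?expR_ge0//.
  rewrite expRN lef_pV2 ?posrE ?expR_gt0//.
  by have := expR_ge1Dx (1 : R); lra.
rewrite -mulr_sumr.
have -> : ((4 * r).+1 = 2 * r + (2 * r).+1)%N by lia.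
apply: (@le_trans _ _ (expR 4 * 3)).
  by rewrite ler_wpM2l ?expR_ge0// sum_two_sided.
apply: (@le_trans _ _ (expR 4 * expR 2)).
  by rewrite ler_wpM2l ?expR_ge0//; have := expR_ge1Dx (2 : R); lra.
by rewrite -expRD ler_expR; lra.
Qed.

End LatticeNet.

(** * Closed walks weighted by the moments of a dense matrix *)

Section DenseWalks.
Variable R : realType.

Lemma even_pow_le_exp (z : R) (N : nat) : (0 < N)%N ->
  z ^+ N.*2 <= N.*2%:R ^+ N.*2 * (expR z + expR (- z)).
Proof.
move=> N0; have N2 : 0 < N.*2%:R :> R by rewrite ltr0n double_gt0.
have e1 : `|z| ^+ N.*2 = z ^+ N.*2.
  by rewrite -mul2n !exprM real_normK ?num_real.
rewrite -e1; apply: (@le_trans _ _ (N.*2%:R ^+ N.*2 * expR `|z|)).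
  have -> : `|z| = N.*2%:R * (`|z| / N.*2%:R) by rewrite mulrCA divff ?mulr1// gt_eqF.
  rewrite expRM_natl -exprMn; apply: lerXn2r;
    rewrite ?nnegrE ?mulr_ge0 ?expR_ge0 ?invr_ge0// ?ltW//.
  rewrite ltr_pM2l//.
  have := expR_ge1Dx (`|z| / N.*2%:R); lra.
rewrite ler_wpM2l ?exprn_ge0//; have [z0|z0] := leP 0 z.
  by rewrite ger0_norm// lerDl expR_ge0.
by rewrite ltr0_norm// lerDr expR_ge0.
Qed.

Variables (K : finType) (q y : K -> R) (C : R).
Hypotheses (C0 : 0 <= C) (q0 : forall a, 0 <= q a).
Hypothesis mgf : forall th, \sum_a q a * expR (th * y a) <= expR (C * th ^+ 2).

(** The dense matrix lives on the finite space of all assignments of its entries, so its means are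
    finite sums. *)
Let Omega r := {ffun 'I_r * 'I_r -> K}.
Let wt r (w : Omega r) := \prod_e q (w e).
Let mat r (w : Omega r) : 'M[R]_r := \matrix_(i, j) y (w (i, j)).

Lemma mean_exp_bilinear r (k l : 'cV[R]_r) (c : R) :
  \sum_(w : Omega r) wt w * expR (c * \tr (k^T *m mat w *m l)) <=
  expR (C * (c ^+ 2 * sqn k * sqn l)).
Proof.
pose th (e : 'I_r * 'I_r) := c * (k e.1 0 * l e.2 0).
have pairE (F : 'I_r * 'I_r -> R) : \sum_e F e = \sum_i \sum_j F (i, j).
  by rewrite pair_bigA; apply: eq_bigr => -[].
have E (w : Omega r) : c * \tr (k^T *m mat w *m l) = \sum_e th e * y (w e).
  rewrite -mulmxA tr_mulmxE mulr_sumr pairE.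
  apply: eq_bigr => i _; rewrite big_ord1 mxE !mulr_sumr; apply: eq_bigr => j _.
  by rewrite /th/= mxE; ring.
rewrite (eq_bigr (fun w : Omega r => \prod_e (q (w e) * expR (th e * y (w e))))); last first.
  by move=> w _; rewrite E expR_sum big_split.
rewrite -(bigA_distr_bigA (fun e a => q a * expR (th e * y a))).
have -> : C * (c ^+ 2 * sqn k * sqn l) = \sum_e C * th e ^+ 2.
  have skl : sqn k * sqn l = \sum_i \sum_j (k i 0 * l j 0) ^+ 2.
    rewrite /sqn big_distrl/=; apply: eq_bigr => i _; rewrite big_ord1 big_distrr/=.
    by apply: eq_bigr => j _; rewrite big_ord1 exprMn.
  rewrite pairE -mulrA skl !mulr_sumr; apply: eq_bigr => i _.
  by rewrite !mulr_sumr; apply: eq_bigr => j _; rewrite /th/=; ring.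
rewrite expR_sum; apply: ler_prod => e _; rewrite mgf andbT.
by apply: sumr_ge0 => a _; rewrite mulr_ge0// expR_ge0.
Qed.

(** The trace expansion read backwards: by independence a product of moments over edges is the mean
    of a walk product. *)
Lemma sum_moments_closed_walks r L :
  \sum_(v : {ffun 'I_L.+1 -> 'I_r} | closed_walk v)
     \prod_e moment q y (edge_count v e) =
  \sum_(w : Omega r) wt w * \tr (altpow (mat w) L).
Proof.
under [RHS]eq_bigr do rewrite trace_altpow mulr_sumr.
rewrite [RHS]exchange_big; apply: eq_bigr => v _.
rewrite (bigA_distr_bigA (fun e a => q a * y a ^+ edge_count v e)).
apply: eq_bigr => w _; rewrite walk_prodE -big_split/=.
by apply: eq_bigr => -[i j] _; rewrite mxE.
Qed.

(** With r = 4m, the two net points cost exp(6r)^2 = exp(48m) and the exponential moment exp(16rC) =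
    exp(64Cm), where 16 r^2 bounds the product of two squared lattice norms. Passing from moments to
    exponentials gives (2m)^(2m) / r^m = m^m, and 8m is r times the two signs of the exponential. *)
Lemma dense_closed_walks (j : nat) (m := j.*2) : (0 < j)%N ->
  \sum_(v : {ffun 'I_(m.*2).+1 -> 'I_(4 * m)} | closed_walk v)
     \prod_e moment q y (edge_count v e)
  <= 8 * m%:R * (expR (48 + 64 * C) * m%:R) ^+ m.
Proof.
move=> j0; have m0 : (0 < m)%N by rewrite double_gt0.
set r := (4 * m)%N; have r0 : (0 < r)%N by rewrite muln_gt0.
have rR : 0 < r%:R :> R by rewrite ltr0n.
have sr2 : Num.sqrt r%:R ^+ 2 = r%:R :> R by rewrite sqr_sqrtr ?ltW.
have s0 : 0 < Num.sqrt r%:R :> R by rewrite sqrtr_gt0.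
have wt0 (w : Omega r) : 0 <= wt w by rewrite prodr_ge0.
rewrite sum_moments_closed_walks; under eq_bigr do rewrite altpow_double.
pose V (w : Omega r) k l := \tr ((lattice_point R k)^T *m mat w *m lattice_point R l).
pose B : R := m%:R ^+ m * (2 * expR (16 * r%:R * C)).
have meanV k l : k \in net R r -> l \in net R r ->
    \sum_(w : Omega r) wt w * (V w k l / r%:R) ^+ m.*2 <= B.
  rewrite !inE => kN lN.
  pose c := (Num.sqrt (r%:R : R))^-1.
  have kl : sqn (lattice_point R k) * sqn (lattice_point R l) <= 16 * r%:R ^+ 2.
    have -> : 16 * r%:R ^+ 2 = (4 * r)%:R * (4 * r)%:R :> R by rewrite natrM; ring.
    by rewrite ler_pM ?sqn_ge0.
  have c2 : c ^+ 2 = r%:R^-1 by rewrite exprVn sr2.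
  have mexp c' : c' ^+ 2 = r%:R^-1 ->
      \sum_(w : Omega r) wt w * expR (c' * V w k l) <= expR (16 * r%:R * C).
    move=> c'2; apply: (le_trans (mean_exp_bilinear _ _ _)).
    rewrite ler_expR c'2 -mulrA mulrC ler_wpM2r//.
    rewrite ler_pdivrMl//; apply: (le_trans kl).
    by rewrite le_eqVlt; apply/orP; left; apply/eqP; ring.
  apply: (@le_trans _ _ (\sum_(w : Omega r) m%:R ^+ m *
      (wt w * expR (c * V w k l) + wt w * expR (- c * V w k l)))).
    apply: ler_sum => w _.
    have -> : (V w k l / r%:R) ^+ m.*2 = r%:R^-1 ^+ m * (c * V w k l) ^+ m.*2.
      rewrite -mul2n !exprM -exprMn; congr (_ ^+ _).
      by rewrite exprMn [in RHS]exprMn c2; field; rewrite gt_eqF.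
    rewrite -mulrDr mulNr [leRHS]mulrCA ler_wpM2l//.
    have := even_pow_le_exp (c * V w k l) m0 => h.
    have h' := ler_wpM2l (exprn_ge0 m (ltW (_ : 0 < r%:R^-1 :> R))) h.
    apply: le_trans (h' _) _; first by rewrite invr_gt0.
    rewrite mulrA -mul2n exprM -exprMn (_ : r%:R^-1 * _ = m%:R)//.
    by rewrite /r !natrM; field; rewrite pnatr_eq0 -lt0n.
  rewrite -mulr_sumr big_split/= /B ler_wpM2l ?exprn_ge0//.
  by have := mexp c c2; have := mexp (- c); rewrite sqrrN => /(_ c2); lra.
apply: (@le_trans _ _ (r%:R * \sum_(k in net R r) \sum_(l in net R r) B)).
  apply: (@le_trans _ _ (\sum_(w : Omega r) wt w * (r%:R *
     \sum_(k in net R r) \sum_(l in net R r) (V w k l / r%:R) ^+ m.*2))).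
    by apply: ler_sum => w _; rewrite ler_wpM2l//; exact: trace_pow_net.
  rewrite (eq_bigr (fun w : Omega r => r%:R * \sum_(k in net R r)
      wt w * \sum_(l in net R r) (V w k l / r%:R) ^+ m.*2)); last first.
    by move=> w _; rewrite mulrCA; congr (_ * _); rewrite mulr_sumr.
  rewrite -mulr_sumr ler_wpM2l ?ler0n// exchange_big/=; apply: ler_sum => k kN.
  rewrite (eq_bigr (fun w : Omega r => \sum_(l in net R r)
      wt w * (V w k l / r%:R) ^+ m.*2)); last by move=> w _; rewrite mulr_sumr.
  by rewrite exchange_big/=; apply: ler_sum => l lN; exact: meanV.
rewrite !sumr_const -mulrnA -[B *+ _]mulr_natr [(#|_| * _)%:R]natrM.
have cn : #|net R r|%:R <= expR (6 * r%:R) :> R by exact: card_net.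
apply: (@le_trans _ _ (r%:R * (B * (expR (6 * r%:R) * expR (6 * r%:R))))).
  rewrite ler_wpM2l ?ler0n// ler_wpM2l ?ler_pM ?ler0n//.
  by rewrite mulr_ge0 ?exprn_ge0// mulr_ge0// expR_ge0.
rewrite le_eqVlt; apply/orP; left; apply/eqP.
rewrite exprMn -expRM_natl /B /r natrM.
have -> : m%:R * (48 + 64 * C) =
  16 * (4 * m%:R) * C + (6 * (4 * m%:R) + 6 * (4 * m%:R)) by ring.
by rewrite !expRD; ring.
Qed.

End DenseWalks.

(** * The noise *)

Lemma funrposB_pointwise (R : realDomainType) (S : Type) (g : S -> R) x :
  g x = g^\+ x - g^\- x.
Proof. by rewrite -[in LHS](funrposBneg g). Qed.

(** * Densities and products of independent variables *)

Section Density.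
Import HBNNSimple.
Local Open Scope ereal_scope.
Context d (T : measurableType d) d' (Y : measurableType d') (R : realType).
Variables (mu : {measure set T -> \bar R}) (nu : {measure set Y -> \bar R}).
Variables (f : T -> Y) (H : T -> R).
Hypotheses (mf : measurable_fun setT f) (mH : measurable_fun setT H).
Hypothesis H0 : forall x, (0 <= H x)%R.
Hypothesis nuE : forall B, measurable B ->
  nu B = \int[mu]_x (\1_B (f x) * H x)%:E.

(** Simple functions and monotone convergence. It serves twice: for the normal density against
    Lebesgue measure, and for independence, where [f] is one variable and [H] the product of the
    functions of the others. *)
Lemma ge0_integral_density (h : Y -> R) :
  measurable_fun setT h -> (forall y, (0 <= h y)%R) ->
  \int[nu]_y (h y)%:E = \int[mu]_x (h (f x) * H x)%:E.
Proof.
move=> mh h0.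
have meh : measurable_fun setT (EFin \o h) by exact/measurable_EFinP.
pose g := nnsfun_approx measurableT meh.
have gcvg y : (fun n => (g n y)%:E) @ \oo --> (h y)%:E.
  by apply: cvg_nnsfun_approx => // z _; rewrite lee_fin.
have mgf n : measurable_fun setT (g n \o f) by exact: measurableT_comp.
transitivity (limn (fun n => \int[nu]_y (g n y)%:E)).
  rewrite -monotone_convergence//.
  - by apply: eq_integral => y _; apply/esym/cvg_lim => //; exact: gcvg.
  - by move=> n; exact/measurable_EFinP/measurable_funP.
  - by move=> n y _; rewrite lee_fin.
  - by move=> y _ m n mn; rewrite lee_fin; exact/lefP/nd_nnsfun_approx.
rewrite [X in limn X](_ : _ = (fun n => \int[mu]_x (g n (f x) * H x)%:E)).
  rewrite -monotone_convergence//.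
  - apply: eq_integral => x _; apply/cvg_lim => //.
    have Hfin : (H x)%:E \is a fin_num by [].
    exact: (cvgeZr Hfin (gcvg (f x))).
  - by move=> n; apply/measurable_EFinP; apply: measurable_funM => //; exact: mgf.
  - by move=> n x _; rewrite lee_fin mulr_ge0.
  - move=> x _ m n mn; rewrite lee_fin ler_wpM2r//.
    exact/lefP/nd_nnsfun_approx.
apply/funext => n.
have mind k : measurable_fun setT (fun x => \1_(g n @^-1` [set k]) (f x) : R).
  by apply: (measurableT_comp _ mf); exact: measurable_indic.
have pos k x : 0 <= k%:E * (\1_(g n @^-1` [set k]) (f x) * H x)%:E.
  have [k0|k0] := leP 0%R k; first by rewrite mule_ge0// lee_fin mulr_ge0.
  by rewrite preimage_nnfun0// indic0 mul0r mule0.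
transitivity (\sum_(k \in range (g n)) k%:E * nu (g n @^-1` [set k])).
  under eq_integral do rewrite fimfunE -fsumEFin//.
  rewrite ge0_integral_fsum//; last 2 first.
  - by move=> y; exact/measurable_EFinP/measurable_funM.
  - by move=> y x _; rewrite nnfun_muleindic_ge0.
  apply: eq_fsbigr => r _; rewrite integralZl_indic_nnsfun// integral_indic//=.
  by rewrite setIT.
transitivity (\sum_(k \in range (g n))
    \int[mu]_x (k%:E * (\1_(g n @^-1` [set k]) (f x) * H x)%:E)).
  apply: eq_fsbigr => k _; rewrite nuE//.
  have [k0|k0] := leP 0%R k; last first.
    rewrite preimage_nnfun0//.
    under eq_integral do rewrite indic0 mul0r.
    under [RHS]eq_integral do rewrite indic0 mul0r mule0.
    by rewrite integral0 mule0.
  rewrite ge0_integralZl//.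
  - by apply/measurable_EFinP; exact: measurable_funM.
  - by move=> x _; rewrite lee_fin mulr_ge0.
rewrite -ge0_integral_fsum//.
- apply: eq_integral => x _; rewrite [in RHS]fimfunE.
  rewrite mulr_fsuml// -fsumEFin//.
  by apply: eq_fsbigr => k _; rewrite -EFinM mulrA.
- move=> k; under eq_fun do rewrite -EFinM.
  by apply/measurable_EFinP; do 2 apply: measurable_funM => //.
Qed.

End Density.

Section IndependentProducts.
Local Open Scope ereal_scope.
Context {R : realType} d (T : measurableType d) (P : probability T R).
Variables (I : finType) (F : I -> set (set T)) (f : I -> T -> R).
Hypothesis FP : mutually_independent P F.
Hypothesis mf : forall i, measurable_fun setT (f i).
Hypothesis Ff : forall i B, measurable B -> F i (f i @^-1` B).

(** Outside [K] the functions are indicators; the induction is on the size of [K]. With an indicator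
    of B at the index k, the induction hypothesis says that integrating it against the product of
    the other functions gives a constant times the law of [f k] at B, and the density identity then
    replaces the indicator by [h k]. *)
Let ge0_integral_prod_rec (K : {set I}) (h : I -> R -> R) :
  (forall i, measurable_fun setT (h i)) -> (forall i y, (0 <= h i y)%R) ->
  (forall i, i \notin K -> exists2 B, measurable B & h i = \1_B) ->
  (forall i, \int[P]_x (h i (f i x))%:E < +oo) ->
  \int[P]_x (\prod_i h i (f i x))%:E = \prod_i \int[P]_x (h i (f i x))%:E.
Proof.
have [m] := ubnP #|K|; elim: m K h => // m IH K h Km mh h0 hB hfin.
have mhf i : measurable_fun setT (fun x => h i (f i x)).
  exact: measurableT_comp.
have [K0|[k kK]] := set_0Vmem K.
  have /choice[B BP] : forall i, exists B, measurable B /\ h i = \1_B.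
    by move=> i; have [|B mB ->] := hB i; [rewrite K0 inE|exists B].
  have mB i := (BP i).1; have hE i := (BP i).2.
  transitivity (P (\bigcap_(i in [set` [set: I]%SET]) (f i @^-1` B i))).
    rewrite -[X in P X]setIT -integral_indic//; last first.
      apply: fin_bigcap_measurable => // i _.
      by rewrite -[X in measurable X]setTI; exact: mf.
    apply: eq_integral => x _; congr EFin; rewrite indicE.
    have [xB|xB] := boolP (x \in _).
      rewrite big1// => i _; rewrite hE indicE; case: (boolP (_ \in _)) => //.
      move/negP; case; rewrite inE; move: xB; rewrite inE => /(_ i); apply.
      by rewrite /= inE.
    apply/eqP; rewrite prodf_seq_eq0; apply/hasP; apply: contrapT => no.
    move/negP: xB; apply; rewrite inE => i _ /=; apply: contrapT => xi.
    apply: no; exists i; rewrite ?mem_index_enum//= hE indicE.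
    by rewrite memNset.
  rewrite FP; last by move=> i _; exact: Ff.
  rewrite big_mkcond/=; apply: eq_bigr => i _; rewrite inE.
  rewrite -[X in P X]setIT -integral_indic//; last first.
    by rewrite -[X in measurable X]setTI; exact: mf.
  by apply: eq_integral => x _; rewrite hE.
pose H x := (\prod_(i | i != k) h i (f i x))%R.
have H0 x : (0 <= H x)%R by rewrite prodr_ge0.
have mH : measurable_fun setT H.
  rewrite (_ : H = fun x => \prod_(i <- [seq i <- index_enum I | i != k]) h i (f i x))%R.
    by apply: measurable_prod => i _; exact: mhf.
  by apply/funext => x; rewrite big_filter.
pose e i := fine (\int[P]_x (h i (f i x))%:E).
have eE i : \int[P]_x (h i (f i x))%:E = (e i)%:E.
  rewrite fineK// ge0_fin_numE//; apply: integral_ge0 => x _.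
  by rewrite lee_fin.
have e0 i : (0 <= e i)%R by rewrite fine_ge0// integral_ge0// => x _; rewrite lee_fin.
pose c := (\prod_(i | i != k) e i)%R.
have c0 : (0 <= c)%R by rewrite prodr_ge0.
have Hind B : measurable B ->
    \int[P]_x (\1_B (f k x) * H x)%:E = P (f k @^-1` B) * c%:E.
  move=> mB; pose h' i := if i == k then \1_B : R -> R else h i.
  have mfB : measurable (f k @^-1` B) by rewrite -[X in measurable X]setTI; exact: mf.
  have intB : \int[P]_x (\1_B (f k x))%:E = P (f k @^-1` B).
    by rewrite -[X in P X]setIT -integral_indic.
  transitivity (\int[P]_x (\prod_i h' i (f i x))%:E).
    apply: eq_integral => x _; rewrite [in RHS](bigD1 k)//= /h' eqxx.
    by congr (_ * _)%:E; apply: eq_bigr => i /negbTE ->.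
  have h'E i : i != k -> h' i = h i by rewrite /h' => /negbTE ->.
  have h'k : h' k = \1_B by rewrite /h' eqxx.
  have h'int i : \int[P]_x (h' i (f i x))%:E =
      if i == k then P (f k @^-1` B) else (e i)%:E.
    by case: eqVneq => [->|ik]; [rewrite h'k intB|rewrite h'E].
  have := IH (K :\ k)%SET h'; rewrite [#|K|](cardsD1 k) kK in Km.
  move=> /(_ Km) -> //.
  - rewrite (bigD1 k)//= h'int eqxx; congr (_ * _).
    rewrite /c -prodEFin; apply: eq_bigr => i ik; rewrite h'int.
    by rewrite (negbTE ik).
  - by move=> i; rewrite /h'; case: ifP.
  - by move=> i y; rewrite /h'; case: ifP => // _; rewrite indicE.
  - move=> i; rewrite !inE negb_and negbK => /orP[/eqP ->|iK].
      by exists B; rewrite ?h'k.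
    have ik : i != k by apply: contraNneq iK => ->.
    by rewrite h'E//; exact: hB.
  - move=> i; rewrite h'int; case: eqP => _; last by rewrite ltry.
    by rewrite (le_lt_trans (probability_le1 P mfB)) ?ltry.
pose X : {RV P >-> R} := HB.pack (f k) (isMeasurableFun.Build _ _ _ _ (f k) (mf k)).
have nuE B : measurable B ->
    mscale (NngNum c0) (distribution P X) B = \int[P]_x (\1_B (X x) * H x)%:E.
  by move=> mB; rewrite Hind// muleC.
transitivity (\int[P]_x (h k (X x) * H x)%:E).
  by apply: eq_integral => x _; rewrite (bigD1 k).
rewrite -(ge0_integral_density (mf k) mH H0 nuE)//.
rewrite ge0_integral_mscale//; last 2 first.
- exact/measurable_EFinP.
- by move=> y _; rewrite lee_fin.
have mhk : measurable_fun setT (EFin \o h k) by exact/measurable_EFinP.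
rewrite (ge0_integral_distribution X mhk); last by move=> y; rewrite lee_fin.
rewrite [RHS](bigD1 k)//= muleC; congr (_ * _).
by rewrite -prodEFin; apply: eq_bigr => i _; rewrite eE.
Qed.

(* Functions of independent variables: the indicators in the definition of
   independence are replaced one at a time. *)
Lemma ge0_integral_prod (h : I -> R -> R) :
  (forall i, measurable_fun setT (h i)) -> (forall i y, (0 <= h i y)%R) ->
  (forall i, \int[P]_x (h i (f i x))%:E < +oo) ->
  \int[P]_x (\prod_i h i (f i x))%:E = \prod_i \int[P]_x (h i (f i x))%:E.
Proof.
move=> mh h0 hfin; apply: (@ge0_integral_prod_rec [set: I]%SET) => //.
by move=> i; rewrite inE.
Qed.

(** Here [K] contains the indices whose function may change sign. Splitting [h k] into positive and
    negative parts removes k, and both sides are additive in that factor. *)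
Let integral_prod_rec (K : {set I}) (h : I -> R -> R) :
  (forall i, measurable_fun setT (h i)) ->
  (forall i, P.-integrable setT (fun x => (h i (f i x))%:E)) ->
  (forall i, i \notin K -> forall y, (0 <= h i y)%R) ->
  P.-integrable setT (fun x => (\prod_i h i (f i x))%:E) /\
  (\int[P]_x (\prod_i h i (f i x)) = \prod_i \int[P]_x (h i (f i x)))%R.
Proof.
have [m] := ubnP #|K|; elim: m K h => // m IH K h Km mh hi hK.
have mhf i : measurable_fun setT (fun x => h i (f i x)).
  exact: measurableT_comp.
have mprod : measurable_fun setT (fun x => \prod_i h i (f i x))%R.
  by apply: measurable_prod => i _; exact: mhf.
have iprod : P.-integrable setT (fun x => (\prod_i h i (f i x))%:E).
  apply/integrableP; split; first exact/measurable_EFinP.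
  have absfin i : \int[P]_x (`|h i (f i x)|)%:E < +oo.
    by have /integrableP[_] := hi i.
  rewrite (_ : \int[P]_x _ = \int[P]_x (\prod_i `|h i (f i x)|)%:E); last first.
    by apply: eq_integral => x _; rewrite abse_EFin normr_prod.
  rewrite (@ge0_integral_prod (fun i y => `|h i y|)%R)//.
    have fin i : \int[P]_x (`|h i (f i x)|)%:E \is a fin_num.
      rewrite ge0_fin_numE//; apply: integral_ge0 => x _.
      by rewrite lee_fin.
    under eq_bigr do rewrite -(fineK (fin _)).
    by rewrite prodEFin ltry.
  by move=> i; exact: measurableT_comp.
split => //.
have [K0|[k kK]] := set_0Vmem K.
  have h0 i y : (0 <= h i y)%R by apply: hK; rewrite K0 inE.
  rewrite /Rintegral ge0_integral_prod//; last first.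
    move=> i; have /integrableP[_] := hi i; congr (_ < _).
    by apply: eq_integral => x _; rewrite gee0_abs ?lee_fin.
  have fin i : \int[P]_x (h i (f i x))%:E \is a fin_num by exact: integrable_fin_num.
  rewrite -[RHS]/(fine (\prod_i fine (\int[P]_x (h i (f i x))%:E))%:E) -prodEFin.
  by congr fine; apply: eq_bigr => i _; rewrite fineK.
pose hp (b : bool) i y := if i == k then (if b then (h k)^\+ y else (h k)^\- y)%R else h i y.
have rest b : (\prod_(i | i != k) \int[P]_x (hp b i (f i x)) =
    \prod_(i | i != k) \int[P]_x (h i (f i x)))%R.
  by apply: eq_bigr => i ik; apply: eq_Rintegral => x _; rewrite /hp (negbTE ik).
have Km' : (#|K :\ k|%SET < m)%N by move: Km; rewrite [#|K|](cardsD1 k) kK.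
have hpi b i : P.-integrable setT (fun x => (hp b i (f i x))%:E).
  rewrite /hp; case: eqVneq => [->|_] //.
  by case: b; [exact: (integrable_funrpos measurableT (hi k))|
               exact: (integrable_funrneg measurableT (hi k))].
have [|||ip Ep] := IH _ (hp true) Km'.
- by move=> i; rewrite /hp; case: eqP => [_|_]; [apply: measurable_funrpos; exact: mh|exact: mh].
- exact: hpi.
- move=> i; rewrite !inE negb_and negbK /hp; case: eqVneq => //= ik iK y.
  exact: hK.
have [|||im Em] := IH _ (hp false) Km'.
- by move=> i; rewrite /hp; case: eqP => [_|_]; [apply: measurable_funrneg; exact: mh|exact: mh].
- exact: hpi.
- move=> i; rewrite !inE negb_and negbK /hp; case: eqVneq => //= ik iK y.
  exact: hK.
have prodD x : (\prod_i h i (f i x) = \prod_i hp true i (f i x) - \prod_i hp false i (f i x))%R.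
  rewrite (bigD1 k)//= [X in _ = (X - _)%R](bigD1 k)//= [X in _ = (_ - X)%R](bigD1 k)//=.
  have E b : (\prod_(i | i != k) hp b i (f i x) = \prod_(i | i != k) h i (f i x))%R.
    by apply: eq_bigr => i /negbTE ik; rewrite /hp ik.
  rewrite !E -mulrBl; congr (_ * _)%R.
  by rewrite /hp eqxx [LHS]funrposB_pointwise.
transitivity (\int[P]_x (\prod_i hp true i (f i x) - \prod_i hp false i (f i x)))%R.
  by apply: eq_Rintegral => x _; rewrite prodD.
rewrite RintegralB// Ep Em [in RHS](bigD1 k)//= [X in (X - _)%R = _](bigD1 k)//=.
rewrite [X in (_ - X)%R = _](bigD1 k)//= !rest -mulrBl; congr (_ * _)%R.
rewrite -RintegralB//; last 2 first.
  exact: (hpi true k).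
  exact: (hpi false k).
by apply: eq_Rintegral => x _; rewrite /hp eqxx [RHS]funrposB_pointwise.
Qed.

Lemma integral_prod_independent (h : I -> R -> R) :
  (forall i, measurable_fun setT (h i)) ->
  (forall i, P.-integrable setT (fun x => (h i (f i x))%:E)) ->
  P.-integrable setT (fun x => (\prod_i h i (f i x))%:E) /\
  (\int[P]_x (\prod_i h i (f i x)) = \prod_i \int[P]_x (h i (f i x)))%R.
Proof.
move=> mh hi; apply: (@integral_prod_rec [set: I]%SET) => //.
by move=> i; rewrite inE.
Qed.

End IndependentProducts.

(** * Moments of the normal and Bernoulli laws *)

Section NormalMoments.
Context {R : realType}.
Notation mu := (@lebesgue_measure R).

Lemma ge0_integral_oppr (g : R -> R) :
  measurable_fun setT g -> (forall x, 0 <= g x) ->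
  (\int[mu]_x (g (- x))%:E = \int[mu]_x (g x)%:E)%E.
Proof.
move=> mg g0.
have meg : measurable_fun setT (EFin \o g) by exact/measurable_EFinP.
have := @ge0_integral_pushforward _ _ _ _ R
  (-%R : measurableTypeR R -> measurableTypeR R) (@oppr_measurable R setT)
  mu setT (EFin \o g) measurableT meg.
rewrite preimage_setT => <- //; last by move=> x _; rewrite lee_fin.
apply: eq_measure_integral => B mB _; exact: lebesgue_measureN.
Qed.

(** From (|x| - 2t)^2 >= 0, |x| <= t (1 + x^2 / 4t^2) <= t exp(x^2 / 4t^2); in the k-th power, k <=
    t^2 leaves exp(x^2 / 4). *)
Lemma pow_le_expR (k t : nat) (x : R) : (0 < t)%N -> (k <= t ^ 2)%N ->
  `|x| ^+ k <= t%:R ^+ k * expR (x ^+ 2 / 4).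
Proof.
move=> t0 kt; have tR : 0 < t%:R :> R by rewrite ltr0n.
have h : `|x| <= t%:R * expR ((x / t%:R) ^+ 2 / 4).
  have e : x ^+ 2 = `|x| ^+ 2 by rewrite real_normK ?num_real.
  apply: (@le_trans _ _ (t%:R * (1 + (x / t%:R) ^+ 2 / 4))); last first.
    by rewrite ler_pM2l// expR_ge1Dx.
  rewrite expr_div_n e; set a := `|x|; set s := t%:R in tR *.
  have -> : s * (1 + a ^+ 2 / s ^+ 2 / 4) = (s ^+ 2 * 4 + a ^+ 2) / (4 * s).
    by field; rewrite gt_eqF.
  rewrite ler_pdivlMr ?mulr_gt0//.
  by have := sqr_ge0 (a - 2 * s); nra.
apply: (@le_trans _ _ ((t%:R * expR ((x / t%:R) ^+ 2 / 4)) ^+ k)).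
  by apply: lerXn2r; rewrite ?nnegrE// mulr_ge0 ?(ltW tR)// expR_ge0.
rewrite exprMn ler_wpM2l ?exprn_ge0 ?(ltW tR)// -expRM_natl ler_expR.
rewrite expr_div_n -natrX mulrA ler_wpM2r// mulrA ler_pdivrMr ?ltr0n ?expn_gt0 ?t0//.
by rewrite mulrC ler_wpM2l ?sqr_ge0// ler_nat.
Qed.

(** As -x^2 / 2 + x^2 / 4 = -x^2 / 4, the weighted density is a multiple of the density of variance
    2, whose integral is known. *)
Lemma normal_pdf_gaussian_weight (x : R) :
  expR (x ^+ 2 / 4) * normal_pdf 0 1 x = Num.sqrt 2 * normal_pdf 0 (Num.sqrt 2) x.
Proof.
have s20 : Num.sqrt 2 != 0 :> R by rewrite gt_eqF// sqrtr_gt0.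
have s2 : Num.sqrt 2 ^+ 2 = 2 :> R by rewrite sqr_sqrtr.
rewrite !normal_pdfE ?oner_eq0// /normal_peak /normal_fun s2 subr0 expr1n mul1r.
have -> : Num.sqrt (2 * pi *+ 2) = Num.sqrt 2 * Num.sqrt (pi *+ 2) :> R.
  by rewrite -mulrnAr sqrtrM.
have p0 : Num.sqrt (pi *+ 2) != 0 :> R.
  by rewrite gt_eqF// sqrtr_gt0 mulrn_wgt0// pi_gt0.
have eE : expR (x ^+ 2 / 4) * expR (- x ^+ 2 / (1 *+ 2)) = expR (- x ^+ 2 / (2 *+ 2)).
  by rewrite -expRD; congr expR; field.
by rewrite mulrCA eE; field; rewrite s20 p0.
Qed.

Lemma normal_abs_moment (k t : nat) : (0 < t)%N -> (k <= t ^ 2)%N ->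
  (\int[mu]_x (`|x| ^+ k * normal_pdf 0 1 x)%:E <= (2 * t%:R ^+ k : R)%:E)%E.
Proof.
move=> t0 kt.
have mk : measurable_fun setT (fun x : R => `|x| ^+ k).
  by apply: measurable_funX; exact: normr_measurable.
apply: (@le_trans _ _ (\int[mu]_x ((t%:R ^+ k * Num.sqrt 2)%:E * (normal_pdf 0 (Num.sqrt 2) x)%:E)))%E.
  apply: ge0_le_integral => //.
  - by move=> x _; rewrite lee_fin mulr_ge0 ?exprn_ge0// normal_pdf_ge0.
  - apply/measurable_EFinP; apply: measurable_funM => //; exact: measurable_normal_pdf.
  - apply/measurable_EFinP; apply: measurable_funM => //; exact: measurable_normal_pdf.
  - move=> x _; rewrite -EFinM lee_fin -mulrA -normal_pdf_gaussian_weight mulrA.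
    by rewrite ler_wpM2r ?normal_pdf_ge0// pow_le_expR.
rewrite ge0_integralZl//.
- rewrite integral_normal_pdf mule1 lee_fin mulrC ler_wpM2r ?exprn_ge0//.
  have : Num.sqrt 2 ^+ 2 = 2 :> R by rewrite sqr_sqrtr.
  by have := sqrtr_ge0 (2 : R); nra.
- apply/measurable_EFinP; exact: measurable_normal_pdf.
- by move=> x _; rewrite lee_fin normal_pdf_ge0.
Qed.

Context d (T : measurableType d) (P : probability T R).

Lemma normal_law_integral (X : {RV P >-> R}) (h : R -> R) :
  has_law X (normal_prob 0 1) -> measurable_fun setT h -> (forall x, 0 <= h x) ->
  (\int[P]_w (h (X w))%:E = \int[mu]_x (h x * normal_pdf 0 1 x)%:E)%E.
Proof.
move=> lawX mh h0.
have meh : measurable_fun setT (EFin \o h) by exact/measurable_EFinP.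
have := ge0_integral_distribution X meh; rewrite /= => <-; last by move=> y; rewrite lee_fin.
have mpdf : measurable_fun setT (normal_pdf 0 1 : R -> R) by exact: measurable_normal_pdf.
have pdf0 (x : R) : 0 <= normal_pdf 0 1 x by exact: normal_pdf_ge0.
have nuE (B : set R) : measurable B -> (distribution P X B =
    \int[mu]_x (\1_B (idfun x) * normal_pdf 0 1 x)%:E)%E.
  move=> mB; rewrite (lawX _ mB) /normal_prob integral_mkcond.
  apply: eq_integral => x _; rewrite /patch indicE /=.
  by case: ifP => _; rewrite ?mul1r ?mul0r.
have mid : measurable_fun setT (idfun : measurableTypeR R -> R).
  by move=> _ B mB; rewrite setTI; exact: mB.
exact: (@ge0_integral_density _ _ _ _ R mu (distribution P X) idfun (normal_pdf 0 1)
  mid mpdf pdf0 nuE h mh h0).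
Qed.

Lemma normal_law_moments (X : {RV P >-> R}) : has_law X (normal_prob 0 1) ->
  [/\ forall k, P.-integrable setT (fun w => (X w ^+ k)%:E),
      \int[P]_w X w = 0
    & forall k t, (0 < t)%N -> (k <= t ^ 2)%N ->
      `|\int[P]_w (X w ^+ k)| <= 2 * t%:R ^+ k].
Proof.
move=> lawX.
have mX : measurable_fun setT X by exact: measurable_funP.
have mk k : measurable_fun setT (fun x : R => `|x| ^+ k).
  by apply: measurable_funX; exact: normr_measurable.
have absm k t : (0 < t)%N -> (k <= t ^ 2)%N ->
    (\int[P]_w (`|X w| ^+ k)%:E <= (2 * t%:R ^+ k : R)%:E)%E.
  by move=> t0 kt; rewrite (normal_law_integral lawX (mk k)) ?normal_abs_moment.
have int k : P.-integrable setT (fun w => (X w ^+ k)%:E).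
  apply/integrableP; split; first by apply/measurable_EFinP; exact: measurable_funX.
  rewrite (_ : (\int[P]_w _ = \int[P]_w (`|X w| ^+ k)%:E)%E); last first.
    by apply: eq_integral => w _; rewrite abse_EFin normrX.
  by apply: (le_lt_trans (@absm k k.+1 _ _)); rewrite ?ltry//; nia.
split => //.
(* The reflection of the line preserves the normal density and exchanges positive and negative
   parts, so the mean vanishes. *)
- have mp : measurable_fun setT (fun x : R => Num.max x 0) by exact: measurable_maxr.
  have mn : measurable_fun setT (fun x : R => Num.max (- x) 0).
    by apply: measurable_maxr => //; exact: oppr_measurable.
  have eqpn : (\int[P]_w (Num.max (X w) 0)%:E = \int[P]_w (Num.max (- X w) 0)%:E)%E.
    rewrite (normal_law_integral lawX mp); last by move=> x; rewrite le_max lexx orbT.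
    rewrite (normal_law_integral lawX mn); last by move=> x; rewrite le_max lexx orbT.
    rewrite -[LHS]ge0_integral_oppr; last 2 first.
    - by apply: measurable_funM => //; exact: measurable_normal_pdf.
    - by move=> x; rewrite mulr_ge0 ?normal_pdf_ge0// le_max lexx orbT.
    apply: eq_integral => x _; congr (_ * _)%:E.
    by rewrite !normal_pdfE ?oner_eq0// /normal_fun !subr0 sqrrN.
  have iX : P.-integrable setT (EFin \o X).
    by apply: eq_integrable (int 1%N) => // w _; rewrite expr1.
  rewrite (_ : \int[P]_w X w = \int[P]_w (X^\+ w - X^\- w)); last first.
    by apply: eq_Rintegral => w _; rewrite [LHS]funrposB_pointwise.
  rewrite RintegralB//; [|exact: (integrable_funrpos measurableT iX)
    |exact: (integrable_funrneg measurableT iX)].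
  by apply/eqP; rewrite subr_eq0; apply/eqP; rewrite /Rintegral; congr fine.
- move=> k t t0 kt; apply: (le_trans (le_normr_Rintegral _ (int k))) => //.
  rewrite -lee_fin; apply: le_trans (absm k t t0 kt).
  rewrite /Rintegral fineK.
    by under eq_integral do rewrite normrX.
  apply: integrable_fin_num => //; apply: integrable_norm.
  exact: int.
Qed.

Lemma bernoulli_law_integral (p : R) (X : {RV P >-> bool}) (h : bool -> R) :
  0 <= p <= 1 -> has_law X (bernoulli_prob p) ->
  P.-integrable setT (fun w => (h (X w))%:E) /\
  \int[P]_w h (X w) = p * h true + (1 - p) * h false.
Proof.
move=> p01 lawX.
have mX : measurable (X @^-1` [set true]) by rewrite -[X in measurable X]setTI; exact: measurable_funP.
have hE w : h (X w) = h false + (h true - h false) * \1_(X @^-1` [set true]) w.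
  rewrite indicE; case: (boolP (w \in _)); rewrite ?inE /=.
    by move=> ->; rewrite mulr1 addrC subrK.
  by move/negP; rewrite inE /=; case: (X w) => //; rewrite mulr0 addr0.
have i1 : P.-integrable setT (fun w => (\1_(X @^-1` [set true]) w : R)%:E).
  exact: integrable_indic.
have i2 : P.-integrable setT (fun w => ((h true - h false) * \1_(X @^-1` [set true]) w : R)%:E).
  by apply: eq_integrable (integrableZl measurableT (h true - h false) i1).
have i0 : P.-integrable setT (fun w : T => (h false)%:E).
  exact: finite_measure_integrable_cst.
have -> : (fun w => (h (X w))%:E) =
    (fun w => (h false)%:E + ((h true - h false) * \1_(X @^-1` [set true]) w)%:E)%E.
  by apply/funext => w; rewrite hE EFinD.
split; first exact: integrableD.
rewrite (_ : \int[P]_w h (X w) =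
    \int[P]_w (h false + (h true - h false) * \1_(X @^-1` [set true]) w)); last first.
  by apply: eq_Rintegral => w _; rewrite hE.
rewrite RintegralD// RintegralZl// Rintegral_cst//.
have -> : \int[P]_w \1_(X @^-1` [set true]) w = p.
  have PX : P (X @^-1` [set true]) = p%:E.
    transitivity (distribution P X [set true]); first by [].
    rewrite lawX// bernoulli_probE//= !diracE mem_set//= memNset//=.
    by rewrite mule1 mule0 adde0.
  rewrite /Rintegral (_ : (\int[P]_w (\1_(X @^-1` [set true]) w)%:E = p%:E)%E)//.
  by rewrite integral_indic// setIT; exact: PX.
have -> : fine (P setT) = 1 by rewrite probability_setT.
by ring.
Qed.

End NormalMoments.

(** The iterated Cauchy-Schwarz inequality needs an exponent that is a power of 2; the smallest one
    above D loses at most a factor 2. *)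
Lemma exists_pow2_between (R : archiRealFieldType) (D : R) : 1 <= D ->
  exists k : nat, D <= (2 ^ k.+1)%:R /\ (2 ^ k.+1)%:R <= 2 * D.
Proof.
move=> D1; have ex : exists k : nat, D <= (2 ^ k.+1)%:R.
  exists (Num.truncn D).+1; apply: ltW; apply: lt_le_trans (truncnS_gt D) _.
  by rewrite ler_nat; apply: leq_trans (ltnW (ltn_expl _ (ltnSn 1))) _; rewrite leq_exp2l.
have [k Dk kmin] := ex_minnP ex; exists k; split => //.
case: k Dk kmin => [|k] Dk kmin; first by rewrite expn1; lra.
have := contraNN (kmin k); rewrite ltnn => /(_ isT); rewrite -ltNge => h.
by rewrite expnS natrM ler_wpM2l// ltW.
Qed.

(** * The norm of a sparse random matrix *)

Section SparseMatrix.
Context {R : realType} d (T : measurableType d) (P : probability T R) (n : nat).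

(* The entries of N behave, for the purpose of the trace method, as independent
   centered variables with k-th moment at most p times that of a fixed
   subgaussian law. *)
Definition moments_dominated (p : R) (N : T -> 'M[R]_n) :=
  forall (M : nat -> R) (L : nat), M 0%N = 1 -> M 1%N = 0 -> (forall k, 0 <= M k) ->
    (forall k, (2 <= k <= L)%N -> exists t : nat,
       [/\ (0 < t)%N, (k <= t ^ 2)%N & 2 * t%:R ^+ k <= M k]) ->
    forall t : {ffun 'I_L.+1 -> 'I_n},
      P.-integrable setT (fun w => (\prod_e N w e.1 e.2 ^+ edge_count t e)%:E) /\
      \int[P]_w (\prod_e N w e.1 e.2 ^+ edge_count t e) <=
      \prod_e (if edge_count t e == 0%N then 1 else p * M (edge_count t e)).

Lemma prod_edge_weight (p : R) (M : nat -> R) L (t : {ffun 'I_L.+1 -> 'I_n}) :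
  M 0%N = 1 ->
  \prod_e (if edge_count t e == 0%N then 1 else p * M (edge_count t e)) =
  p ^+ nb_edges t * \prod_e M (edge_count t e).
Proof.
move=> M0; rewrite /nb_edges -prodr_const [X in X * _]big_mkcond/= -big_split/=.
apply: eq_bigr => e _; rewrite edge_count_eq0.
case: ifPn => [eN|]; last by rewrite negbK => ->.
rewrite (negbTE eN) mul1r.
by move: eN; rewrite -edge_count_eq0 => /eqP ->.
Qed.

Lemma mean_trace_le (p C : R) (K : finType) (q y : K -> R) (N : T -> 'M[R]_n) (j : nat)
    (m := j.*2) :
  (0 < n)%N -> 0 < p <= 1 -> (0 < j)%N -> n%:R * p <= m%:R ->
  moments_dominated p N -> 0 <= C ->
  (forall a, 0 <= q a) -> \sum_a q a = 1 -> \sum_a q a * y a = 0 ->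
  (forall k, 0 <= moment q y k) ->
  (forall k, (2 <= k <= m.*2)%N -> exists t : nat,
     [/\ (0 < t)%N, (k <= t ^ 2)%N & 2 * t%:R ^+ k <= moment q y k]) ->
  (forall th, \sum_a q a * expR (th * y a) <= expR (C * th ^+ 2)) ->
  P.-integrable setT (fun w => (\tr ((N w *m (N w)^T) ^+ m))%:E) /\
  \int[P]_w \tr ((N w *m (N w)^T) ^+ m) <=
    p^-1 * (8 * m%:R * (expR (48 + 64 * C) * m%:R) ^+ m).
Proof.
move=> n0 /andP[p0 p1] j0 npm domN C0 q0 q1 qy M0 Mk mgf.
pose M := moment q y.
have M_0 : M 0%N = 1 by rewrite /M /moment; under eq_bigr do rewrite expr0 mulr1.
have M_1 : M 1%N = 0 by rewrite /M /moment; under eq_bigr do rewrite expr1.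
have dom := domN M m.*2 M_0 M_1 M0 Mk.
have trE w : \tr ((N w *m (N w)^T) ^+ m) =
    \sum_(t : {ffun 'I_(m.*2).+1 -> 'I_n} | closed_walk t) \prod_e N w e.1 e.2 ^+ edge_count t e.
  by rewrite -altpow_double trace_altpow; apply: eq_bigr => t _; rewrite walk_prodE.
have isum : P.-integrable setT (fun w => (\sum_(t : {ffun 'I_(m.*2).+1 -> 'I_n} | closed_walk t)
    (\prod_e N w e.1 e.2 ^+ edge_count t e)%:E)%E).
  by apply: integrable_sum => // t _; exact: (dom t).1.
have eqs : (fun w => (\tr ((N w *m (N w)^T) ^+ m))%:E) =
    (fun w => (\sum_(t : {ffun 'I_(m.*2).+1 -> 'I_n} | closed_walk t)
    (\prod_e N w e.1 e.2 ^+ edge_count t e)%:E)%E).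
  by apply/funext => w; rewrite trE sumEFin.
split; first by rewrite eqs.
apply: (@le_trans _ _ (\sum_(t : {ffun 'I_(m.*2).+1 -> 'I_n} | closed_walk t)
    p ^+ nb_edges t * \prod_e M (edge_count t e))).
  rewrite /Rintegral eqs integral_sum//; last by move=> t; exact: (dom t).1.
  rewrite (eq_bigr (fun t : {ffun 'I_(m.*2).+1 -> 'I_n} =>
     (\int[P]_w (\prod_e N w e.1 e.2 ^+ edge_count t e))%:E)); last first.
    move=> t _; rewrite /Rintegral fineK//; apply: integrable_fin_num => //.
    exact: (dom t).1.
  rewrite sumEFin/=; apply: ler_sum => t _.
  by rewrite -prod_edge_weight//; exact: (dom t).2.
(* The size 4m leaves room for the 2m + 1 positions of a walk: np + 2m + 1 <= m + 3m. *)
apply: (le_trans (@closed_walk_comparison R n (4 * m) m.*2 p M n0 p0 p1 M_0 M0 _)).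
  have -> : (4 * m)%:R = m%:R + (3 * m)%:R :> R by rewrite -natrD; congr (_%:R); lia.
  by rewrite lerD// ler_nat /m; lia.
by rewrite ler_wpM2l ?invr_ge0 ?(ltW p0)// dense_closed_walks.
Qed.

End SparseMatrix.

Lemma expRN_ln_nat (R : realType) (n k : nat) : (0 < n)%N ->
  expR (- (k%:R * ln n%:R)) = n%:R ^- k :> R.
Proof.
by move=> n0; rewrite expRN expRM_natl lnK ?posrE ?ltr0n// -exprVn exprVn.
Qed.

(** Markov's inequality for the trace: the threshold tau^m with tau = K1 e m exceeds (K1 m)^m by
    e^m, which leaves 8 (m / p) e^(-m). Then m / p <= 2n, e^(-m) <= n^(-18) and 16 <= n^4 give
    n^(-13). [K] is universal because the subgaussian constant of the comparison law is the same for
    every exponent; its factor 2 comes from m <= 2D. *)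
Lemma sparse_matrix_bound (R : realType) : exists2 K : R, 0 < K &
  forall d (T : measurableType d) (P : probability T R) (n : nat) (p : R) (N : T -> 'M[R]_n),
    (2 <= n)%N -> 0 < p <= 1 -> 1 <= n%:R * p -> 18 * ln n%:R <= n%:R * p ->
    (forall i j, measurable_fun setT (fun w => N w i j)) ->
    moments_dominated P p N ->
    exists B, [/\ measurable B, (P (~` B) <= (n%:R ^- 13 : R)%:E)%E
      & forall w, B w -> op_sq_bound (N w) (K * (n%:R * p))].
Proof.
have [C C0 law] := comparison_law R.
pose K1 : R := expR (48 + 64 * C); have K10 : 0 < K1 by exact: expR_gt0.
exists (2 * (K1 * expR 1)); first by rewrite !mulr_gt0// expR_gt0.
move=> d T P n p N n2 p01 D1 Dn mN domN.
have /andP[p0 p1] := p01.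
have n0 : (0 < n)%N by lia.
have [k [Dk kD]] := exists_pow2_between D1.
pose j := (2 ^ k)%N; pose m := j.*2.
have mE : (2 ^ k.+1)%N = m by rewrite /m /j expnS mul2n.
rewrite mE in Dk kD.
have j0 : (0 < j)%N by rewrite expn_gt0.
have [L [q [y [[q0 q1 qy] M0 Mk mgf]]]] := law m.*2.
have [itr Etr] := mean_trace_le n0 p01 j0 Dk domN C0 q0 q1 qy M0 Mk mgf.
rewrite -/m in itr Etr.
pose tau : R := K1 * expR 1 * m%:R.
have m0 : 0 < m%:R :> R by rewrite ltr0n double_gt0.
have tau0 : 0 < tau by rewrite !mulr_gt0// expR_gt0.
pose tr w := \tr ((N w *m (N w)^T) ^+ m).
have mtr : measurable_fun setT tr by apply/measurable_EFinP; case/integrableP: itr.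
have tr0 w : 0 <= tr w.
  by rewrite /tr /m -addnn exprD -{1}(gram_pow_tr _ j) -sqnE sqn_ge0.
pose B := [set w | tr w <= tau ^+ m].
have mB : measurable B.
  rewrite (_ : B = setT `&` tr @^-1` `]-oo, tau ^+ m]).
    by apply: mtr => //; exact: measurable_itv.
  by apply/seteqP; split => w /=; rewrite in_itv/=; [move=> ?; split|case].
exists B; split => //.
- have taum : 0 < tau ^+ m by rewrite exprn_gt0.
  have mBC : measurable (~` B) by exact: measurableC.
  have h1 : ((tau ^+ m)%:E * P (~` B) <= (\int[P]_w tr w)%:E)%E.
    have -> : (\int[P]_w tr w)%:E = (\int[P]_w (tr w)%:E)%E.
      by rewrite /Rintegral fineK//; exact: integrable_fin_num.
    have <- : (\int[P]_w (\1_(~` B) w : R)%:E = P (~` B))%E.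
      by rewrite integral_indic// setIT.
    rewrite -ge0_integralZl//; last 2 first.
    - by apply/measurable_EFinP; exact: measurable_indic.
    - by rewrite lee_fin ltW.
    apply: ge0_le_integral => //.
    - by move=> w _; rewrite mule_ge0// lee_fin ltW.
    - apply/measurable_EFinP; apply: measurable_funM => //; exact: measurable_indic.
    - exact/measurable_EFinP.
    - move=> w _; rewrite -EFinM lee_fin indicE.
      case: (boolP (w \in _)); last by rewrite mulr0.
      by rewrite inE /B /= mulr1 => /negP; rewrite -ltNge => /ltW.
  have Pfin : P (~` B) \is a fin_num by exact: fin_num_measure.
  rewrite -(fineK Pfin) lee_fin; rewrite -(fineK Pfin) -EFinM lee_fin in h1.
  have {h1} := le_trans h1 Etr; rewrite -ler_pdivlMl// => /le_trans; apply.
  have -> : (tau ^+ m)^-1 * (p^-1 * (8 * m%:R * (K1 * m%:R) ^+ m)) =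
      8 * (m%:R / p) * expR (- m%:R).
    have e1 : expR (- m%:R) = (expR 1 ^+ m)^-1 :> R by rewrite -expRM_natl mulr1 expRN.
    have K1m : K1 ^+ m != 0 by rewrite expf_neq0// gt_eqF.
    have em : expR 1 ^+ m != 0 :> R by rewrite expf_neq0// gt_eqF// expR_gt0.
    have mm : m%:R ^+ m != 0 :> R by rewrite expf_neq0// gt_eqF.
    rewrite e1 /tau !exprMn; field.
    by rewrite K1m em mm gt_eqF.
  have mp : m%:R / p <= 2 * n%:R.
    by rewrite ler_pdivrMr// -mulrA.
  have em : expR (- m%:R) <= n%:R ^- 18 :> R.
    by rewrite -expRN_ln_nat// ler_expR lerN2 (le_trans Dn).
  have n16 : 16 <= n%:R ^+ 4 :> R.
    by rewrite -natrX ler_nat (_ : 16 = 2 ^ 4)%N// leq_exp2r.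
  have nR : 0 < n%:R :> R by rewrite ltr0n.
  apply: (@le_trans _ _ (8 * (2 * n%:R) * n%:R ^- 18)).
    by rewrite ler_pM ?expR_ge0// ?mulr_ge0 ?invr_ge0 ?(ltW p0) ?(ltW m0)// ler_wpM2l.
  apply: (@le_trans _ _ (n%:R ^+ 4 * n%:R * n%:R ^- 18)).
    rewrite ler_wpM2r ?invr_ge0 ?exprn_ge0//.
    by rewrite mulrA ler_wpM2r// (le_trans _ n16)//; lra.
  have n18 : n%:R ^+ 18 = n%:R ^+ 5 * n%:R ^+ 13 :> R by rewrite -exprD.
  rewrite n18 -exprSr invfM mulrA divff ?mul1r//.
  by rewrite expf_neq0// gt_eqF.
- move=> w Bw x y'.
  have h : op_sq_bound (N w) tau.
    apply: (op_sq_bound_trace (k := k)); first exact: ltW.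
    by rewrite mE.
  apply: (le_trans (h x y')); rewrite ler_wpM2r ?sqn_ge0// ler_wpM2r ?sqn_ge0//.
  have := ler_wpM2l (ltW (mulr_gt0 K10 (expR_gt0 (1 : R)))) kD.
  by rewrite /tau => /le_trans; apply; rewrite mulrCA mulrA.
Qed.

Lemma bernoulli_central_moment (R : realFieldType) (p : R) (k : nat) :
  0 <= p <= 1 -> (2 <= k)%N -> `|p * (1 - p) ^+ k + (1 - p) * (- p) ^+ k| <= p.
Proof.
move=> /andP[p0 p1] k2; have q0 : 0 <= 1 - p by rewrite subr_ge0.
apply: le_trans (ler_normD _ _) _.
rewrite [`|p * _|]normrM [`|(1 - p) * _|]normrM !normrX normrN !ger0_norm//.
have e1 : (1 - p) ^+ k <= (1 - p) ^+ 2 by rewrite ler_wiXn2l//; lra.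
have e2 : p ^+ k <= p ^+ 2 by rewrite ler_wiXn2l.
have := ler_wpM2l p0 e1; have := ler_wpM2l q0 e2; nra.
Qed.

(** * The noise matrices of the model *)

Section ModelNoise.
Context {R : realType} {dT : measure_display} {T : measurableType dT}.
Variables (P : probability T R) (n d : nat) (p : R).
Variables (A : 'I_n -> 'I_n -> {RV P >-> bool}).
Variables (W : 'I_n -> 'I_n -> 'I_d -> 'I_d -> {RV P >-> R}).
Hypothesis p01 : 0 < p <= 1.
Hypothesis noise : perm_sync_noise A W p.

Definition noise_variable (i : edge n + edge n * ('I_d * 'I_d)) (w : T) : R :=
  match i with
  | inl e => (A (val e).1 (val e).2 w)%:R
  | inr (e, (a, b)) => W (val e).1 (val e).2 a b w
  end.

Lemma measurable_bool_fun (X : {RV P >-> bool}) (h : bool -> R) :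
  measurable_fun setT (fun w => h (X w)).
Proof. exact: (@measurableT_comp _ _ _ _ _ _ h). Qed.

Lemma measurable_noise_variable i : measurable_fun setT (noise_variable i).
Proof.
case: i => [e|[e [a b]]] /=; first exact: (measurable_bool_fun _ (fun b => b%:R)).
exact: measurable_funP.
Qed.

Lemma noise_sigma_algebra_variable i B :
  measurable B -> noise_sigma_algebra A W i (noise_variable i @^-1` B).
Proof.
move=> mB; case: i => [e|[e [a b]]] /=.
  by exists ((fun b : bool => b%:R) @^-1` B); rewrite ?setTI.
by exists B; rewrite ?setTI.
Qed.

Lemma prod_pairE (I J : finType) (F : I * J -> R) :
  \prod_e F e = \prod_i \prod_j F (i, j).
Proof. by rewrite pair_bigA; apply: eq_bigr => -[]. Qed.

Lemma prod_upper (G : 'I_n * 'I_n -> R) :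
  (forall e : 'I_n * 'I_n, ~~ (e.1 < e.2)%N -> G e = 1) ->
  \prod_e G e = \prod_(e : edge n) G (val e).
Proof.
move=> G1; rewrite (bigID (fun e : 'I_n * 'I_n => (e.1 < e.2)%N))/=.
rewrite [X in _ * X]big1 ?mulr1//.
rewrite (reindex_omap (val : edge n -> _) insub)/=; last first.
  by move=> e le; rewrite insubT.
by apply: eq_bigl => -[e le]; rewrite /= le insubT/= eqxx.
Qed.

(** Common to both kinds of noise. A walk using a pair outside the upper triangle contributes 0;
    otherwise its product is regrouped, edge by edge, into one adjacency factor and d^2 Gaussian
    ones, and the mean factors by independence. *)
Lemma integral_upper_prod (L : nat) (t : {ffun 'I_L.+1 -> 'I_n}) (M : nat -> R)
    (g : T -> 'I_n * 'I_n -> R) (h : edge n + edge n * ('I_d * 'I_d) -> R -> R) :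
  (forall k, 0 <= M k) ->
  (forall w (e : 'I_n * 'I_n), ~~ (e.1 < e.2)%N -> g w e = 0) ->
  (forall i, measurable_fun setT (h i)) ->
  (forall i, P.-integrable setT (fun w => (h i (noise_variable i w))%:E)) ->
  (forall w (e : edge n), g w (val e) ^+ edge_count t (val e) =
     h (inl e) (noise_variable (inl e) w) *
     \prod_ab h (inr (e, ab)) (noise_variable (inr (e, ab)) w)) ->
  (forall e : edge n, `|\int[P]_w h (inl e) (noise_variable (inl e) w) *
     \prod_ab \int[P]_w h (inr (e, ab)) (noise_variable (inr (e, ab)) w)| <=
     (if edge_count t (val e) == 0%N then 1 else p * M (edge_count t (val e)))) ->
  P.-integrable setT (fun w => (\prod_e g w e ^+ edge_count t e)%:E) /\
  \int[P]_w (\prod_e g w e ^+ edge_count t e) <=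
  \prod_e (if edge_count t e == 0%N then 1 else p * M (edge_count t e)).
Proof.
move=> M0 g0 mh ih gh hM.
pose c (e : 'I_n * 'I_n) : R :=
  if edge_count t e == 0%N then 1 else p * M (edge_count t e).
have c0 e : 0 <= c e.
  rewrite /c; case: ifP => // _; rewrite mulr_ge0//.
  by case/andP: p01 => /ltW.
have [/existsP[e0 /andP[e0l e0c]]|] :=
    boolP [exists e : 'I_n * 'I_n, ~~ (e.1 < e.2)%N && (edge_count t e != 0%N)].
  have z w : \prod_e g w e ^+ edge_count t e = 0.
    by rewrite (bigD1 e0)//= g0// expr0n (negbTE e0c) mul0r.
  under eq_fun do rewrite z.
  split; first exact: integrable0.
  rewrite (_ : \int[P]_w _ = 0); last first.
    rewrite (_ : \int[P]_w _ = \int[P]_w (0 : R)); last by apply: eq_Rintegral => w _.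
    by rewrite /Rintegral integral0.
  by apply: prodr_ge0 => e _; exact: c0.
rewrite negb_exists => /forallP low.
have low0 (e : 'I_n * 'I_n) : ~~ (e.1 < e.2)%N -> edge_count t e = 0%N.
  by move=> el; have := low e; rewrite el/= negbK => /eqP.
have prodE w : \prod_e g w e ^+ edge_count t e = \prod_i h i (noise_variable i w).
  rewrite prod_upper; last by move=> e el; rewrite low0.
  rewrite big_sumType/= prod_pairE.
  by rewrite -big_split/=; apply: eq_bigr => e _; exact: gh.
under eq_fun do rewrite prodE.
have [_ _ indep] := noise.
have [iprod Eprod] := integral_prod_independent indep measurable_noise_variable
  noise_sigma_algebra_variable mh ih.
split => //.
rewrite (_ : \int[P]_w _ = \int[P]_w (\prod_i h i (noise_variable i w))); last first.
  by apply: eq_Rintegral => w _; rewrite prodE.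
rewrite Eprod -/(c _) (prod_upper (G := c)); last by move=> e el; rewrite /c low0.
rewrite big_sumType/= prod_pairE.
rewrite -big_split/=; apply: le_trans (ler_norm _) _; rewrite normr_prod.
by apply: ler_prod => e _; rewrite normr_ge0/=; exact: hM.
Qed.

Definition adjacency_noise (w : T) : 'M[R]_n :=
  \matrix_(j, k) if (j < k)%N then (A j k w)%:R - p else 0.

(** The selector [s] picks a single Gaussian variable in each block, so that the entries above the
    diagonal remain independent. *)
Definition gaussian_noise (s : 'I_n -> 'I_n -> 'I_d * 'I_d) (w : T) : 'M[R]_n :=
  \matrix_(j, k) if (j < k)%N then (A j k w)%:R * W j k (s j k).1 (s j k).2 w else 0.

Lemma measurable_adjacency_noise j k : measurable_fun setT (fun w => adjacency_noise w j k).
Proof.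
under eq_fun do rewrite mxE.
case: (j < k)%N; last exact: measurable_cst.
exact: (measurable_bool_fun _ (fun b => b%:R - p)).
Qed.

Lemma measurable_gaussian_noise s j k :
  measurable_fun setT (fun w => gaussian_noise s w j k).
Proof.
under eq_fun do rewrite mxE.
case: (j < k)%N; last exact: measurable_cst.
apply: measurable_funM; first exact: (measurable_bool_fun _ (fun b => b%:R)).
exact: measurable_funP.
Qed.

Lemma adjacency_noise_moments : moments_dominated P p adjacency_noise.
Proof.
move=> M L M_0 M_1 M0 Mk t.
have [lawA _ _] := noise.
have /andP[p0 p1] := p01.
have p01' : 0 <= p <= 1 by rewrite ltW.
pose h (i : edge n + edge n * ('I_d * 'I_d)) : R -> R :=
  match i with inl e => fun x => (x - p) ^+ edge_count t (val e) | inr _ => fun=> 1 end.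
apply: (@integral_upper_prod L t M (fun w e => adjacency_noise w e.1 e.2) h) => //.
- by move=> w e el; rewrite mxE (negbTE el).
- case=> [e|[e ab]] /=; last exact: measurable_cst.
  by apply: measurable_funX; apply: measurable_funB.
- case=> [e|[e [a b]]] /=.
    exact: (bernoulli_law_integral (fun b => (b%:R - p) ^+ edge_count t (val e)) p01' (lawA _ _ (valP e))).1.
  exact: finite_measure_integrable_cst.
- by move=> w [[j k] le]; rewrite /= mxE/= le big1 ?mulr1.
move=> e; rewrite [X in _ * X]big1 ?mulr1; last first.
  by move=> [a b] _; rewrite /= Rintegral_cst//= probability_setT mul1r.
rewrite /= (bernoulli_law_integral (fun b => (b%:R - p) ^+ edge_count t (val e)) p01' (lawA _ _ (valP e))).2.
set c := edge_count _ _.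
have cL : (c <= L)%N by rewrite /c /edge_count (leq_trans (max_card _))// card_ord.
(* A pair crossed once contributes 0 by centering, in accordance with [M 1 = 0]. From two crossings
   on, the central moment is at most p while [M] is at least 1. *)
case: c cL => [|[|c]] cL; rewrite -?[_.+1 == 0%N]/false ?eqxx.
- by rewrite !expr0 !mulr1 addrC subrK normr1.
- rewrite M_1 mulr0 !expr1 mulr1n mulr0n sub0r.
  have -> : p * (1 - p) + (1 - p) * - p = 0 by ring.
  by rewrite normr0.
have [t0 [t00 _ tM]] := Mk c.+2 cL.
have M1 : 1 <= M c.+2.
  apply: le_trans tM; have : 1 <= t0%:R ^+ c.+2 :> R by rewrite exprn_ege1// ler1n.
  by lra.
rewrite mulr1n mulr0n sub0r.
apply: (@le_trans _ _ (p * 1)); last by rewrite ler_wpM2l// ltW.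
by rewrite mulr1 bernoulli_central_moment.
Qed.

Lemma gaussian_noise_moments s : moments_dominated P p (gaussian_noise s).
Proof.
move=> M L M_0 M_1 M0 Mk t.
have [lawA lawW _] := noise.
have /andP[p0 p1] := p01.
have p01' : 0 <= p <= 1 by rewrite ltW.
pose se (e : edge n) := s (val e).1 (val e).2.
pose h (i : edge n + edge n * ('I_d * 'I_d)) : R -> R :=
  match i with
  | inl e => fun x => x ^+ edge_count t (val e)
  | inr (e, ab) => if ab == se e then fun x => x ^+ edge_count t (val e) else fun=> 1
  end.
apply: (@integral_upper_prod L t M (fun w e => gaussian_noise s w e.1 e.2) h) => //.
- by move=> w e el; rewrite mxE (negbTE el).
- case=> [e|[e ab]] /=; first exact: measurable_funX.
  by case: ifP => _; [exact: measurable_funX|exact: measurable_cst].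
- case=> [e|[e [a b]]] /=.
    exact: (bernoulli_law_integral (fun b => b%:R ^+ edge_count t (val e)) p01' (lawA _ _ (valP e))).1.
  case: ifP => _; last exact: finite_measure_integrable_cst.
  by have [+ _ _] := normal_law_moments (lawW _ _ a b (valP e)); exact.
- move=> w e; rewrite mxE (valP e) exprMn; congr (_ * _).
  rewrite (bigD1 (se e))//= eqxx big1 ?mulr1; last by move=> ab /negbTE /= ->.
  by rewrite /se; case: (s _ _).
move=> e; rewrite (bigD1 (se e))//= [X in _ * (_ * X)]big1 ?mulr1; last first.
  move=> [a b] abs; rewrite /= (negbTE abs).
  by rewrite Rintegral_cst//= probability_setT mul1r.
rewrite (bernoulli_law_integral (fun b => b%:R ^+ edge_count t (val e)) p01' (lawA _ _ (valP e))).2.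
set c := edge_count _ _.
have cL : (c <= L)%N by rewrite /c /edge_count (leq_trans (max_card _))// card_ord.
rewrite eqxx; case: (se e) => a b /=.
have [iW W1 Wk] := normal_law_moments (lawW _ _ a b (valP e)).
case: c cL => [|[|c]] cL; rewrite -?[_.+1 == 0%N]/false ?eqxx.
- rewrite !expr0 !mulr1 addrC subrK mul1r.
  under eq_Rintegral do rewrite expr0.
  by rewrite Rintegral_cst//= probability_setT mul1r normr1.
- under eq_Rintegral do rewrite expr1.
  by rewrite W1 mulr0 normr0 M_1 mulr0.
have [t0 [t00 tc tM]] := Mk c.+2 cL.
rewrite expr1n mulr1 expr0n mulr0 addr0 normrM ger0_norm ?(ltW p0)//.
by rewrite ler_wpM2l ?(ltW p0)// (le_trans _ tM)// Wk.
Qed.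

End ModelNoise.

(** * Perturbation of the leading eigenspace *)

Section KyFan.
Variable R : realType.
Local Open Scope complex_scope.

Lemma char_poly_conj (F : fieldType) m (Q D : 'M[F]_m) : Q \in unitmx ->
  char_poly (invmx Q *m D *m Q) = char_poly D.
Proof.
move=> Qu; pose q := map_mx (@polyC F) Q; pose q' := map_mx (@polyC F) (invmx Q).
have q'q : q' *m q = 1%:M by rewrite -map_mxM mulVmx// map_mx1.
have : char_poly_mx (invmx Q *m D *m Q) = q' *m char_poly_mx D *m q.
  rewrite /char_poly_mx mulmxBr mulmxBl !map_mxM -/q -/q'; congr (_ - _).
  by rewrite mul_mx_scalar -scalemxAl q'q scalemx1.
rewrite /char_poly => ->; rewrite !det_mulmx mulrAC -det_mulmx q'q det1.
by rewrite mul1r.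
Qed.

Lemma char_poly_diag (F : comNzRingType) m (D : 'rV[F]_m) :
  char_poly (diag_mx D) = \prod_i ('X - (D 0 i)%:P).
Proof.
rewrite char_poly_trig ?diag_mx_is_trig//.
by apply: eq_bigr => i _; rewrite mxE eqxx mulr1n.
Qed.

(* r lists the eigenvalues and om i is the squared norm of the projection of the
   i-th eigenvector on the span of V. *)
Lemma eigen_weights m (X : 'M[R]_m) (s : seq R) : X^T = X ->
  char_poly X = \prod_(a <- s) ('X - a%:P) ->
  exists r : 'I_m -> R, perm_eq [seq r i | i <- index_enum 'I_m] s /\
    forall k (V : 'M[R]_(m, k)), V^T *m V = 1%:M ->
      exists om : 'I_m -> R,
        [/\ forall i, 0 <= om i <= 1, \sum_i om i = k%:R
          & \tr (V^T *m X *m V) = \sum_i r i * om i].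
Proof.
move=> Xs cX.
(* The spectral theorem is applied over the complex numbers; comparing characteristic polynomials
   shows that the eigenvalues are the real numbers listed in [s]. *)
pose C : numClosedFieldType := R[i].
pose rc (a : R) : C := a%:C.
have rcD : {morph rc : a b / a + b} by move=> a b; rewrite /rc rmorphD.
pose toC p q (B : 'M[R]_(p, q)) : 'M[C]_(p, q) := map_mx (real_complex R) B.
have toCM p q l (B : 'M[R]_(p, q)) (D : 'M[R]_(q, l)) : toC _ _ (B *m D) = toC _ _ B *m toC _ _ D.
  exact: map_mxM.
have toC1 p : toC p p 1%:M = 1%:M by exact: map_mx1.
pose cj : {rmorphism C -> C} := Num.conj.
have rc_real a : rc a \is Num.real.
  by rewrite realE -[0]/(rc 0) !lecR -realE num_real.
have cj_rc a : cj (rc a) = rc a by apply/CrealP.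
pose adj p q (B : 'M[C]_(p, q)) : 'M[C]_(q, p) := map_mx cj B^T.
have adjM p q l (B : 'M[C]_(p, q)) (D : 'M[C]_(q, l)) : adj _ _ (B *m D) = adj _ _ D *m adj _ _ B.
  by rewrite /adj trmx_mul map_mxM.
have adjK p q (B : 'M[C]_(p, q)) : adj _ _ (adj _ _ B) = B.
  by apply/matrixP => i j; rewrite !mxE; exact: conjCK.
have adj_toC p q (B : 'M[R]_(p, q)) : adj _ _ (toC _ _ B) = toC _ _ B^T.
  by apply/matrixP => i j; rewrite !mxE; exact: cj_rc.
have adjE p q (B : 'M[C]_(p, q)) i j : adj _ _ B i j = cj (B j i) by rewrite !mxE.
pose A := toC _ _ X.
have Anormal : A \is normalmx.
  apply/normalmxP; have -> : map_mx Num.conj A^T = A by rewrite -[LHS]/(adj _ _ A) adj_toC Xs.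
  by [].
pose P := spectralmx A; pose sp := spectral_diag A.
have Pu : P \is unitarymx by exact: spectral_unitarymx.
have PP : P *m adj _ _ P = 1%:M by exact/unitarymxP.
have PP' : adj _ _ P *m P = 1%:M by exact: mulmx1C.
have iP : invmx P = adj _ _ P by exact: invmx_unitary.
have AE : A = adj _ _ P *m diag_mx sp *m P by rewrite -iP; exact/orthomx_spectralP.
have perm_sp : perm_eq [seq sp 0 i | i <- index_enum 'I_m] [seq rc a | a <- s].
  apply: prod_XsubC_eq; rewrite !big_map -char_poly_diag.
  rewrite -(char_poly_conj _ (spectral_unit A)) -/P iP -AE.
  rewrite /A /toC -map_char_poly cX map_prod_XsubC.
  by apply: eq_bigr.
pose r i := complex.Re (sp 0 i).
have rE i : sp 0 i = rc (r i).
  have : sp 0 i \in [seq rc a | a <- s].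
    by rewrite -(perm_mem perm_sp) map_f// mem_index_enum.
  by move=> /mapP[a _ ea]; rewrite /r ea.
exists r; split.
  have rcI : injective rc by exact: complexI.
  apply: (perm_map_inj rcI).
  have -> : [seq rc a | a <- [seq r i | i <- index_enum 'I_m]] =
      [seq sp 0 i | i <- index_enum 'I_m].
    by rewrite -map_comp; apply: eq_map => i; rewrite rE.
  exact: perm_sp.
move=> k V VV; pose G := P *m toC _ _ V.
have GG : adj _ _ G *m G = 1%:M.
  by rewrite adjM adj_toC -mulmxA (mulmxA (adj _ _ P)) PP' mul1mx -toCM VV toC1.
(* [Q] is the orthogonal projection on the span of [V], written in the eigenbasis, and its diagonal
   gives the weights. Idempotence yields Q_ii >= Q_ii^2, hence weights at most 1. *)
pose Q := G *m adj _ _ G.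
have QQ : Q *m Q = Q by rewrite /Q -mulmxA (mulmxA (adj _ _ G)) GG mul1mx.
have Qadj : adj _ _ Q = Q by rewrite /Q adjM adjK.
have QT i j : Q j i = cj (Q i j) by rewrite -{1}Qadj adjE.
have normE (z : C) : z * cj z = `|z| ^+ 2 by rewrite normCK.
have Qii i : Q i i = \sum_c `|G i c| ^+ 2.
  by rewrite mxE; apply: eq_bigr => c _; rewrite adjE normE.
have Qii2 i : Q i i = \sum_j `|Q i j| ^+ 2.
  by rewrite -[in LHS]QQ mxE; apply: eq_bigr => j _; rewrite (QT i j) normE.
pose om i := complex.Re (Q i i).
have Q0 i : 0 <= Q i i by rewrite Qii sumr_ge0// => c _; rewrite exprn_ge0.
have omE i : Q i i = rc (om i) by rewrite /rc /om RRe_real// ger0_real.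
exists om; split.
- move=> i; have om0 : 0 <= om i by have := Q0 i; rewrite omE -[0]/(rc 0) lecR.
  rewrite om0/=.
  have : (rc (om i)) ^+ 2 <= rc (om i).
    rewrite -omE [leRHS]Qii2 (bigD1 i)//= ger0_norm ?Q0// lerDl.
    by apply: sumr_ge0 => j _; exact: exprn_ge0.
  rewrite -[rc (om i) ^+ 2]/(rc (om i) * rc (om i)) -[_ * _]rmorphM lecR => h.
  by nra.
- have : rc (\sum_i om i) = rc k%:R.
    rewrite /rc rmorph_sum (eq_bigr (fun i => Q i i)) => [|i _]; last by rewrite omE.
    by rewrite -[LHS]/(\tr Q) /Q mxtrace_mulC GG mxtrace1 rmorph_nat.
  exact: complexI.
- have : rc (\tr (V^T *m X *m V)) = rc (\sum_i r i * om i).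
    rewrite {1}/rc -trace_map_mx -/(toC _ _ _) !toCM -/A AE -adj_toC.
    have -> : adj _ _ (toC _ _ V) *m (adj _ _ P *m diag_mx sp *m P) *m toC _ _ V =
        adj _ _ G *m (diag_mx sp *m G) by rewrite adjM !mulmxA.
    rewrite mxtrace_mulC -mulmxA -/Q /rc rmorph_sum; apply: eq_bigr => i _.
    by rewrite mul_diag_mx mxE rE omE rmorphM.
  exact: complexI.
Qed.

End KyFan.

(** Linear programming duality. With [mu] the least of the first d entries of [s], r om <= max (r -
    mu) 0 + mu om for every weight om in [0, 1]; in the sum only the first d entries contribute to
    the first part, and the second part is mu d. *)
Lemma ky_fan (R : realType) m d (X : 'M[R]_m) (U V : 'M[R]_(m, d)) : (0 < d)%N ->
  X^T = X -> top_eigenvectors X U -> V^T *m V = 1%:M ->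
  \tr (V^T *m X *m V) <= \tr (U^T *m X *m U).
Proof.
move=> d0 Xs [UU [s [cX smax eig]]] VV.
have [r [rs om_ex]] := eigen_weights Xs cX.
have [om [om01 om_sum ->]] := om_ex _ _ VV.
have dm : (d <= m)%N.
  by have := mxrankM_maxr U^T U; rewrite UU mxrank1 => /leq_trans; apply; exact: rank_leq_row.
have sm : size s = m.
  by rewrite -(perm_size rs) size_map /index_enum -enumT size_enum_ord.
pose i0 : 'I_d := Ordinal d0.
pose imin := [arg min_(i < i0) (s`_i : R)]%O.
pose mu := s`_imin.
have mu_le (i : 'I_d) : mu <= s`_i by rewrite /mu /imin; case: arg_minP => // i1 _; exact.
have mu_ge j : (d <= j < size s)%N -> s`_j <= mu by exact: smax.
have -> : \tr (U^T *m X *m U) = \sum_(i < d) s`_i.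
  apply: eq_bigr => j _.
  have colE (B : 'M[R]_(d, m)) (D : 'M[R]_(m, d)) : (B *m D) j j = (B *m col j D) j 0.
    by rewrite !mxE; apply: eq_bigr => k _; rewrite mxE.
  by rewrite colE -mulmxA eig -scalemxAr mxE -colE UU mxE eqxx mulr1.
pose pp (a : R) := Num.max (a - mu) 0.
apply: (@le_trans _ _ (\sum_i (pp (r i) + mu * om i))).
  apply: ler_sum => i _; have /andP[w0 w1] := om01 i.
  rewrite /pp; case: (leP (r i - mu) 0) => h; nra.
rewrite big_split/= -mulr_sumr om_sum.
have -> : \sum_i pp (r i) = \sum_(a <- s) pp a.
  by rewrite -(perm_big _ rs) big_map.
rewrite (big_nth 0) sm (big_cat_nat (n := d))//=.
have -> : \sum_(d <= i < m) pp s`_i = 0.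
  rewrite big_nat_cond big1// => j /andP[jd _]; apply/max_idPr.
  by rewrite subr_le0 mu_ge// sm.
rewrite addr0 big_mkord (eq_bigr (fun i : 'I_d => s`_i - mu)); last first.
  by move=> i _; apply/max_idPl; rewrite subr_ge0.
by rewrite sumrB sumr_const card_ord -[mu *+ d]mulr_natr subrK.
Qed.

(** * Deterministic perturbation of a low-rank signal *)

Section Perturbation.
Variables (R : realType) (m d : nat) (E : 'M[R]_m) (Us U : 'M[R]_(m, d)).
Variables (p D kap b : R).
Hypotheses (EE : E^T = E) (UsUs : Us^T *m Us = 1%:M) (UU : U^T *m U = 1%:M).
Hypotheses (D0 : 0 < D) (kapD : kap <= D / 8).
Hypothesis Ekap : forall y : 'cV[R]_m, `|\tr (y^T *m E *m y)| <= kap * sqn y.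
Hypothesis EUs : sqn (E *m Us) <= b.

Let X := D *: (Us *m Us^T) - p%:M + E.
Hypothesis trX : \tr (Us^T *m X *m Us) <= \tr (U^T *m X *m U).

Let quad_le q (V : 'M[R]_(m, q)) : `|\tr (V^T *m E *m V)| <= kap * sqn V.
Proof.
rewrite sqn_cols mulr_sumr /mxtrace; apply: le_trans (ler_norm_sum _ _ _) _.
apply: ler_sum => j _; apply: le_trans (Ekap (col j V)).
rewrite le_eqVlt; apply/orP; left; apply/eqP; congr `|_|.
rewrite /mxtrace big_ord1 !mxE; apply: eq_bigr => k _; rewrite !mxE; congr (_ * _).
by apply: eq_bigr => l _; rewrite !mxE.
Qed.

(** [B V V^T] projects the rows of [B] on the span of [V] and has the same norm as [B V]. *)
Lemma sqn_mul_isometry q (B : 'M[R]_(q, m)) (V : 'M[R]_(m, d)) :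
  V^T *m V = 1%:M -> sqn (B *m V) <= sqn B.
Proof.
move=> VV; have h := sqn_ge0 (B - B *m V *m V^T).
rewrite -scaleN1r sqnD sqnZ sqrrN expr1n mul1r -scalemxAr mxtraceZ in h.
have e1 : sqn (B *m V *m V^T) = sqn (B *m V).
  set W := B *m V; rewrite sqnE trmx_mul trmxK -mulmxA mxtrace_mulC.
  by rewrite -!mulmxA VV mulmx1 -sqnE.
have e2 : \tr (B^T *m (B *m V *m V^T)) = sqn (B *m V).
  by rewrite mulmxA mxtrace_mulC sqnE trmx_mul -!mulmxA.
by move: h; rewrite e1 e2; lra.
Qed.

Let trB k (A B : 'M[R]_k) : \tr (A - B) = \tr A - \tr B.
Proof. exact: raddfB. Qed.

Let quad_add q (A B : 'M[R]_(m, q)) : \tr ((A + B)^T *m E *m (A + B)) =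
  \tr (A^T *m E *m A) + 2 * \tr (A^T *m E *m B) + \tr (B^T *m E *m B).
Proof.
have -> : (A + B)^T = A^T + B^T by rewrite linearD.
rewrite !mulmxDl !mulmxDr !mxtraceD.
have -> : \tr (B^T *m E *m A) = \tr (A^T *m E *m B).
  by rewrite -mxtrace_tr !trmx_mul !trmxK EE !mulmxA.
ring.
Qed.

(* Comparing the traces of X on the two subspaces bounds D |V|^2 by the
   difference of the quadratic forms of E, in which the part linear in
   V' = Us - U H only involves E Us, and |V'| = |V|. *)
Lemma subspace_perturbation : sqn (U - Us *m (U^T *m Us)^T) <= 16 * b / D ^+ 2.
Proof.
pose H := U^T *m Us; pose V := U - Us *m H^T; pose V' := Us - U *m H.
have HE : H^T = Us^T *m U by rewrite /H trmx_mul trmxK.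
have sV : sqn V = d%:R - sqn H.
  rewrite /V -scaleN1r sqnD sqnZ sqrrN expr1n mul1r -scalemxAr mxtraceZ.
  have -> : sqn U = d%:R by rewrite sqnE UU mxtrace1.
  have -> : \tr (U^T *m (Us *m H^T)) = sqn H by rewrite mulmxA -/H -sqn_tr sqnE trmxK.
  have -> : sqn (Us *m H^T) = sqn H.
    by rewrite sqnE trmx_mul trmxK -mulmxA (mulmxA Us^T) UsUs mul1mx -sqn_tr sqnE trmxK.
  by ring.
have V'V' : V'^T *m V' = 1%:M - H^T *m H.
  have -> : V'^T = Us^T - H^T *m U^T by rewrite /V' linearB/= trmx_mul.
  rewrite /V' mulmxBl !mulmxBr UsUs.
  rewrite mulmxA -HE -!mulmxA -/H (mulmxA U^T U) UU mul1mx.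
  by rewrite subrr subr0.
have sV' : sqn V' = sqn V.
  by rewrite sqnE V'V' trB mxtrace1 -sqnE sV.
have key : D * sqn V <= \tr (U^T *m E *m U) - \tr (Us^T *m E *m Us).
  have expand (B : 'M[R]_(m, d)) : B^T *m B = 1%:M -> \tr (B^T *m X *m B) =
      D * \tr (B^T *m (Us *m Us^T) *m B) - p * d%:R + \tr (B^T *m E *m B).
    move=> BB; rewrite /X mulmxDr mulmxBr mulmxDl mulmxBl -scalemxAr -scalemxAl.
    by rewrite mul_mx_scalar -scalemxAl BB mxtraceD trB !mxtraceZ mxtrace1.
  move: trX; rewrite !expand//.
  have -> : \tr (Us^T *m (Us *m Us^T) *m Us) = d%:R.
    by rewrite -!mulmxA UsUs mulmx1 UsUs mxtrace1.
  have -> : \tr (U^T *m (Us *m Us^T) *m U) = sqn H.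
    by rewrite mulmxA -/H -mulmxA -HE -sqn_tr sqnE trmxK.
  by rewrite sV; lra.
have UE : U = V + Us *m H^T by rewrite /V subrK.
pose Y := E *m Us *m H^T.
have trU : \tr (U^T *m E *m U) =
    \tr (V^T *m E *m V) + 2 * \tr (V^T *m Y) + \tr (H *m (Us^T *m E *m Us) *m H^T).
  have -> : \tr (U^T *m E *m U) = \tr ((V + Us *m H^T)^T *m E *m (V + Us *m H^T)).
    by rewrite -UE.
  rewrite quad_add /Y; have -> : (Us *m H^T)^T = H *m Us^T by rewrite trmx_mul trmxK.
  by rewrite !mulmxA.
pose Q := Us *m V'^T.
(* The difference is - tr ((1 - H^T H) B) with B = Us^T E Us, and 1 - H^T H is the Gram matrix of
   V'; it is therefore quadratic in the error. *)
have trHUs : \tr (H *m (Us^T *m E *m Us) *m H^T) - \tr (Us^T *m E *m Us) =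
    - \tr (Q^T *m E *m Q).
  set B := Us^T *m E *m Us.
  have -> : \tr (Q^T *m E *m Q) = \tr (V'^T *m V' *m B).
    have -> : Q^T = V' *m Us^T by rewrite /Q trmx_mul trmxK.
    rewrite (_ : V' *m Us^T *m E *m Q = V' *m (B *m V'^T)); last by rewrite /B /Q !mulmxA.
    by rewrite [LHS]mxtrace_mulC -[in LHS]mulmxA [LHS]mxtrace_mulC.
  rewrite V'V' mulmxBl mul1mx trB mxtrace_mulC mulmxA; ring.
have sQ : sqn Q = sqn V.
  rewrite /Q sqnE trmx_mul trmxK -mulmxA (mulmxA Us^T) UsUs mul1mx.
  by rewrite mxtrace_mulC -sqnE sV'.
have sY : sqn Y <= b.
  apply: le_trans EUs; rewrite /Y HE mulmxA; apply: le_trans (sqn_mul_isometry _ UU) _.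
  rewrite -sqn_tr trmx_mul trmxK sqnE trmx_mul trmxK -mulmxA (mulmxA Us^T) UsUs mul1mx.
  by rewrite mxtrace_mulC -sqnE.
have h1 := quad_le V; have h2 := quad_le Q; rewrite sQ in h2.
have h3 := tr_cauchy V Y.
move: h1 h2; rewrite !ler_norml => /andP[_ h1] /andP[h2 _].
set a := \tr (V^T *m Y) in trU h3; set v := sqn V in key h1 h2 h3 *.
have v0 : 0 <= v by exact: sqn_ge0.
have kv : kap * v <= D / 8 * v by rewrite ler_wpM2r.
(* The two quadratic forms absorb D v / 4, half of the rest bounds the cross term, and
   Cauchy-Schwarz gives 9 D^2 v / 64 <= b, rounded up to the constant 16. *)
have h4 : D * v * (3 / 8) <= a by lra.
have h5 : (D * v * (3 / 8)) ^+ 2 <= v * b.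
  apply: (@le_trans _ _ (a ^+ 2)).
    by rewrite ler_pXn2r// ?nnegrE ?mulr_ge0 ?(ltW D0)// (le_trans _ h4)// !mulr_ge0// ltW.
  by apply: le_trans h3 _; rewrite ler_wpM2l.
have b0 : 0 <= b by apply: le_trans EUs; exact: sqn_ge0.
rewrite -[X in X <= _]/v.
have [v00|vn0] := eqVneq v 0; first by rewrite v00 !mulr_ge0// invr_ge0 sqr_ge0.
have vp : 0 < v by rewrite lt_def vn0.
rewrite ler_pdivlMr ?exprn_gt0//.
have h6 : v * (D ^+ 2 * v * (9 / 64)) <= v * b.
  by apply: le_trans h5; rewrite le_eqVlt; apply/orP; left; apply/eqP; field.
by move: h6; rewrite ler_pM2l// => h6; lra.
Qed.

End Perturbation.

(* The stacked index g j a is row a of block j after relabelling block j by the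
   true permutation; in these coordinates the signal blocks are identity
   matrices and the (a, c) slice of the noise E is an n x n matrix. *)
Section Gauge.
Variables (R : realType) (n d m : nat) (g : 'I_n -> 'I_d -> 'I_m).
Hypothesis g_sum : forall f : 'I_m -> R, \sum_i f i = \sum_j \sum_a f (g j a).
Variables (Us : 'M[R]_(m, d)) (E : 'M[R]_m) (NA : 'M[R]_n) (N : 'I_d -> 'I_d -> 'M[R]_n).
Variables (sig tau : R).
Hypothesis n0 : (0 < n)%N.
Hypothesis UsE : forall j a c, Us (g j a) c = (a == c)%:R / Num.sqrt n%:R.
Let F a c : 'M[R]_n := (a == c)%:R *: NA + sig *: N a c.
Hypothesis EF : forall j a k c, E (g j a) (g k c) = F a c j k + F c a k j.
Hypotheses (sig0 : 0 <= sig) (tau0 : 0 <= tau).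
Hypotheses (NAtau : op_sq_bound NA tau) (Ntau : forall a c, op_sq_bound (N a c) tau).

Lemma bilinear_sum p q (A : 'M[R]_(p, q)) (x : 'cV[R]_p) (y : 'cV[R]_q) :
  \tr (x^T *m A *m y) = \sum_j \sum_k x j 0 * A j k * y k 0.
Proof.
rewrite -mulmxA tr_mulmxE; apply: eq_bigr => j _; rewrite big_ord1 mxE mulr_sumr.
by apply: eq_bigr => k _; rewrite mulrA.
Qed.

Lemma op_sq_bound_bilinear p q (A : 'M[R]_(p, q)) (x : 'cV[R]_p) (y : 'cV[R]_q) :
  op_sq_bound A tau -> `|\tr (x^T *m A *m y)| <= Num.sqrt tau * ((sqn x + sqn y) / 2).
Proof.
move=> At; have sx := sqn_ge0 x; have sy := sqn_ge0 y.
have s0 : 0 <= Num.sqrt tau * ((sqn x + sqn y) / 2).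
  by rewrite mulr_ge0 ?sqrtr_ge0// divr_ge0// addr_ge0.
rewrite -(@ler_pXn2r _ 2)// ?nnegrE// real_normK ?num_real// (le_trans (At x y))//.
rewrite exprMn sqr_sqrtr// -mulrA ler_wpM2l//.
by have := sqr_ge0 (sqn x - sqn y); nra.
Qed.

Let slice (y : 'cV[R]_m) a : 'cV[R]_n := \col_j y (g j a) 0.

Let sqn_slice y : sqn y = \sum_a sqn (slice y a).
Proof.
rewrite /sqn g_sum exchange_big; apply: eq_bigr => a _; apply: eq_bigr => j _.
by rewrite !big_ord1 mxE.
Qed.

(** The factor 2 accounts for the transposed half of E. The triangle inequality and the
    arithmetic-geometric mean over the d^2 Gaussian slices cost a factor d, which is affordable
    since [sigma d] already enters the assumption on D. *)
Lemma gauge_quadratic_bound (y : 'cV[R]_m) :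
  `|\tr (y^T *m E *m y)| <= 2 * Num.sqrt tau * (1 + sig * d%:R) * sqn y.
Proof.
pose x := slice y; pose B a c := \tr ((x a)^T *m F a c *m x c).
have yE : \tr (y^T *m E *m y) = 2 * \sum_a \sum_c B a c.
  have BE a c : B a c = \sum_j \sum_k y (g j a) 0 * F a c j k * y (g k c) 0.
    by rewrite /B bilinear_sum; apply: eq_bigr => j _; apply: eq_bigr => k _; rewrite !mxE.
  rewrite bilinear_sum g_sum exchange_big/=.
  have -> : 2 * (\sum_a \sum_c B a c) = \sum_a \sum_c (B a c + B c a).
    rewrite [RHS](eq_bigr (fun a => \sum_c B a c + \sum_c B c a)); last first.
      by move=> a _; rewrite big_split.
    by rewrite big_split/= [X in _ = _ + X]exchange_big/=; ring.
  apply: eq_bigr => a _.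
  rewrite (eq_bigr (fun j => \sum_c \sum_k
     (y (g j a) 0 * F a c j k * y (g k c) 0 + y (g k c) 0 * F c a k j * y (g j a) 0))).
    rewrite exchange_big/=; apply: eq_bigr => c _; rewrite !BE.
    rewrite [X in _ = _ + X]exchange_big/= -big_split/=; apply: eq_bigr => j _.
    by rewrite -big_split.
  move=> j _; rewrite g_sum exchange_big/=; apply: eq_bigr => c _.
  by apply: eq_bigr => k _; rewrite EF; ring.
have Bdec : \sum_a \sum_c B a c =
    \sum_a \tr ((x a)^T *m NA *m x a) + sig * \sum_a \sum_c \tr ((x a)^T *m N a c *m x c).
  have BE a c : B a c = (a == c)%:R * \tr ((x a)^T *m NA *m x c) +
      sig * \tr ((x a)^T *m N a c *m x c).
    by rewrite /B /F mulmxDr mulmxDl -!scalemxAr -!scalemxAl mxtraceD !mxtraceZ.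
  rewrite mulr_sumr -big_split/=; apply: eq_bigr => a _.
  rewrite (eq_bigr _ (fun c _ => BE a c)) big_split/= -mulr_sumr; congr (_ + _).
  rewrite (bigD1 a)//= eqxx mul1r big1 ?addr0// => c /negbTE ca.
  by rewrite eq_sym ca mul0r.
have h1 : `|\sum_a \tr ((x a)^T *m NA *m x a)| <= Num.sqrt tau * sqn y.
  rewrite (sqn_slice y) mulr_sumr; apply: le_trans (ler_norm_sum _ _ _) _.
  apply: ler_sum => a _; apply: le_trans (op_sq_bound_bilinear _ _ NAtau) _.
  by rewrite /x; lra.
have h2 : `|\sum_a \sum_c \tr ((x a)^T *m N a c *m x c)| <= Num.sqrt tau * (d%:R * sqn y).
  have -> : d%:R * sqn y = \sum_(a < d) \sum_(c < d) (sqn (x a) + sqn (x c)) / 2.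
    have -> : \sum_(a < d) \sum_(c < d) (sqn (x a) + sqn (x c)) / 2 =
        \sum_(a < d) (d%:R * sqn (x a) / 2 + sqn y / 2).
      apply: eq_bigr => a _; rewrite -mulr_suml big_split/= sumr_const card_ord.
      by rewrite /x -(sqn_slice y) -[_ *+ d]mulr_natl mulrDl.
    rewrite big_split/= sumr_const card_ord -mulr_suml -mulr_sumr /x -(sqn_slice y).
    by rewrite -[_ *+ d]mulr_natl; field.
  rewrite mulr_sumr; apply: le_trans (ler_norm_sum _ _ _) _; apply: ler_sum => a _.
  rewrite mulr_sumr; apply: le_trans (ler_norm_sum _ _ _) _; apply: ler_sum => c _.
  exact: op_sq_bound_bilinear.
rewrite yE Bdec normrM [`|2|]ger0_norm// -!mulrA ler_wpM2l//.
apply: le_trans (ler_normD _ _) _; rewrite normrM (ger0_norm sig0).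
have := ler_wpM2l sig0 h2; move: h1; set s := Num.sqrt tau; set v := sqn y.
by lra.
Qed.

(** In relabelled coordinates the columns of Us are constant on their label, so E Us consists of the
    slices applied to the all-ones vector. Squared norms add over (a, c): the adjacency matrix
    counts d times, the Gaussian slices d^2 times, and 8 comes from splitting twice into two
    terms. *)
Lemma gauge_signal_bound : sqn (E *m Us) <= 8 * tau * (d%:R + sig ^+ 2 * d%:R ^+ 2).
Proof.
pose one : 'cV[R]_n := const_mx 1.
have nR : 0 < n%:R :> R by rewrite ltr0n.
have sone : sqn one = n%:R.
  rewrite /sqn (eq_bigr (fun=> 1)) => [|i _]; last by rewrite big_ord1 mxE expr1n.
  by rewrite sumr_const card_ord.
have Fone a c : sqn (F a c *m one + (F c a)^T *m one) <= 8 * tau * n%:R * ((a == c)%:R + sig ^+ 2).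
  have Fb (A B : 'M[R]_n) : op_sq_bound A tau -> op_sq_bound B tau ->
      sqn (((a == c)%:R *: A + sig *: B) *m one) <= 2 * tau * n%:R * ((a == c)%:R + sig ^+ 2).
    move=> Ab Bb; rewrite mulmxDl -!scalemxAl; apply: le_trans (sqnD_le _ _) _.
    have hA := op_sq_bound_mul one tau0 Ab; have hB := op_sq_bound_mul one tau0 Bb.
    rewrite !sqnZ sone in hA hB *.
    have -> : (a == c)%:R ^+ 2 = (a == c)%:R :> R by case: eqP; rewrite ?expr1n ?expr0n.
    have e0 : 0 <= (a == c)%:R :> R by [].
    by have := ler_wpM2l e0 hA; have := ler_wpM2l (sqr_ge0 sig) hB; lra.
  have FT : (F c a)^T = (a == c)%:R *: NA^T + sig *: (N c a)^T.
    by apply/matrixP => i j; rewrite !mxE eq_sym.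
  apply: le_trans (sqnD_le _ _) _.
  have h1 := Fb _ _ NAtau (Ntau a c); rewrite -/(F a c) in h1.
  have h2 := Fb _ _ (op_sq_bound_tr NAtau) (op_sq_bound_tr (Ntau c a)); rewrite -FT in h2.
  by lra.
have entry j a c : (E *m Us) (g j a) c =
    (F a c *m one + (F c a)^T *m one) j 0 / Num.sqrt n%:R.
  rewrite mxE g_sum (eq_bigr (fun k => (F a c j k + F c a k j) / Num.sqrt n%:R)); last first.
    move=> k _; rewrite (bigD1 c)//= big1 ?addr0 => [|e /negbTE ec].
      by rewrite EF UsE eqxx mul1r.
    by rewrite UsE ec mul0r mulr0.
  rewrite -mulr_suml; congr (_ / _); rewrite big_split/= mxE; congr (_ + _).
    by rewrite mxE; apply: eq_bigr => k _; rewrite [X in _ * X]mxE mulr1.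
  by rewrite mxE; apply: eq_bigr => k _; rewrite [X in _ * X]mxE mulr1 [RHS]mxE.
have -> : sqn (E *m Us) = n%:R^-1 * \sum_a \sum_c sqn (F a c *m one + (F c a)^T *m one).
  rewrite {1}/sqn g_sum exchange_big mulr_sumr; apply: eq_bigr => a _.
  rewrite exchange_big mulr_sumr; apply: eq_bigr => c _.
  rewrite /sqn mulr_sumr; apply: eq_bigr => j _.
  rewrite big_ord1 entry expr_div_n sqr_sqrtr ?ler0n//; exact: mulrC.
have -> : 8 * tau * (d%:R + sig ^+ 2 * d%:R ^+ 2) =
    n%:R^-1 * \sum_(a < d) \sum_(c < d) 8 * tau * n%:R * ((a == c)%:R + sig ^+ 2).
  under eq_bigr do rewrite -mulr_sumr.
  rewrite -mulr_sumr (eq_bigr (fun=> 1 + d%:R * sig ^+ 2)); last first.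
    move=> a _; rewrite big_split/= sumr_const card_ord mulr_natl; congr (_ + _).
    by rewrite (bigD1 a)//= eqxx big1 ?addr0// => c /negbTE ca; rewrite eq_sym ca.
  by rewrite sumr_const card_ord -mulr_natl; field; rewrite gt_eqF.
rewrite ler_wpM2l ?invr_ge0 ?ler0n//; apply: ler_sum => a _; apply: ler_sum => c _.
exact: Fone.
Qed.

End Gauge.

(** * Recovery of the anchor *)

Section Matching.
Variables (R : realType) (n d m : nat) (g : 'I_n -> 'I_d -> 'I_m).
Hypothesis g_sum : forall f : 'I_m -> R, \sum_i f i = \sum_j \sum_a f (g j a).
Variable lab : 'I_m -> 'I_d.
Hypothesis labK : forall j a, lab (g j a) = a.
Variables (Us U : 'M[R]_(m, d)) (mu : 'I_d -> 'rV[R]_d) (M : 'M[R]_d) (B : R).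
Hypotheses (n0 : (0 < n)%N) (B0 : 0 < B) (B7 : 7 * B < 1).
Hypothesis UsE : forall j a c, Us (g j a) c = (a == c)%:R / Num.sqrt n%:R.
Hypotheses (UsUs : Us^T *m Us = 1%:M) (UU : U^T *m U = 1%:M).
Hypothesis UB : sqn (U - Us *m (U^T *m Us)^T) <= B.
Hypotheses (mu_opt : kmeans_centers U mu) (ME : forall k, row k M = Num.sqrt n%:R *: mu k).

Let H := U^T *m Us.
Let h k : 'rV[R]_d := row k H^T.

Lemma frobenius_sqn p q (A : 'M[R]_(p, q)) : frobenius_norm A ^+ 2 = sqn A.
Proof. by rewrite sqr_sqrtr// sqn_ge0. Qed.

Let nR : 0 < n%:R :> R. Proof. by rewrite ltr0n. Qed.
Let s2 : Num.sqrt n%:R ^+ 2 = n%:R :> R. Proof. by rewrite sqr_sqrtr. Qed.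
Let s0 : Num.sqrt n%:R != 0 :> R. Proof. by rewrite gt_eqF// sqrtr_gt0. Qed.

Let row_truth j a : row (g j a) (Us *m H^T) = (Num.sqrt n%:R)^-1 *: h a.
Proof.
apply/rowP => c; rewrite !mxE (bigD1 a)//= big1 ?addr0 => [|e ea].
  by rewrite UsE eqxx mul1r !mxE.
by rewrite UsE eq_sym (negbTE ea) !mul0r.
Qed.

Lemma sqnN p q (A : 'M[R]_(p, q)) : sqn (- A) = sqn A.
Proof. by rewrite -scaleN1r sqnZ sqrrN expr1n mul1r. Qed.

(** The true labels with centers h_a / sqrt n cost at most B, and [mu] is optimal. Since the loss is
    an infimum, the strict slack from B to 2B provides an actual labeling for [mu]. *)
Let good_labeling : exists z : 'I_m -> 'I_d, kmeans_cost U mu z < 2 * B.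
Proof.
have lb (nu : 'I_d -> 'rV[R]_d) :
    has_lbound [set kmeans_cost U nu z | z in [set: 'I_m -> 'I_d]].
  by exists 0 => _ [z _ <-]; apply: sumr_ge0 => i _; rewrite sqr_ge0.
have hinf : [set kmeans_cost U mu z | z in [set: 'I_m -> 'I_d]] !=set0.
  by exists (kmeans_cost U mu lab), lab.
have : kmeans_loss U mu < 2 * B.
  pose nu a := (Num.sqrt (n%:R : R))^-1 *: h a.
  apply: le_lt_trans (mu_opt nu) _; apply: (@le_lt_trans _ _ B); last by move: B0; lra.
  apply: le_trans UB; apply: (@le_trans _ _ (kmeans_cost U nu lab)).
    by apply: ge_inf => //; exists lab.
  rewrite le_eqVlt; apply/orP; left; apply/eqP.
  rewrite sqn_rows /kmeans_cost !g_sum; apply: eq_bigr => j _; apply: eq_bigr => a _.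
  by rewrite frobenius_sqn labK linearB/= row_truth.
by move=> /(inf_lt hinf)[_ [z _ <-] zB]; exists z.
Qed.

(** h_k - h_l is U^T w for a vector w = Us e of squared norm 2. The part of w outside the span of U
    is V' e, whose squared norm is at most 2B. *)
Let separation k l : k != l -> 2 - 2 * B <= sqn (h k - h l).
Proof.
move=> kl; pose e : 'cV[R]_d := delta_mx k 0 - delta_mx l 0.
have se : sqn e = 2.
  have lk : (l == k) = false by rewrite eq_sym; exact: negbTE.
  have ek : e k 0 = 1 by rewrite !mxE !eqxx (negbTE kl) subr0.
  have el : e l 0 = -1 by rewrite !mxE !eqxx lk sub0r.
  rewrite /sqn (bigD1 k)//= (bigD1 l)//= ?lk// !big_ord1 ek el sqrrN expr1n.
  rewrite big1 ?addr0// => i /andP[ik il].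
  by rewrite big_ord1 !mxE (negbTE ik) (negbTE il) subr0 expr0n.
pose w := Us *m e.
have sw : sqn w = 2 by rewrite /w sqnE trmx_mul -mulmxA (mulmxA Us^T) UsUs mul1mx -sqnE.
have he : h k - h l = (U^T *m w)^T.
  rewrite /w mulmxA -/H trmx_mul /e.
  have -> : (delta_mx k 0 - delta_mx l 0 : 'cV[R]_d)^T = delta_mx 0 k - delta_mx 0 l.
    by rewrite linearB/= !trmx_delta.
  by rewrite mulmxBl -!rowE.
pose V := U - Us *m H^T; pose V' := Us - U *m H.
have sV' : sqn V' <= B.
  apply: le_trans UB; rewrite -/H -/V le_eqVlt; apply/orP; left; apply/eqP.
  have pyth (A C : 'M[R]_(m, d)) : A^T *m A = 1%:M -> C^T *m C = 1%:M ->
      sqn (A - C *m (A^T *m C)^T) = d%:R - sqn (A^T *m C).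
    move=> AA CC; rewrite -scaleN1r sqnD sqnZ sqrrN expr1n mul1r -scalemxAr mxtraceZ.
    have -> : sqn A = d%:R by rewrite sqnE AA mxtrace1.
    have -> : \tr (A^T *m (C *m (A^T *m C)^T)) = sqn (A^T *m C).
      by rewrite mulmxA -[RHS]sqn_tr [RHS]sqnE trmxK.
    have -> : sqn (C *m (A^T *m C)^T) = sqn (A^T *m C).
      set D := A^T *m C; rewrite sqnE trmx_mul trmxK -mulmxA (mulmxA C^T) CC mul1mx.
      by rewrite -[RHS]sqn_tr sqnE trmxK.
    by ring.
  rewrite /V pyth// /V'; have := pyth _ _ UsUs UU.
  have HT : Us^T *m U = H^T by rewrite /H trmx_mul trmxK.
  by rewrite HT trmxK sqn_tr.
have res : w - U *m (U^T *m w) = V' *m e by rewrite /w /V' mulmxBl mulmxA -/H !mulmxA.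
have sres : sqn (w - U *m (U^T *m w)) = sqn w - sqn (U^T *m w).
  rewrite -scaleN1r sqnD sqnZ sqrrN expr1n mul1r -scalemxAr mxtraceZ.
  have -> : \tr (w^T *m (U *m (U^T *m w))) = sqn (U^T *m w).
    by rewrite mulmxA [RHS]sqnE [(U^T *m w)^T]trmx_mul trmxK.
  have -> : sqn (U *m (U^T *m w)) = sqn (U^T *m w).
    set D := U^T *m w; by rewrite sqnE trmx_mul -mulmxA (mulmxA U^T) UU mul1mx -sqnE.
  by ring.
rewrite he sqn_tr.
have : sqn (V' *m e) <= B * 2.
  by apply: le_trans (sqn_mulmx _ _) _; rewrite se ler_wpM2r.
by rewrite -res sres sw; lra.
Qed.

(* In each true cluster some point is at most as far from its center as the
   average; the centers obtained in this way are distinct because the rows of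
   H^T are almost orthonormal. *)
Lemma anchor_matching :
  exists2 Q : 'M[R]_d, is_perm_mx Q & sqn (M - Q *m H^T) <= 6 * B.
Proof.
have [z zB] := good_labeling.
pose f j k := sqn ((Num.sqrt n%:R)^-1 *: h k - mu (z (g j k))).
(* 2B comes from the eigenspace error and 2 * 2B from the cost of the labeling. *)
have fsum : \sum_j \sum_k f j k <= 6 * B.
  apply: (@le_trans _ _ (\sum_j \sum_k (2 * sqn (row (g j k) (U - Us *m H^T)) +
      2 * sqn (row (g j k) U - mu (z (g j k)))))).
    apply: ler_sum => j _; apply: ler_sum => k _.
    have -> : f j k = sqn (- row (g j k) (U - Us *m H^T) + (row (g j k) U - mu (z (g j k)))).
      by congr sqn; rewrite linearB/= row_truth opprB addrA subrK.
    apply: le_trans (sqnD_le _ _) _.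
    by rewrite sqnN.
  under eq_bigr do rewrite big_split/=.
  rewrite big_split/= -(g_sum (fun i => 2 * sqn (row i (U - Us *m H^T)))).
  rewrite -(g_sum (fun i => 2 * sqn (row i U - mu (z i)))) -!mulr_sumr -sqn_rows.
  have -> : \sum_i sqn (row i U - mu (z i)) = kmeans_cost U mu z.
    by apply: eq_bigr => i _; rewrite frobenius_sqn.
  by have := UB; rewrite -/H; move: zB; lra.
pose j0 : 'I_n := Ordinal n0.
pose jm k := [arg min_(j < j0) f j k]%O.
have jmP k j : f (jm k) k <= f j k by rewrite /jm; case: arg_minP => // i _; exact.
pose zeta k := z (g (jm k) k).
have dist k : sqn (row (zeta k) M - h k) = n%:R * f (jm k) k.
  rewrite ME /f -[X in X * _]s2 -sqnZ scalerBr scalerA divff// scale1r -/(zeta k).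
  by rewrite -[LHS]sqnN opprB.
have dsum : \sum_k sqn (row (zeta k) M - h k) <= 6 * B.
  apply: le_trans fsum; rewrite [leRHS]exchange_big/=; apply: ler_sum => k _.
  have -> : sqn (row (zeta k) M - h k) = \sum_(j < n) f (jm k) k.
    by rewrite dist sumr_const card_ord mulr_natl.
  apply: ler_sum => j _.
  exact: jmP.
(* A center shared by k and l would give 2 - 2B <= 2 * 6B, which 7B < 1 excludes. *)
have zinj : injective zeta.
  move=> k l e; apply/eqP; apply: contraT => kl.
  have := separation kl; have := dsum.
  rewrite (bigD1 k)//= (bigD1 l) 1?eq_sym//= -e.
  have : 0 <= \sum_(i < d | (i != k) && (i != l)) sqn (row (zeta i) M - h i).
    by apply: sumr_ge0 => i _; exact: sqn_ge0.
  have := sqnD_le (h k - row (zeta k) M) (row (zeta k) M - h l).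
  rewrite addrA subrK -[sqn (h k - row (zeta k) M)]sqnN opprB.
  by move: B7; lra.
(* Row [zeta k] of [M] is close to row k of H^T, so the matrix must send k to [zeta k]: this is the
   permutation matrix of the inverse. *)
pose s := perm zinj.
exists (perm_mx s^-1); first exact: perm_mx_is_perm.
rewrite sqn_rows (reindex_inj zinj)/=; apply: le_trans dsum; apply: ler_sum => k _.
rewrite linearB/= -row_permE.
have -> // : row (zeta k) (row_perm s^-1 H^T) = h k.
by apply/rowP => c; rewrite !mxE -[zeta k](permE zinj) permK.
Qed.

End Matching.

(** * Indices of stacked and block matrices *)

Section BlockIndices.
Variables (n d : nat) (s : 'I_n -> 'S_d).

(* The index, in the stacked matrices, of the row of block j that the
   permutation s j sends to a. *)
Definition block_index (j : 'I_n) (a : 'I_d) : 'I_(\sum_(j < n) d) :=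
  tagnat.Rank (p_ := fun=> d) j ((s j)^-1%g a).

Lemma block_indexP i : exists j a, i = block_index j a.
Proof.
exists (tagnat.sig1 i), (s (tagnat.sig1 i) (tagnat.sig2 i)).
by rewrite /block_index permK tagnat.sig2K.
Qed.

Lemma block_index_eq j a k c :
  (block_index j a == block_index k c) = (j == k) && (a == c).
Proof.
rewrite -val_eqE/= /block_index tagnat.eq_Rank.
by case: eqP => //= ->; rewrite val_eqE (inj_eq perm_inj).
Qed.

Definition block_label i : 'I_d := s (tagnat.sig1 i) (tagnat.sig2 i).

Lemma block_labelK j a : block_label (block_index j a) = a.
Proof.
rewrite /block_label /block_index; set b := (s j)^-1%g a.
have -> : tagnat.sig2 (tagnat.Rank (p_ := fun=> d) j b) = b :> 'I_d.
  by apply/val_inj; rewrite /= tagnat.Rank2K.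
by rewrite tagnat.Rank1K /b permKV.
Qed.

Lemma block_index_sum (R : nmodType) (f : 'I_(\sum_(j < n) d) -> R) :
  \sum_i f i = \sum_j \sum_a f (block_index j a).
Proof.
rewrite pair_bigA/= (reindex (fun ja : 'I_n * 'I_d => block_index ja.1 ja.2))//.
exists (fun i => (tagnat.sig1 i, block_label i)) => [[j a]|i] _ /=.
  by rewrite block_labelK tagnat.Rank1K.
by rewrite /block_index /block_label permK tagnat.sig2K.
Qed.

Lemma mxcol_block_index (R : Type) (B : 'I_n -> 'M[R]_d) j a c :
  (\mxcol_(j < n) B j) (block_index j a) c = B j ((s j)^-1%g a) c.
Proof.
rewrite -[in RHS](mxcolK (p_ := fun=> d) B j) /submxcol.
by rewrite [RHS]mxE.
Qed.

Lemma mxblock_block_index (R : Type) (B : 'I_n -> 'I_n -> 'M[R]_d) j a k c :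
  (\mxblock_(j < n, k < n) B j k) (block_index j a) (block_index k c) =
  B j k ((s j)^-1%g a) ((s k)^-1%g c).
Proof.
rewrite -[in RHS](mxblockK (p_ := fun=> d) (q_ := fun=> d) B j k) /submxblock.
by rewrite [RHS]mxE.
Qed.

End BlockIndices.

(** * Signal, noise and the deterministic conclusion *)

Section Recovery.
Context {R : realType} {dT : measure_display} {T : measurableType dT}.
Variables (P : probability T R) (n d : nat) (p sigma : R).
Variables (A : 'I_n -> 'I_n -> {RV P >-> bool}).
Variables (W : 'I_n -> 'I_n -> 'I_d -> 'I_d -> {RV P >-> R}).
Variables (Z : 'I_n -> 'M[R]_d) (s : 'I_n -> 'S_d) (w : T).
Hypotheses (n0 : (0 < n)%N) (d0 : (0 < d)%N) (p0 : 0 < p) (sigma0 : 0 < sigma).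
Hypothesis Zs : forall j, Z j = perm_mx (s j).

Let g := block_index s.
Let Us : 'M[R]_(\sum_(j < n) d, d) := stacked_truth Z.
Let X := perm_sync_data A W sigma Z w.
Let D := n%:R * p.
Let q := Num.sqrt d%:R + sigma * d%:R.

Definition gauged_gaussian_noise (a c : 'I_d) : T -> 'M[R]_n :=
  gaussian_noise A W (fun j k => ((s j)^-1%g a, (s k)^-1%g c)).

Let NA := adjacency_noise p A w.
Let N a c := gauged_gaussian_noise a c w.
Let F a c : 'M[R]_n := (a == c)%:R *: NA + sigma *: N a c.
(** Every diagonal block of D Us Us^T is p I, whereas those of [X] vanish; adding p I makes the
    diagonal blocks of [E] vanish as well. *)
Let E := X - D *: (Us *m Us^T) + p%:M.

Let ZE j a c : Z j ((s j)^-1%g a) c = (a == c)%:R.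
Proof. by rewrite Zs !mxE permKV. Qed.

Let UsE j a c : Us (g j a) c = (a == c)%:R / Num.sqrt n%:R.
Proof.
rewrite /Us /stacked_truth /g mxcol_block_index mxE ZE.
exact: mulrC.
Qed.

Let ZZE j k a c : (Z j *m (Z k)^T) ((s j)^-1%g a) ((s k)^-1%g c) = (a == c)%:R.
Proof.
rewrite mxE (bigD1 c)//= big1 ?addr0 => [|e ec].
  by rewrite ZE mxE ZE eqxx mulr1.
by rewrite [X in _ * X]mxE !ZE [c == e]eq_sym (negbTE ec) mulr0.
Qed.

Let nR : 0 < n%:R :> R. Proof. by rewrite ltr0n. Qed.
Let s2 : Num.sqrt n%:R ^+ 2 = n%:R :> R. Proof. by rewrite sqr_sqrtr ?ltW. Qed.

Let UsUs : Us^T *m Us = 1%:M.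
Proof.
apply/matrixP => a c; rewrite mxE (block_index_sum s).
rewrite (eq_bigr (fun=> (a == c)%:R / n%:R)) => [|j _].
  rewrite sumr_const card_ord -[_ *+ n]mulr_natr mulfVK ?(gt_eqF nR)//.
  by rewrite [RHS]mxE.
rewrite (bigD1 a)//= [X in _ + X]big1 ?addr0 => [|e ea].
  by rewrite [Us^T _ _]mxE !UsE eqxx mul1r mulrCA -invfM -expr2 s2.
by rewrite [Us^T _ _]mxE !UsE (negbTE ea) !mul0r.
Qed.

Let XE j a k c : X (g j a) (g k c) =
  if (j < k)%N then (A j k w)%:R * ((a == c)%:R + sigma * W j k ((s j)^-1%g a) ((s k)^-1%g c) w)
  else if (k < j)%N then (A k j w)%:R * ((a == c)%:R + sigma * W k j ((s k)^-1%g c) ((s j)^-1%g a) w)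
  else 0.
Proof.
have ub j' k' a' c' : upper_block A W sigma Z j' k' w ((s j')^-1%g a') ((s k')^-1%g c') =
    (A j' k' w)%:R * ((a' == c')%:R + sigma * W j' k' ((s j')^-1%g a') ((s k')^-1%g c') w).
  rewrite /upper_block; case: (A j' k' w); last by rewrite mul0r mxE.
  by rewrite mul1r [LHS]mxE ZZE; congr (_ + _); rewrite !mxE.
rewrite /X /perm_sync_data /g mxblock_block_index.
case: ifP => _; first exact: ub.
case: ifP => _; last by rewrite mxE.
by rewrite mxE ub eq_sym.
Qed.

Let EF j a k c : E (g j a) (g k c) = F a c j k + F c a k j.
Proof.
have -> : E (g j a) (g k c) = X (g j a) (g k c) - p * (a == c)%:R +
    p * ((j == k) && (a == c))%:R.
  have entry l (C G : 'M[R]_l) (x y : R) i i' :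
      (C - x *: G + y%:M) i i' = C i i' - x * G i i' + y * (i == i')%:R.
    by rewrite !mxE mulr_natr.
  rewrite /E entry block_index_eq; congr (_ - _ + _).
  have UU j' a' k' c' : (Us *m Us^T) (g j' a') (g k' c') = (a' == c')%:R / n%:R.
    rewrite mxE (bigD1 c')//= [X in _ + X]big1 ?addr0 => [|e ec].
      by rewrite [Us^T _ _]mxE !UsE eqxx mul1r -mulrA -invfM -expr2 s2.
    by rewrite [Us^T _ _]mxE !UsE [c' == e]eq_sym (negbTE ec) mul0r mulr0.
  by rewrite UU /D; field; rewrite gt_eqF.
have FE a' c' j' k' : F a' c' j' k' = if (j' < k')%N then
    (a' == c')%:R * ((A j' k' w)%:R - p) +
    sigma * ((A j' k' w)%:R * W j' k' ((s j')^-1%g a') ((s k')^-1%g c') w) else 0.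
  rewrite mxE [X in X + _]mxE [X in _ + X]mxE [NA _ _]mxE [N _ _ _ _]mxE.
  by case: ifP => //= _; rewrite !mulr0 addr0.
rewrite XE !FE [c == a]eq_sym; case: ltngtP => jk.
- by rewrite -[j == k]val_eqE/= (ltn_eqF jk)/=; ring.
- by rewrite -[j == k]val_eqE/= (gtn_eqF jk)/=; ring.
- by rewrite -[j == k]val_eqE/= jk eqxx/=; ring.
Qed.

Let XT : X^T = X.
Proof.
apply/matrixP => i i'; have [j [a ->]] := block_indexP s i.
have [k [c ->]] := block_indexP s i'; rewrite mxE -/g !XE [c == a]eq_sym.
by case: ltngtP.
Qed.

Let ET : E^T = E.
Proof.
apply/matrixP => i i'; have [j [a ->]] := block_indexP s i.
by have [k [c ->]] := block_indexP s i'; rewrite mxE -/g !EF addrC.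
Qed.

Variable K : R.
Hypotheses (K0 : 0 < K) (Dq : (1024 * K + 1) * q ^+ 2 < D).
Hypothesis NAbound : op_sq_bound NA (K * D).
Hypothesis Nbound : forall a c, op_sq_bound (N a c) (K * D).

Let D0 : 0 < D. Proof. by rewrite mulr_gt0. Qed.
Let tau0 : 0 <= K * D. Proof. by rewrite mulr_ge0 ?ltW. Qed.

Lemma signal_eigenspace_error (U : 'M[R]_(\sum_(j < n) d, d)) :
  top_eigenvectors X U ->
  sqn (U - Us *m (U^T *m Us)^T) <= 128 * K * q ^+ 2 / D.
Proof.
move=> topU; have [UU _] := topU.
have dR : 1 <= d%:R :> R by rewrite ler1n.
have sd2 : Num.sqrt d%:R ^+ 2 = d%:R :> R by rewrite sqr_sqrtr.
have sd1 : 1 <= Num.sqrt d%:R :> R by have := sqrtr_ge0 (d%:R : R); nra.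
have sd0 : 0 <= sigma * d%:R by rewrite mulr_ge0// ltW.
have q1 : 1 + sigma * d%:R <= q by rewrite /q lerD2r.
have tauE : Num.sqrt (K * D) ^+ 2 = K * D by rewrite sqr_sqrtr.
have kapD : 2 * Num.sqrt (K * D) * (1 + sigma * d%:R) <= D / 8.
  rewrite -(@ler_pXn2r _ 2)// ?nnegrE ?mulr_ge0 ?sqrtr_ge0 ?addr_ge0 ?invr_ge0 ?(ltW p0)//.
  have e8 : (D / 8) ^+ 2 = D * D / 64 by field.
  rewrite e8 !exprMn tauE.
  have h : (1 + sigma * d%:R) ^+ 2 <= q ^+ 2 by rewrite ler_pXn2r// nnegrE; lra.
  have KDp := mulr_gt0 K0 D0.
  have h1 := ler_wpM2l (ltW KDp) h.
  have h2 := ler_wpM2l (ltW D0) (ltW Dq).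
  have h3 : 0 <= D * q ^+ 2 by rewrite mulr_ge0 ?sqr_ge0 ?ltW.
  have h4 := mulr_ge0 (ltW K0) h3.
  by move: h1 h2; lra.
have b_le : 8 * (K * D) * (d%:R + sigma ^+ 2 * d%:R ^+ 2) <= 8 * (K * D) * q ^+ 2.
  have cross : 0 <= Num.sqrt d%:R * (sigma * d%:R) by rewrite mulr_ge0// sqrtr_ge0.
  have qE : q ^+ 2 = d%:R + 2 * (Num.sqrt d%:R * (sigma * d%:R)) + sigma ^+ 2 * d%:R ^+ 2.
    by rewrite /q; set r := Num.sqrt _ in sd2 *; rewrite -sd2; ring.
  have KD8 : 0 <= 8 * (K * D) by rewrite mulr_ge0.
  by rewrite ler_wpM2l// qE; lra.
have EUs := gauge_signal_bound (@block_index_sum _ _ s R) n0 UsE EF tau0 NAbound Nbound.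
have Ekap := gauge_quadratic_bound (@block_index_sum _ _ s R) EF (ltW sigma0) tau0 NAbound Nbound.
have split3 (V : zmodType) (x y z : V) : x = y - z + (x - y + z).
  by rewrite [x - y + z]addrC addrA subrK addrC subrK.
have XEq : X = D *: (Us *m Us^T) - p%:M + E by exact: split3.
have kf : \tr (Us^T *m (D *: (Us *m Us^T) - p%:M + E) *m Us) <=
    \tr (U^T *m (D *: (Us *m Us^T) - p%:M + E) *m U).
  by rewrite -XEq; exact: ky_fan d0 XT topU UsUs.
have := subspace_perturbation ET UsUs UU D0 kapD Ekap (le_trans EUs b_le) kf.
move=> /le_trans; apply; rewrite le_eqVlt; apply/orP; left; apply/eqP.
by field; rewrite gt_eqF.
Qed.

Lemma recovery_error (U : 'M[R]_(\sum_(j < n) d, d)) (M : 'M[R]_d) :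
  top_eigenvectors X U -> is_anchor U M ->
  min_over_perms (fun Q => frobenius_norm (M - Q *m (U^T *m Us)^T)) <=
    Num.sqrt (768 * K) * q / Num.sqrt D.
Proof.
move=> topU [mu [muopt ME]]; have [UU _] := topU.
have q0 : 0 < q by rewrite /q ltr_pwDl ?sqrtr_gt0 ?ltr0n// mulr_ge0// ltW.
pose B := 128 * K * q ^+ 2 / D.
have B0 : 0 < B.
  apply: divr_gt0 (D0); apply: mulr_gt0; last exact: exprn_gt0.
  by apply: mulr_gt0 K0; rewrite ltr0n.
have B7 : 7 * B < 1.
  rewrite /B mulrA ltr_pdivrMr// mul1r; apply: le_lt_trans Dq.
  have := mulr_ge0 (ltW K0) (sqr_ge0 q); have := sqr_ge0 q; lra.
have [Q permQ QB] := anchor_matching (@block_index_sum _ _ s R) (block_labelK s) n0 B0 B7 UsE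
  UsUs UU (signal_eigenspace_error topU) muopt ME.
apply: (@le_trans _ _ (frobenius_norm (M - Q *m (U^T *m Us)^T))).
  by apply: ge_inf; [exists 0 => _ [? _ <-]; exact: sqrtr_ge0|exists Q].
have K768 : 0 <= 768 * K by apply: mulr_ge0 (ltW K0); exact: ler0n.
move: (sqrtr_ge0 (768 * K)) (sqr_sqrtr K768).
move: (Num.sqrt (768 * K)) => k k0 kE.
have k_ge0 : 0 <= k * q / Num.sqrt D.
  by rewrite divr_ge0 ?sqrtr_ge0// mulr_ge0// ltW.
rewrite -ler_sqr ?nnegrE//; last exact: sqrtr_ge0.
rewrite frobenius_sqn; apply: (le_trans QB).
rewrite expr_div_n exprMn kE (sqr_sqrtr (ltW D0)).
rewrite le_eqVlt; apply/orP; left; apply/eqP; rewrite /B; field.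
by rewrite gt_eqF.
Qed.

End Recovery.

Lemma finite_union_bound d (T : measurableType d) (R : realType) (P : probability T R)
    (I : eqType) (r : seq I) (B : I -> set T) (e : R) :
  (forall i, measurable (B i) /\ (P (~` B i) <= e%:E)%E) ->
  exists G, [/\ measurable G, forall w, G w -> forall i, i \in r -> B i w
    & (P (~` G) <= ((size r)%:R * e)%:E)%E].
Proof.
move=> BP; elim: r => [|i r [G [mG GB PG]]].
  by exists setT; split => //; rewrite setCT measure0 mul0r.
have [mB PB] := BP i; exists (B i `&` G); split.
- exact: measurableI.
- by move=> w [Bw Gw] k; rewrite inE => /predU1P[->//|kr]; exact: GB.
- rewrite setCI; apply: (le_trans (measureU2 _ _ _)); try exact: measurableC.
  apply: (le_trans (leeD PB PG)); rewrite -EFinD lee_fin /= -natr1 mulrDl mul1r.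
  by rewrite addrC.
Qed.

Theorem proposition1 (R : realType) :
  exists C1 C2 C3 : R,
    [/\ 0 < C1, 0 < C2, 0 < C3
      & forall (n d : nat) (p sigma : R) (Z : 'I_n -> 'M[R]_d)
          (dT : measure_display) (T : measurableType dT) (P : probability T R)
          (A : 'I_n -> 'I_n -> {RV P >-> bool})
          (W : 'I_n -> 'I_n -> 'I_d -> 'I_d -> {RV P >-> R})
          (U : T -> 'M[R]_(\sum_(j < n) d, d)) (M : T -> 'M[R]_d),
        (2 <= n)%N -> (0 < d)%N -> 0 < p <= 1 -> 0 < sigma ->
        (forall j, is_perm_mx (Z j)) ->
        perm_sync_noise A W p ->
        (forall w, top_eigenvectors (perm_sync_data A W sigma Z w) (U w)) ->
        (forall w, is_anchor (U w) (M w)) ->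
        n%:R * p / ln n%:R > C1 ->
        n%:R * p / (Num.sqrt d%:R + sigma * d%:R) ^+ 2 > C2 ->
        with_probability_at_least P (1 - n%:R ^- 10)
          [set w | let H := (U w)^T *m stacked_truth Z in
             min_over_perms (fun Q => frobenius_norm (M w - Q *m H^T))
               <= C3 * (Num.sqrt d%:R + sigma * d%:R) / Num.sqrt (n%:R * p)]].
Proof.
have [K K0 sparse] := sparse_matrix_bound R.
(* 18 is the ratio D / log n required by the matrix bound. 1024 K exceeds both the 256 K that makes
   the noise at most D / 8 and the 7 * 128 K that separates the centers; the extra 1 yields q^2 <=
   D. Finally 768 = 6 * 128, with 128 = 16 * 8 from the perturbation and signal bounds. *)
exists 18, (1024 * K + 1), (Num.sqrt (768 * K)); split.
- by rewrite ltr0n.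
- by apply: addr_gt0 ltr01; apply: mulr_gt0 K0; rewrite ltr0n.
- by rewrite sqrtr_gt0; apply: mulr_gt0 K0; rewrite ltr0n.
move=> n d p sigma Z dT T P A W U M n2 d0 p01 sigma0 permZ noise topU anchorM Dn Dq.
have /andP[p0 p1] := p01; have n0 : (0 < n)%N by exact: leq_trans n2.
pose q : R := Num.sqrt d%:R + sigma * d%:R.
have sd0 : 0 < sigma * d%:R by rewrite mulr_gt0// ltr0n.
have sqd : 0 <= Num.sqrt (d%:R : R) by exact: sqrtr_ge0.
have q0 : 0 < q by rewrite /q; lra.
have dq : d%:R <= q ^+ 2.
  have e : Num.sqrt d%:R ^+ 2 = d%:R :> R by rewrite sqr_sqrtr.
  by rewrite -[leLHS]e ler_pXn2r// ?nnegrE ?(ltW q0)// /q lerDl ltW.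
have d1 : 1 <= d%:R :> R by rewrite ler1n.
rewrite ltr_pdivlMr ?ln_gt0 ?ltr1n// in Dn.
rewrite -/q ltr_pdivlMr ?exprn_gt0// in Dq.
have qD : q ^+ 2 <= n%:R * p.
  by apply: le_trans (ltW Dq); have := mulr_ge0 (ltW K0) (sqr_ge0 q); lra.
have D1 : 1 <= n%:R * p by apply: le_trans (le_trans d1 dq) qD.
(* This limits the number of exceptional events: d^2 + 1 <= 2 n^2 <= n^3, which turns n^(-13) into
   n^(-10). *)
have dn : (d <= n)%N.
  rewrite -(ler_nat R); apply: le_trans (le_trans dq qD) _.
  by rewrite -[leRHS]mulr1 ler_wpM2l.
have /choice[s Zs] : forall j, exists u : 'S_d, Z j = perm_mx u.
  by move=> j; apply/is_perm_mxP; exact: permZ.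
pose N (i : option ('I_d * 'I_d)) : T -> 'M[R]_n :=
  if i is Some ac then gauged_gaussian_noise A W s ac.1 ac.2 else adjacency_noise p A.
have /choice[B BP] : forall i, exists B, [/\ measurable B,
    (P (~` B) <= (n%:R ^- 13 : R)%:E)%E & forall w, B w -> op_sq_bound (N i w) (K * (n%:R * p))].
  case=> [[a c]|]; apply: sparse => //; try exact: ltW.
  - exact: measurable_gaussian_noise.
  - exact: gaussian_noise_moments.
  - exact: measurable_adjacency_noise.
  - exact: adjacency_noise_moments noise.
have [i|G [mG GB PG]] := finite_union_bound (enum {: option ('I_d * 'I_d)})
  (B := B) (P := P) (e := n%:R ^- 13).
  by have [mB PB _] := BP i.
exists G; split=> //.
  move=> w Gw; have bound i : op_sq_bound (N i w) (K * (n%:R * p)).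
    by have [_ _] := BP i; apply; apply: GB => //; rewrite mem_enum.
  exact: (recovery_error n0 d0 p0 sigma0 Zs K0 Dq (bound None) (fun a c => bound (Some (a, c)))
    (topU w) (anchorM w)).
have nR : 0 < n%:R :> R by rewrite ltr0n.
have size_le : (size (enum {: option ('I_d * 'I_d)}))%:R * n%:R ^- 13 <= n%:R ^- 10 :> R.
  rewrite -cardE card_option card_prod card_ord ler_pdivrMr ?exprn_gt0//.
  rewrite -[13%N]/(10 + 3)%N exprD mulKf ?gt_eqF ?exprn_gt0//.
  rewrite -natrX ler_nat; have dd := leq_mul dn dn.
  apply: (@leq_trans (2 * (n * n))); last by rewrite expnS leq_mul.
  by rewrite mul2n -addnn -addn1 leq_add// (leq_trans (isT : 1 <= 2 * 2)%N)// leq_mul.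
have : (1 - P G <= (n%:R ^- 10)%:E)%E.
  by rewrite -probability_setC//; apply: le_trans PG _; rewrite lee_fin.
rewrite -[P G]fineK ?fin_num_measure// -EFinB !lee_fin; lra.
Qed.
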